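(* Let the setting, notation and objects $H,U,\mathbb{H},\mathbb{U},T,\gamma,\delta,\lambda,(\Omega,\mathcal{F},\mathbb{P},(\mathcal{F}_t)_{t\in[0,T]}),W,A,H_r,\xi,F,B,D=(D^I_h),P_I,\hat P_J$ be as fixed in the context. Let $\rho\in[0,\infty)$, $c,\iota\in[1,\infty)$, $\varsigma\in\big(0,\tfrac{1-14\delta}{2+2\iota}\big)$, $V\in\mathcal{C}^3_c(H,[0,\infty))$, $\bar V\in\mathcal{C}(H,\mathbb{R})$. Assume for all $h\in(0,T]$, $x,y\in H$ that $$V(e^{hA}x)\le V(x),\qquad \bar V(e^{hA}x)\le\bar V(x),\qquad |\bar V(x)-\bar V(y)|\le c\,(1+|V(x)|^\iota+|V(y)|^\iota)\,\|x-y\|_H,$$ $$|\bar V(x)|\le c\,(1+|V(x)|^\iota),\qquad \sup_{I\in\mathcal{P}_0(\mathbb{H})}\mathbb{E}\big[e^{V(P_I\xi)}\big]<\infty .$$ Assume for all $I\in\mathcal{P}_0(\mathbb{H})$, $J\in\mathcal{P}_0(\mathbb{U})$, $h\in(0,T]$, $x\in D^I_h$ that $D^I_h\subseteq\{v\in H: V(v)\le c\,h^{-\varsigma}\}$, that $\max\{\|P_IF(x)\|_H,\|P_IB(x)\hat P_J\|_{\mathrm{HS}(U,H)}\}\le c\,h^{-\delta}$, and that $$(\mathcal{G}_{P_IF,\,P_IB\hat P_J}V)(x)+\tfrac12\big\|(P_IB(x)\hat P_J)^*(\nabla V)(x)\big\|_U^2+\bar V(x)\le\rho\,V(x).$$ Let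 $Y^{\theta,I,J}\colon[0,T]\times\Omega\to P_I(H_\gamma)$, $\theta\in\varpi_T$, $I\in\mathcal{P}_0(\mathbb{H})$, $J\in\mathcal{P}_0(\mathbb{U})$, be $(\mathcal{F}_t)_{t\in[0,T]}$-adapted stochastic processes with continuous sample paths which satisfy for all $\theta\in\varpi_T$, $I\in\mathcal{P}_0(\mathbb{H})$, $J\in\mathcal{P}_0(\mathbb{U})$, $t\in(0,T]$ that $Y^{\theta,I,J}_0=P_I(\xi)$ and, $\mathbb{P}$-almost surely, $$Y^{\theta,I,J}_t=e^{(t-\llcorner t\lrcorner_\theta)A}\Big(Y^{\theta,I,J}_{\llcorner t\lrcorner_\theta}+\mathbf 1_{D^I_{|\theta|_T}}(Y^{\theta,I,J}_{\llcorner t\lrcorner_\theta})\,P_IF(Y^{\theta,I,J}_{\llcorner t\lrcorner_\theta})\,(t-\llcorner t\lrcorner_\theta)\Big)+\frac{\int_{\llcorner t\lrcorner_\theta}^t e^{(t-\llcorner t\lrcorner_\theta)A}\,\mathbf 1_{D^I_{|\theta|_T}}(Y^{\theta,I,J}_{\llcorner t\lrcorner_\theta})\,P_IB(Y^{\theta,I,J}_{\llcorner t\lrcorner_\theta})\hat P_J\,dW_s}{1+\big\|\int_{\llcorner t\lrcorner_\theta}^tP_IB(Y^{\theta,I,J}_{\llcorner t\lrcorner_\theta})\hat P_J\,dW_s\big\|_H^2}.$$ Then $$\limsup_{|\theta|_T\searrow0}\ \sup_{I\in\mathcal{P}_0(\mathbb{H})}\ \sup_{J\in\mathcal{P}_0(\mathbb{U})}\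 \sup_{t\in[0,T]}\mathbb{E}\Big[\exp\Big(\tfrac{V(Y^{\theta,I,J}_t)}{e^{\rho t}}+\int_0^t\mathbf 1_{D^I_{|\theta|_T}}(Y^{\theta,I,J}_{\lfloor s\rfloor_\theta})\tfrac{\bar V(Y^{\theta,I,J}_s)}{e^{\rho s}}\,ds\Big)\Big]\le\sup_{I\in\mathcal{P}_0(\mathbb{H})}\mathbb{E}\big[e^{V(P_I\xi)}\big]$$ $$\le\sup_{\theta\in\varpi_T}\ \sup_{I\in\mathcal{P}_0(\mathbb{H})}\ \sup_{J\in\mathcal{P}_0(\mathbb{U})}\ \sup_{t\in[0,T]}\mathbb{E}\Big[\exp\Big(\tfrac{V(Y^{\theta,I,J}_t)}{e^{\rho t}}+\int_0^t\mathbf 1_{D^I_{|\theta|_T}}(Y^{\theta,I,J}_{\lfloor s\rfloor_\theta})\tfrac{\bar V(Y^{\theta,I,J}_s)}{e^{\rho s}}\,ds\Big)\Big]<\infty.$$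
   Context: Setting. $(H,\langle\cdot,\cdot\rangle_H,\|\cdot\|_H)$ and $(U,\langle\cdot,\cdot\rangle_U,\|\cdot\|_U)$ are separable real Hilbert spaces; $\mathbb{H}\subseteq H$ and $\mathbb{U}\subseteq U$ are non-empty orthonormal bases of $H$ and $U$. $T\in(0,\infty)$, $\gamma\in[0,\infty)$, $\delta\in[0,\tfrac1{14})$, and $\lambda\colon\mathbb{H}\to\mathbb{R}$, $h\mapsto\lambda_h$, satisfies $\sup_{h\in\mathbb{H}}\lambda_h<0$. $(\Omega,\mathcal{F},\mathbb{P},(\mathcal{F}_t)_{t\in[0,T]})$ is a filtered probability space and $(W_t)_{t\in[0,T]}$ is an $\mathrm{Id}_U$-cylindrical $(\mathcal{F}_t)_{t\in[0,T]}$-Wiener process. $A\colon D(A)\subseteq H\to H$ is the linear operator with $D(A)=\{w\in H:\sum_{h\in\mathbb{H}}|\lambda_h\langle h,w\rangle_H|^2<\infty\}$ and $Av=\sum_{h\in\mathbb{H}}\lambda_h\langle h,v\rangle_Hh$ for $v\in D(A)$. $(H_r,\langle\cdot,\cdot\rangle_{H_r},\|\cdot\|_{H_r})$, $r\in\mathbb{R}$, is the family of interpolation spaces associated to $-A$; for $r\ge0$: $H_r=D((-A)^r)=\{v\in H:\sum_{h\in\mathbb{H}}|\lambda_h|^{2r}|\langle h,v\rangle_H|^2<\infty\}$ and $\|v\|_{H_r}=\|(-A)^rv\|_H$. $\xi\colon\Omega\to H_\gamma$ is $\mathcal{F}_0/\mathcal{B}(H_\gamma)$-measurable; $F\colon H_\gamma\to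 H$ and $B\colon H_\gamma\to\mathrm{HS}(U,H)$ are Borel measurable; $D^I_h\in\mathcal{B}(H_\gamma)$ for every subset $I\subseteq\mathbb{H}$ and $h\in(0,T]$. For $I\subseteq\mathbb{H}$, $J\subseteq\mathbb{U}$: $P_I\in L(H)$, $P_I(x)=\sum_{h\in I}\langle h,x\rangle_Hh$, and $\hat P_J\in L(U)$, $\hat P_J(y)=\sum_{u\in J}\langle u,y\rangle_Uu$. Notation. $\mathrm{HS}(U,H)$: Hilbert–Schmidt operators from $U$ to $H$ with the Hilbert–Schmidt norm. $\mathcal{B}(X)$: Borel sigma-algebra of $X$. $\mathcal{P}_0(X)$: the set of all finite subsets of $X$. $\mathbf 1_A(x)=1$ if $x\in A$, and $0$ otherwise. $\varpi_T$: the set of all finite $\theta\subseteq[0,T]$ with $\{0,T\}\subseteq\theta$; $|\theta|_T\in(0,T]$ is the maximal distance between two consecutive points of $\theta$. For $t\in(0,T]$: $\lfloor t\rfloor_\theta=\max([0,t]\cap\theta)$, $\llcorner t\lrcorner_\theta=\max([0,t)\cap\theta)$, and $\lfloor0\rfloor_\theta=\llcorner0\lrcorner_\theta=0$. For $\mathcal{H}\subseteq H$, $F\colon\mathcal{H}\to H$, $B\colon\mathcal{H}\to\mathrm{HS}(U,H)$, $\phi\in\mathcal{C}^2(H,\mathbb{R})$, $x\in\mathcal{H}$: $(\mathcal{G}_{F,B}\phi)(x)=\langle F(x),(\nabla\phi)(x)\rangle_H+\tfrac12\operatorname{trace}_H\big(B(x)B(x)^*(\operatorname{Hess}\phi)(x)\big)$.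 Here $P_IF$ and $P_IB\hat P_J$ denote $x\mapsto P_I(F(x))$ and $x\mapsto P_IB(x)\hat P_J$ on $H_\gamma$. For $n\in\mathbb{N}$, $c\in[1,\infty)$, $S\subseteq\mathbb{R}$: $\mathcal{C}^n_c(H,S)$ is the set of all $f\in\mathcal{C}^{n-1}(H,S)$ such that for all $x,y\in H$, $i\in\{0,1,\dots,n-1\}$: $\|f^{(i)}(x)-f^{(i)}(y)\|_{L^{(i)}(H,\mathbb{R})}\le c\|x-y\|_H\big(1+\sup_{r\in[0,1]}|f(rx+(1-r)y)|\big)^{1-1/c}$, where $L^{(i)}(H,\mathbb{R})$ is the space of continuous $i$-linear maps $H^i\to\mathbb{R}$ with its usual operator norm and $L^{(0)}(H,\mathbb{R})=\mathbb{R}$. *)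

(* Defs.v *)
From mathcomp Require Import all_boot all_order all_algebra sesquilinear.
From mathcomp Require Import all_classical all_reals all_analysis.
Set Implicit Arguments.
Unset Strict Implicit.
Unset Printing Implicit Defensive.
Import Order.TTheory GRing.Theory Num.Theory.
Import numFieldNormedType.Exports.

Local Open Scope classical_set_scope.
Local Open Scope ring_scope.

(* A real Hilbert space is a completeNormedModType together with a dot form
   ip satisfying [hilbert_norm ip]. *)
Definition hilbert_norm (R : realType) (E : completeNormedModType R)
  (ip : {dot E for idfun}) := forall x : E, ip x x = `|x| ^+ 2.

Definition separable_space (E : topologicalType) :=
  exists S : set E, countable S /\ dense S.

Definition linspan (R : realType) (E : normedModType R) (S : set E) : set E :=
  [set v | exists A (a : E -> R), fsets S A /\ v = \sum_(h \in A) a h *: h].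

Definition orthonormal_basis (R : realType) (E : normedModType R)
    (ip : {dot E for idfun}) (S : set E) :=
  (forall x y, S x -> S y -> ip x y = (x == y)%:R) /\ dense (linspan S).

(* Unordered sum over S: limit of the partial sums along the finite subsets of
   S directed by inclusion. *)
Definition usum (R : realType) (I : choiceType) (E : normedModType R)
    (S : set I) (f : I -> E) : E :=
  lim ((fun A : set I => \sum_(i \in A) f i) @
       filter_from (fsets S) (fun A => [set C | fsets S C /\ A `<=` C])).

(* Orthogonal projection onto the closed span of the orthonormal set I. *)
Definition orthoproj (R : realType) (E : normedModType R) (ip : {dot E for idfun})
  (I : set E) (x : E) : E := usum I (fun h => ip h x *: h).

Section diagonal_operator.
Context (R : realType) (H : normedModType R) (ip : {dot H for idfun}).
Variables (HH : set H) (lam : H -> R).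

(* f(A) for the diagonal operator A = sum_(h in HH) lam h <h, .> h; thus A
   itself is [fcalc id] on the domain [interp 1]. *)
Definition fcalc (f : R -> R) (v : H) : H :=
  usum HH (fun h => (f (lam h) * ip h v) *: h).

(* e^{tA} *)
Definition semigroup (t : R) : H -> H := fcalc (fun l => expR (t * l)).

(* H_r = D((-A)^r), r >= 0, as a subset of H, and its norm |(-A)^r v|_H *)
Definition interp (r : R) : set H :=
  [set v | (\esum_(h in HH) (`|lam h| `^ (2 * r) * `|ip h v| ^+ 2)%:E < +oo)%E].

Definition interp_norm (r : R) (v : H) : R :=
  `|fcalc (fun l => (- l) `^ r) v|.

Definition interp_dist (r : R) (v w : H) : R := interp_norm r (v - w).

End diagonal_operator.

Section borel.
Context (R : realType).

(* Sets that are open in the metric space (D, d), D a subset of X. *)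
Definition metric_open (X : Type) (D : set X) (d : X -> X -> R) :
    set (set X) :=
  [set O | O `<=` D /\ forall x, O x ->
     exists2 e, 0 < e & forall y, D y -> d x y < e -> O y].

Definition borel_on (X : Type) (D : set X) (d : X -> X -> R) : set (set X) :=
  <<s D, metric_open D d >>.

Definition norm_dist (E : normedModType R) (x y : E) : R := `|x - y|.

(* f restricted to D is Borel measurable from (D, d) to (E, e); the values of f
   outside D are irrelevant. *)
Definition borel_measurable_on (X Z : Type) (D : set X) (d : X -> X -> R)
    (E : set Z) (e : Z -> Z -> R) (f : X -> Z) :=
  (forall x, D x -> E (f x)) /\
  (forall S, borel_on E e S -> borel_on D d (D `&` f @^-1` S)).

(* X : Omega -> E is G/B(E)-measurable. *)
Definition random_element (Omega Z : Type) (G : set (set Omega))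
    (E : set Z) (e : Z -> Z -> R) (X : Omega -> Z) :=
  (forall w, E (X w)) /\ (forall S, borel_on E e S -> G (X @^-1` S)).

End borel.

Section operators.
Context (R : realType) (U H : normedModType R).
Variables (ipU : {dot U for idfun}) (ipH : {dot H for idfun}).
Variables (UU : set U) (HH : set H).

Definition hs_norm2 (L : U -> H) : \bar R :=
  (\esum_(u in UU) (`|L u| ^+ 2)%:E)%E.

(* HS(U, H); the Hilbert-Schmidt norm is computed in the orthonormal basis UU *)
Definition hilbert_schmidt : set (U -> H) :=
  [set L | [/\ linear L, continuous L & (hs_norm2 L < +oo)%E]].

Definition hs_norm (L : U -> H) : R := Num.sqrt (fine (hs_norm2 L)).

Definition hs_dist (L M : U -> H) : R := hs_norm (fun u => L u - M u).

Definition adjoint (L : U -> H) (x : H) : U :=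
  xget 0 [set y | forall u, ipU u y = ipH (L u) x].

Definition trace (L : H -> H) : R := usum HH (fun h => ipH h (L h) : R).

(* Riesz representative of the Frechet derivative *)
Definition grad (f : H -> R) (x : H) : H :=
  xget 0 [set g | forall v, ipH g v = 'd f x v].

Definition hess (f : H -> R) (x : H) : H -> H := 'd (grad f) x.

Definition generator (F : H -> H) (B : H -> U -> H) (phi : H -> R) (x : H) : R :=
  ipH (F x) (grad phi x) +
  2^-1 * trace (fun h => B x (adjoint (B x) (hess phi x h))).

End operators.

Section smooth_functions.
Context (R : realType) (H : normedModType R).

Fixpoint nderive (f : H -> R) (vs : seq H) : H -> R :=
  if vs is v :: vs' then 'D_v (nderive f vs') else f.

(* f^(i)(x) as a function of its i arguments; the first one is the direction of
   the last differentiation.  It is the i-th Frechet derivative when f is C^i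
   in the sense of [is_Cn] below. *)
Definition nth_deriv (f : H -> R) (i : nat) (x : H) (v : i.-tuple H) : R :=
  nderive f v x.

Definition mform_norm (i : nat) (M : i.-tuple H -> R) : \bar R :=
  ereal_sup [set `|M v|%:E | v in [set v | forall k, `|tnth v k| <= 1]].

Definition tupd (i : nat) (v : i.-tuple H) (k : 'I_i) (z : H) : i.-tuple H :=
  [tuple if j == k then z else tnth v j | j < i].

(* M belongs to L^(i)(H, R) *)
Definition bounded_multilinear (i : nat) (M : i.-tuple H -> R) :=
  (forall v k a y z,
     M (tupd v k (a *: y + z)) = a * M (tupd v k y) + M (tupd v k z)) /\
  (mform_norm M < +oo)%E.

(* C^n(H, R): for i < n the map f^(i) : H -> L^(i)(H, R) is Frechet
   differentiable with derivative f^(i+1), and f^(i) is continuous for i <= n. *)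
Definition is_Cn (n : nat) (f : H -> R) :=
  [/\ forall i x, (i <= n)%N -> bounded_multilinear (@nth_deriv f i x),
      forall i x (e : R), (i < n)%N -> 0 < e ->
        \forall v \near (0 : H),
          (mform_norm (fun w : i.-tuple H =>
             (nth_deriv f (x + v) w - nth_deriv f x w
                - nth_deriv f x [tuple of v :: w])%R)
           <= (e * `|v|)%:E)%E
    & forall i x (e : R), (i <= n)%N -> 0 < e ->
        \forall y \near x,
          (mform_norm (fun w : i.-tuple H => nth_deriv f y w - nth_deriv f x w)%R
           <= e%:E)%E].

(* C^n_c(H, S), n >= 1 *)
Definition Cnc (n : nat) (c : R) (S : set R) (f : H -> R) :=
  [/\ is_Cn n.-1 f, forall x, S (f x)
    & forall x y i, (i < n)%N ->
        (mform_norm (fun w : i.-tuple H => nth_deriv f x w - nth_deriv f y w)%R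
         <= (c * `|x - y| *
             (1 + sup [set `|f (r *: x + (1 - r) *: y)| | r in `[0, 1]])
               `^ (1 - c^-1))%:E)%E].

End smooth_functions.

Section time_grids.
Context (R : realType).

Definition grids (T : R) : set (set R) :=
  [set th | [/\ finite_set th, th `<=` `[0, T], th 0 & th T]].

Definition mesh (th : set R) : R :=
  sup [set l | exists a b, [/\ th a, th b, a < b,
    (forall x, th x -> ~ (a < x < b)) & l = b - a]].

(* The suprema below are maxima, since grids are finite. *)
Definition grid_floor (th : set R) (t : R) : R :=
  if t == 0 then 0 else sup (`[0, t] `&` th).

Definition grid_lfloor (th : set R) (t : R) : R :=
  if t == 0 then 0 else sup (`[0, t[ `&` th).

(* limsup of G(th) as mesh th decreases to 0 over the grids th of [0, T] *)
Definition mesh_limsup (T : R) (G : set R -> \bar R) : \bar R :=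
  ereal_inf [set ereal_sup [set G th | th in [set th | grids T th /\ mesh th < e]]
            | e in [set e : R | 0 < e]].

End time_grids.

Section stochastics.
Context (R : realType) (d : measure_display) (Omega : measurableType d).
Variables (P : probability Omega R) (T : R) (FF : R -> set (set Omega)).

Definition filtration :=
  (forall t, 0 <= t <= T ->
     sigma_algebra setT (FF t) /\ FF t `<=` measurable) /\
  (forall s t, 0 <= s -> s <= t -> t <= T -> FF s `<=` FF t).

Context (U H : normedModType R).
Variables (ipU : {dot U for idfun}) (UU : set U).

(* W t u stands for <u, W_t>.  By [wiener_increments], along every finite
   orthonormal family u the process (W . (u i))_i is a standard Brownian motion
   with respect to the filtration. *)
Record cylindrical_wiener (W : R -> U -> Omega -> R) : Prop := {
  wiener_start : forall u, {ae P, forall w, W 0 u w = 0};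
  wiener_linear : forall t a u v, 0 <= t <= T ->
    {ae P, forall w, W t (a *: u + v) w = a * W t u w + W t v w};
  wiener_adapted : forall t u (S : set R), 0 <= t <= T -> measurable S ->
    FF t (W t u @^-1` S);
  wiener_continuous : forall u,
    {ae P, forall w, {within `[0, T], continuous (fun t => W t u w)}};
  wiener_increments : forall s t n (u : 'I_n -> U) (A : set Omega)
      (S : 'I_n -> set R),
    0 <= s -> s < t -> t <= T ->
    (forall i j, ipU (u i) (u j) = (i == j)%:R) ->
    FF s A -> (forall i, measurable (S i)) ->
    P (A `&` [set w | forall i, S i (W t (u i) w - W s (u i) w)]) =
    (P A * \prod_(i < n) normal_prob 0 (Num.sqrt (t - s)) (S i))%E }.

(* Ito integral over (s, t] of the integrand that is constantly equal to the
   F_s-measurable random operator Phi, i.e. Phi (W_t - W_s) expanded in the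
   basis UU.  Meaningful when Phi vanishes on all but finitely many elements of
   UU (outside of this case the finitely supported sum is 0). *)
Definition elementary_ito (W : R -> U -> Omega -> R) (Phi : Omega -> U -> H)
    (s t : R) (w : Omega) : H :=
  \sum_(u \in UU) (W t u w - W s u w) *: Phi w u.

End stochastics.

(* To be used with D = D^I_h, h = mesh th, and Y = Y^{th,I,J}. *)
Definition exp_moment (R : realType) (d : measure_display)
    (Omega : measurableType d) (P : probability Omega R) (H : Type)
    (rho : R) (V Vbar : H -> R) (D : set H) (th : set R) (Y : R -> Omega -> H)
    (t : R) : \bar R :=
  ('E_P[fun w => (expR (V (Y t w) / expR (rho * t) +
     \int[lebesgue_measure]_(s in `[0, t])
       (\1_D (Y (grid_floor th s) w) * (Vbar (Y s w) / expR (rho * s)))))%R])%E.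

(* Main.v *)
(* On one step of the grid, started at X = Y_s in D with z = B(X) dW, the scheme
   is Y_t = S (X + Dl f + z / (1 + |z|^2)).  Since S decreases V and Vbar, a
   second order Taylor expansion of V, whose derivatives are at most a small
   negative power of h on D, bounds the increment of the exponent by
   a + q + r, where a = p V'(X) z - p Dl |B(X)^* V'(X)|^2 / 2, q is a quadratic
   form in z with conditional mean 0, and r is a remainder.  Hence
   e^(a+q+r) <= e^a + q + Dl om(h) e^(|z|^2 / (4 tau^2)) up to constants, with
   om(h) -> 0.  Conditionally on F_s, z is Gaussian, so that E e^a <= 1 and the
   last exponential has bounded expectation: the exponential moment grows by at
   most the factor 1 + 6 Dl om(h) per step.  The time integral of Vbar is
   replaced by Riemann sums, to which Jensen applies, and is recovered by Fatou.
   Induction over the grid points gives the factor e^(6 T om(h)). *)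

(* The obstacle is the quadratic part: [q] is of order [L tau^2], which is not o(Dl), so it cannot
   be counted as an error. It must stay outside the exponential with a coefficient fixed before the
   noise is drawn, for only then does its mean vanish; hence the pointwise form [e^a + q + ...] of
   the one-step bound. The second obstacle is integrability: [q] and [r] are bounded by polynomials
   of degree 2 and 3 in [|z| / tau], too large to be exponentiated. Their sum grows only linearly,
   because taming keeps the displacement in a ball on which V is Lipschitz, and the exponential of a
   linear function is absorbed by [e^(|z|^2 / (4 tau^2))]. The constants do not depend on I and J,
   since Jensen over the coordinates of z uses only the Hilbert-Schmidt bound. No conditional
   expectation is formed: coefficients and increments are evaluated at two independent sample
   points, and the integral over the second is estimated with the first one fixed. In
   [1 + 6 Dl om(h)], 4 comes from the noise at t and 2 from the noise at a node of the time
   integral. *)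
Require Import Defs.
From mathcomp Require Import all_boot all_order all_algebra sesquilinear finmap.
From mathcomp Require Import all_classical all_reals all_analysis.
From mathcomp Require Import measurable_realfun ring lra.
From HB Require Import structures.
Set Implicit Arguments.
Unset Strict Implicit.
Unset Printing Implicit Defensive.
Import Order.TTheory GRing.Theory Num.Theory.
Import numFieldNormedType.Exports.

Local Open Scope classical_set_scope.
Local Open Scope ring_scope.

(** * Hilbert spaces *)

(** First-order condition at a minimum. The test value [- b / (1 + a)] covers [a = 0] as well. *)
Lemma quadratic_ge0_eq0 (R : realType) (a b : R) :
  0 <= a -> (forall t, 0 <= t * b + t ^+ 2 * a) -> b = 0.
Proof.
move=> a0 h; have a1 : 0 < 1 + a by lra.
have := h (- b / (1 + a)).
have -> : - b / (1 + a) * b + (- b / (1 + a)) ^+ 2 * a = - (b / (1 + a)) ^+ 2.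
  by field; rewrite gt_eqF.
rewrite oppr_ge0 => h1; apply/eqP.
have : (b / (1 + a)) ^+ 2 == 0 by rewrite eq_le h1 sqr_ge0.
by rewrite sqrf_eq0 mulf_eq0 invr_eq0 (gt_eqF a1) orbF.
Qed.

Section hilbert.
Context (R : realType) (E : completeNormedModType R) (ip : {dot E for idfun}).
Hypothesis hip : hilbert_norm ip.
Implicit Types x y z u v w : E.

Lemma ipC x y : ip x y = ip y x.
Proof. by rewrite hermC /= expr0 mul1r. Qed.

Lemma ipDl x y z : ip (x + y) z = ip x z + ip y z.
Proof. exact: linearDl. Qed.

Lemma ipDr x y z : ip z (x + y) = ip z x + ip z y.
Proof. exact: linearDr. Qed.

Lemma ipZl a x z : ip (a *: x) z = a * ip x z.
Proof. exact: linearZl_LR. Qed.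

Lemma ipZr a x z : ip z (a *: x) = a * ip z x.
Proof. by rewrite ipC ipZl ipC. Qed.

Lemma ip0l z : ip 0 z = 0. Proof. exact: linear0l. Qed.
Lemma ip0r z : ip z 0 = 0. Proof. exact: linear0r. Qed.

Lemma ipBl x y z : ip (x - y) z = ip x z - ip y z.
Proof. exact: linearBl. Qed.

Lemma ipBr x y z : ip z (x - y) = ip z x - ip z y.
Proof. exact: linearBr. Qed.

Lemma ip_sumr (I : Type) (r : seq I) (P : pred I) (f : I -> E) z :
  ip z (\sum_(i <- r | P i) f i) = \sum_(i <- r | P i) ip z (f i).
Proof. exact: linear_sumr. Qed.

Lemma ip_suml (I : Type) (r : seq I) (P : pred I) (f : I -> E) z :
  ip (\sum_(i <- r | P i) f i) z = \sum_(i <- r | P i) ip (f i) z.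
Proof. by rewrite ipC ip_sumr; apply: eq_bigr => i _; rewrite ipC. Qed.

Lemma normD2 x y : `|x + y| ^+ 2 = `|x| ^+ 2 + 2 * ip x y + `|y| ^+ 2.
Proof. by rewrite -!hip !ipDl !ipDr (ipC y x); ring. Qed.

Lemma parallelogram x y :
  `|x - y| ^+ 2 + `|x + y| ^+ 2 = 2 * (`|x| ^+ 2 + `|y| ^+ 2).
Proof.
rewrite !normD2 -scaleN1r ipZr normrZ normrN normr1; ring.
Qed.

(** Cauchy-Schwarz: expand the square of the norm of [|y| x - |x| y], after normalising the sign of
    the product. *)
Lemma ip_le x y : `|ip x y| <= `|x| * `|y|.
Proof.
wlog: x / 0 <= ip x y => [h|].
  case: (leP 0 (ip x y)) => [/h //|/ltW xy].
  by have := h (- x); rewrite -scaleN1r ipZl mulN1r oppr_ge0 !normrN scaleN1r normrN; apply.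
move=> xy0; rewrite ger0_norm //.
have [->|y0] := eqVneq y 0; first by rewrite ip0r normr0 mulr0.
have [->|x0] := eqVneq x 0; first by rewrite ip0l normr0 mul0r.
pose a : R := `|x|; pose b : R := `|y|.
have nx : 0 < a by rewrite normr_gt0.
have ny : 0 < b by rewrite normr_gt0.
have := sqr_ge0 (`| b *: x + (- a) *: y| : R).
rewrite normD2 ipZl ipZr !normrZ normrN -/a -/b (gtr0_norm nx) (gtr0_norm ny) => h.
have : 0 <= (a * b) * (a * b - ip x y).
  rewrite -(pmulr_rge0 _ (ltr0n R 2)); apply: le_trans h _.
  by rewrite le_eqVlt; apply/orP; left; apply/eqP; ring.
by rewrite pmulr_rge0 ?mulr_gt0 // subr_ge0; apply.
Qed.

Lemma ip_ext x y : (forall v, ip x v = ip y v) -> x = y.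
Proof.
move=> h; apply/subr0_eq/eqP; rewrite -normr_eq0 -sqrf_eq0 -hip.
by rewrite ipBl h subrr.
Qed.

Lemma norm_riesz_le g (M : R) : 0 <= M -> (forall v, `|ip g v| <= M * `|v|) -> `|g| <= M.
Proof.
move=> M0 h; have := h g; rewrite hip normrX normr_id expr2.
have [->|g0] := eqVneq g 0; first by rewrite normr0.
by rewrite ler_pM2r // normr_gt0.
Qed.

(* The representative minimises [x |-> |x|^2 - 2 f x]; the parallelogram law
   makes minimising sequences Cauchy. *)
Lemma riesz (f : {linear E -> R}) (M : R) :
  (forall v, `|f v| <= M * `|v|) -> exists g, forall v, ip g v = f v.
Proof.
move=> fM.
pose J x : R := `|x| ^+ 2 - 2 * f x.
have fZ a x : f (a *: x) = a * f x by rewrite linearZ.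
have fD x y : f (x + y) = f x + f y by rewrite linearD.
have fB x y : f (x - y) = f x - f y by rewrite linearB.
have fle x : f x <= M * `|x| by exact: le_trans (ler_norm _) (fM x).
have Jlb x : - M ^+ 2 <= J x.
  have := fle x; have := sqr_ge0 (`|x| - M); rewrite /J => h1 h2.
  nra.
have Jinf : has_inf (range J).
  by split; [exists (J 0), 0|exists (- M ^+ 2) => _ [x _ <-]].
pose m := inf (range J).
have mJ x : m <= J x by apply: ge_inf; [exact: Jinf.2|exists x].
have mid x y : `|x - y| ^+ 2 <= 2 * (J x - m) + 2 * (J y - m).
  have := mJ (2^-1 *: (x + y)); rewrite {1}/J normrZ exprMn fZ fD.
  have := parallelogram x y; rewrite /J ger0_norm ?invr_ge0 //.
  set u := `|x + y|; set v := `|x - y|.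
  move=> h1.
  have -> : (2^-1 : R) ^+ 2 * u ^+ 2 = u ^+ 2 / 4 by field.
  have -> : 2 * (2^-1 * (f x + f y)) = f x + f y by field.
  move: (u ^+ 2) (v ^+ 2) h1 => a b h1 h2; lra.
have ex n : exists x, J x < m + n.+1%:R^-1.
  have n0 : 0 < n.+1%:R^-1 :> R by rewrite invr_gt0.
  by have [_ [x _ <-] xm] := inf_adherent n0 Jinf; exists x.
pose u n := xchoose (ex n).
have uP n : J (u n) < m + n.+1%:R^-1 by exact: (xchooseP (ex n)).
have cu : cauchy_ex (u @ \oo).
  move=> _/posnumP[e].
  have e4 : 0 < e%:num ^+ 2 / 4 by rewrite divr_gt0 // exprn_gt0.
  have [N _ HN] : \forall n \near \oo, n.+1%:R^-1 < e%:num ^+ 2 / 4 :> R.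
    exact: near_infty_natSinv_lt (PosNum e4).
  exists (u N), N => // n /= Nn.
  rewrite -ball_normE /= -(@ltr_pXn2r _ 2) ?nnegrE //.
  apply: le_lt_trans (mid _ _) _.
  have := uP N; have := uP n; have := HN _ (leqnn N); have := HN n Nn.
  rewrite /=; move: (J (u n)) (J (u N)) (n.+1%:R^-1 : R) (N.+1%:R^-1 : R) (e%:num ^+ 2 : R).
  by move=> *; lra.
have cvu : cvg (u @ \oo).
  by apply: cauchy_cvg; apply: cauchy_exP.
pose g := lim (u @ \oo); exists g => v.
have Jg : J g <= m.
  suff H (e : R) : 0 < e -> J g <= m + e by apply/ler_addgt0Pr.
  move=> e0.
  have [N _ HN] : \forall n \near \oo, n.+1%:R^-1 < e / 2 :> R.
    exact: near_infty_natSinv_lt (PosNum (divr_gt0 e0 (ltr0n _ 2))).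
  have KM : 0 < `|M| + `|g| + 1 by rewrite ltr_wpDl ?addr_ge0.
  pose K : R := `|M| + `|g| + 1.
  (* J at g exceeds J at a point at distance d by at most [2 (|g| + |M|) d]; half of e pays for this
     and half for the minimising sequence. *)
  have d0 : 0 < e / (4 * K) by rewrite divr_gt0 // mulr_gt0.
  move/cvgrPdist_lt : cvu => /(_ _ d0)[N' _ HN'].
  have := HN (maxn N N') (leq_maxl _ _); have := HN' (maxn N N') (leq_maxr _ _).
  have := uP (maxn N N'); set x := u _.
  have := fM (g - x); rewrite -/g fB /J.
  have : `|g| <= `|x| + `|g - x| by rewrite -lerBlDl (le_trans _ (lerB_dist _ _)).
  set r := _%:R^-1; have := normr_ge0 x; have := normr_ge0 (g - x).
  set a := `|g|; set b := `|x|; set dd := `|g - x| => dd0 b0 ab.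
  rewrite ltr_pdivlMr ?mulr_gt0 // => h1 h2 h3 h4.
  have a0 : 0 <= a by exact: normr_ge0.
  have M1 : M <= `|M| by exact: ler_norm.
  have : a ^+ 2 - b ^+ 2 <= 2 * a * dd.
    have [ba|ba] := leP b a; first by nra.
    by apply: (@le_trans _ _ 0); nra.
  have h5 : - 2 * (f g - f x) <= 2 * (`|M| * dd).
    have := ler_norm (- (f g - f x)); rewrite normrN.
    have : M * dd <= `|M| * dd by exact: ler_wpM2r.
    lra.
  move: h2 h3 h5; rewrite /K -/a; set MM : R := `|M|; move: (f g) (f x) => *; lra.
(* First variation: g minimises J, in particular along the line [g + t v]. *)
suff h t : 0 <= t * (2 * (ip g v - f v)) + t ^+ 2 * `|v| ^+ 2.
  have := quadratic_ge0_eq0 (sqr_ge0 `|v|) h.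
  by move/eqP; rewrite mulf_eq0 pnatr_eq0 /= subr_eq0 => /eqP.
have := le_trans Jg (mJ (g + t *: v)).
rewrite /J normD2 ipZr fD fZ normrZ exprMn real_normK ?num_real //.
move: (ip g v) (f v) (f g) (`|g| ^+ 2 : R) (`|v| ^+ 2 : R) => a b c d e *; lra.
Qed.

End hilbert.

(** * Functions of class C^3_c *)

Section frechet.
Context (R : realType) (E W : normedModType R).

Lemma norm_bounded_continuous (l : {linear E -> W}) (M : R) :
  (forall v, `|l v| <= M * `|v|) -> continuous l.
Proof.
move=> lM; apply/linear_bounded_continuous; apply/linear_boundedP.
exists `|M|; split; first exact: num_real.
move=> B MB x; apply: le_trans (lM x) _; apply: ler_wpM2r => //.
exact: le_trans (ler_norm _) (ltW MB).
Qed.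

(** Bridge from the epsilon form of differentiability, which [is_Cn] supplies, to the little-o form
    behind ['d]. The bound on [l] gives the continuity on which uniqueness of the differential
    rests. *)
Lemma frechet_is_diff (f : E -> W) (l : {linear E -> W}) x (M : R) :
  (forall v, `|l v| <= M * `|v|) ->
  (forall e : R, 0 < e -> \forall v \near (0 : E),
     `|f (x + v) - f x - l v| <= e * `|v|) ->
  is_diff x f l.
Proof.
move=> lM h.
have lc := norm_bounded_continuous lM.
have fE : f \o shift x = cst (f x) + l +o_ 0 id.
  apply/eqaddoP => _/posnumP[e] /=.
  near=> v.
  rewrite [X in `|X|](_ : _ = f (x + v) - f x - l v); last first.
    by change (f (v + x) - (f x + l v) = f (x + v) - f x - l v); rewrite [v + x]addrC opprD addrA.
  near: v; exact: h.
have dE := diff_unique lc fE.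
split => //; apply/diff_locallyP; rewrite dE; split => //.
Unshelve. all: by end_near. Qed.

End frechet.

Lemma expand_is_derive (R : realType) (f : R -> R) (r l : R) :
  (forall e : R, 0 < e -> \forall h \near (0 : R),
     `|f (r + h) - f r - h * l| <= e * `|h|) ->
  is_derive r 1 f l.
Proof.
move=> h.
have lin : linear (fun h : R => h * l : R^o).
  by move=> a u v; rewrite mulrDl /= -mulrA.
pose l' : {linear R -> R} := HB.pack (fun h : R => h * l) (GRing.isLinear.Build _ _ _ _ _ lin).
have [df dE] : is_diff r (f : R -> R) l'.
  by apply: (@frechet_is_diff _ _ _ _ _ _ `|l|) => // v; rewrite normrM mulrC.
split; first by apply/derivable1_diffP.
by rewrite deriveE // dE /= mul1r.
Qed.

Section Cn_bounds.
Context (R : realType) (E : completeNormedModType R) (ip : {dot E for idfun}).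
Hypothesis hip : hilbert_norm ip.
Variables (c : R) (V : E -> R).
Hypothesis c1 : 1 <= c.
Hypothesis VC : Cnc 3 c [set r | 0 <= r] V.
Implicit Types x y z u v w k : E.

Lemma mform_normP (i : nat) (M : i.-tuple E -> R) (e : R) :
  (mform_norm M <= e%:E)%E ->
  forall v : i.-tuple E, (forall j, `|tnth v j| <= 1) -> `|M v| <= e.
Proof.
move=> Me v v1; rewrite -lee_fin; apply: le_trans Me.
by apply: ereal_sup_ubound; exists v.
Qed.

Lemma tuple1_le1 v : `|v| <= 1 -> forall j, `|tnth [tuple v] j| <= 1.
Proof. by move=> v1 j; rewrite (ord1 j). Qed.

Lemma tuple2_le1 v w : `|v| <= 1 -> `|w| <= 1 ->
  forall j, `|tnth [tuple v; w] j| <= 1.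
Proof. by move=> v1 w1 j; rewrite (tnth_nth 0); case: j => -[|[|]]. Qed.

Lemma tupd1 y z : tupd [tuple y] ord0 z = [tuple z].
Proof. by apply: eq_from_tnth => j; rewrite tnth_mktuple (ord1 j). Qed.

Lemma tupd2l y z w : tupd [tuple y; w] ord0 z = [tuple z; w].
Proof.
apply: eq_from_tnth => j; rewrite tnth_mktuple.
by case: j => -[|[|//]] //= Hj; rewrite !(tnth_nth 0).
Qed.

Lemma tupd2r y z w : tupd [tuple y; w] (lift ord0 ord0) z = [tuple y; z].
Proof.
apply: eq_from_tnth => j; rewrite tnth_mktuple.
by case: j => -[|[|//]] //= Hj; rewrite !(tnth_nth 0).
Qed.

Local Notation dV x v := ('D_v V x).
Local Notation ddV x v w := ('D_v ('D_w V) x).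

Lemma V_ge0 x : 0 <= V x. Proof. by case: VC => _ h _; exact: h. Qed.

Lemma dV_lin x (a : R) y z : dV x (a *: y + z) = a * dV x y + dV x z.
Proof.
case: VC => -[/(_ 1%N x isT)[h _] _ _] _ _.
by have := h [tuple 0] ord0 a y z; rewrite !tupd1.
Qed.

Lemma ddV_linl x (a : R) y z w :
  ddV x (a *: y + z) w = a * ddV x y w + ddV x z w.
Proof.
case: VC => -[/(_ 2%N x isT)[h _] _ _] _ _.
by have := h [tuple 0; w] ord0 a y z; rewrite !tupd2l.
Qed.

Lemma ddV_linr x (a : R) y z w :
  ddV x w (a *: y + z) = a * ddV x w y + ddV x w z.
Proof.
case: VC => -[/(_ 2%N x isT)[h _] _ _] _ _.
by have := h [tuple w; 0] (lift ord0 ord0) a y z; rewrite !tupd2r.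
Qed.

Lemma frechetV x (e : R) : 0 < e ->
  \forall v \near (0 : E), `|V (x + v) - V x - dV x v| <= e * `|v|.
Proof.
move=> e0; case: VC => -[_ /(_ 0%N x e isT e0) h _] _ _.
apply: filterS h => v /mform_normP /(_ [tuple]); apply.
by case.
Qed.

(** [mform_norm] tests only vectors of norm at most 1; homogeneity extends its bounds to all
    vectors. *)
Lemma scale_unit (f : E -> R) (M : R) : 0 <= M ->
  (forall (a : R) v, f (a *: v) = a * f v) ->
  (forall v, `|v| <= 1 -> `|f v| <= M) -> forall v, `|f v| <= M * `|v|.
Proof.
move=> M0 fZ fM v; have [->|v0] := eqVneq v 0.
  by have := fZ 0 0; rewrite scale0r mul0r => ->; rewrite !normr0 mulr0.
have nv : 0 < `|v| by rewrite normr_gt0.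
have := fM (`|v|^-1 *: v); rewrite fZ normrM normrZ normfV normr_id mulVf ?gt_eqF //.
by move=> /(_ (lexx _)); rewrite ler_pdivrMl // mulrC.
Qed.

Lemma dVZ x (a : R) v : dV x (a *: v) = a * dV x v.
Proof.
have := dV_lin x 0 0 0; rewrite scaler0 add0r mul0r add0r => _.
have h0 : dV x 0 = 0 by have := dV_lin x 1 0 0; rewrite scaler0 addr0 mul1r; lra.
by have := dV_lin x a v 0; rewrite addr0 h0 addr0.
Qed.

Lemma dVD x v w : dV x (v + w) = dV x v + dV x w.
Proof. by have := dV_lin x 1 v w; rewrite scale1r mul1r. Qed.

Lemma ddVZl x (a : R) v w : ddV x (a *: v) w = a * ddV x v w.
Proof.
have h0 : ddV x 0 w = 0 by have := ddV_linl x 1 0 0 w; rewrite scaler0 addr0 mul1r; lra.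
by have := ddV_linl x a v 0 w; rewrite addr0 h0 addr0.
Qed.

Lemma ddVZr x (a : R) v w : ddV x w (a *: v) = a * ddV x w v.
Proof.
have h0 : ddV x w 0 = 0 by have := ddV_linr x 1 0 0 w; rewrite scaler0 addr0 mul1r; lra.
by have := ddV_linr x a v 0 w; rewrite addr0 h0 addr0.
Qed.

Lemma dVB x v w : dV x (v - w) = dV x v - dV x w.
Proof. by have := dV_lin x (-1) w v; rewrite scaleN1r mulN1r [- w + v]addrC => ->; rewrite addrC. Qed.

Lemma ddVBl x v v' w : ddV x (v - v') w = ddV x v w - ddV x v' w.
Proof. by have := ddV_linl x (-1) v' v w; rewrite scaleN1r mulN1r [- v' + v]addrC => ->; rewrite addrC. Qed.

Lemma ddVBr x v v' w : ddV x w (v - v') = ddV x w v - ddV x w v'.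
Proof. by have := ddV_linr x (-1) v' v w; rewrite scaleN1r mulN1r [- v' + v]addrC => ->; rewrite addrC. Qed.

Lemma frechet_dV x (e : R) : 0 < e ->
  \forall v \near (0 : E), forall w,
    `|dV (x + v) w - dV x w - ddV x v w| <= e * `|v| * `|w|.
Proof.
move=> e0; case: VC => -[_ /(_ 1%N x e isT e0) h _] _ _.
apply: filterS h => v /mform_normP h w.
apply: (@scale_unit (fun w => dV (x + v) w - dV x w - ddV x v w)).
- by rewrite mulr_ge0 // ltW.
- by move=> a z; rewrite !dVZ ddVZr !mulrBr.
- by move=> z z1; apply: (h [tuple z]); exact: tuple1_le1.
Qed.

Lemma continuousV : continuous V.
Proof.
move=> x; case: VC => -[_ _ h] _ _; apply/cvgrPdist_le => e e0.
have := h 0%N x e isT e0; apply: filterS => y /mform_normP /(_ [tuple]).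
by rewrite distrC; apply; case.
Qed.

(** The base [1 + sup] is at least 1 and the exponent lies in [0, 1], so the power is at most
    [1 + m]. Only the bound for V itself keeps the power: [V_growth_segment] needs it to solve for
    the maximum. *)
Lemma Cnc_lip x y (m : R) : (forall r, 0 <= r <= 1 -> V (r *: x + (1 - r) *: y) <= m) ->
  let L := c * (1 + m) in
  [/\ `|V x - V y| <= c * `|x - y| * (1 + m) `^ (1 - c^-1),
      forall v, `|dV x v - dV y v| <= L * `|x - y| * `|v|
    & forall v w, `|ddV x v w - ddV y v w| <= L * `|x - y| * `|v| * `|w|].
Proof.
move=> Vm L; case: VC => _ _ h.
have m0 : 0 <= m by apply: le_trans (V_ge0 _) (Vm 0 _); rewrite lexx ler01.
have c0 : 0 < c by exact: lt_le_trans ltr01 c1.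
have ce : 0 <= 1 - c^-1 by rewrite subr_ge0 invf_le1.
have SE z z' : [set `|V (r *: z + (1 - r) *: z')| | r in `[0, 1]] !=set0.
  by exists `|V (0 *: z + (1 - 0) *: z')|; exists 0 => //=; rewrite in_itv /= lexx ler01.
have Sm : sup [set `|V (r *: x + (1 - r) *: y)| | r in `[0, 1]] <= m.
  apply: ge_sup; first exact: SE.
  move=> _ [r /= r01 <-]; rewrite ger0_norm ?V_ge0 //; apply: Vm.
  by move: r01; rewrite in_itv.
(* A set without supremum has [sup] equal to 0, so both cases give the bound. *)
have S0 : 0 <= sup [set `|V (r *: x + (1 - r) *: y)| | r in `[0, 1]].
  set A := [set _ | _ in _]; have [hA|/sup_out -> //] := pselect (has_sup A).
  have [z Az] := hA.1; apply: le_trans (ub_le_sup hA.2 Az).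
  by case: Az => r _ <-.
have p1 : (1 + sup [set `|V (r *: x + (1 - r) *: y)| | r in `[0, 1]]) `^ (1 - c^-1)
    <= (1 + m) `^ (1 - c^-1).
  by apply: ge0_ler_powR => //; rewrite ?nnegrE ?lerD2l ?addr_ge0 //.
have p2 : (1 + m) `^ (1 - c^-1) <= 1 + m.
  rewrite -[leRHS]powRr1 ?addr_ge0 //; apply: ler_powR; first by rewrite lerDl.
  by rewrite lerBlDr lerDl invr_ge0 ltW.
have cxy : 0 <= c * `|x - y| by rewrite mulr_ge0 // ltW.
have L0 : 0 <= L * `|x - y| by rewrite !mulr_ge0 ?addr_ge0 // ltW.
have Le : c * `|x - y| * (1 + sup [set `|V (r *: x + (1 - r) *: y)| | r in `[0, 1]]) `^ (1 - c^-1)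
   <= L * `|x - y|.
  have -> : L * `|x - y| = c * `|x - y| * (1 + m) by rewrite /L mulrAC.
  by apply: ler_wpM2l => //; exact: le_trans p1 p2.
split.
- have /mform_normP/(_ [tuple]) h0 := h x y 0%N isT.
  by apply: le_trans (h0 _) _; [case|apply: ler_wpM2l].
- move=> v; have /mform_normP h1 := h x y 1%N isT.
  apply: (@scale_unit (fun v => dV x v - dV y v)) => //.
    by move=> a z; rewrite !dVZ mulrBr.
  by move=> z z1; apply: le_trans (h1 [tuple z] _) Le; exact: tuple1_le1.
- move=> v w; have /mform_normP h2 := h x y 2%N isT.
  apply: (@scale_unit (fun w => ddV x v w - ddV y v w)).
  - by rewrite mulr_ge0.
  - by move=> a z; rewrite (ddVZr x a z v) (ddVZr y a z v) mulrBr.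
  move=> z z1.
  apply: (@scale_unit (fun v => ddV x v z - ddV y v z)) => //.
    by move=> a z'; rewrite (ddVZl x a z' z) (ddVZl y a z' z) mulrBr.
  by move=> z' z'1; apply: le_trans (h2 [tuple z'; z] _) Le; exact: tuple2_le1.
Qed.

End Cn_bounds.

(** Serves both levels of [V_taylor]: V minus its polynomial of degree 2, and V' minus its
    polynomial of degree 1, the latter with [b = 0]. *)
Lemma is_derive_sub_quadratic (R : realType) (f : R -> R) (r l a b : R) :
  is_derive r 1 f l ->
  is_derive r 1 (fun t => f t - t * a - 2^-1 * t ^+ 2 * b) (l - a - r * b).
Proof.
move=> fl.
have -> : (fun t => f t - t * a - 2^-1 * t ^+ 2 * b) =
    f - a *: id - (2^-1 * b) *: (id ^+ 2).
  apply/funext => t; change (f t - t * a - 2^-1 * t ^+ 2 * b =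
    f t - a * t - (2^-1 * b) * (t ^+ 2)); ring.
apply: is_derive_eq.
change (l - a * 1 - (2^-1 * b) * ((2 * r ^+ 1) * 1) = l - a - r * b); by field.
Qed.

Section Cn_local.
Context (R : realType) (E : completeNormedModType R) (ip : {dot E for idfun}).
Hypothesis hip : hilbert_norm ip.
Variables (c : R) (V : E -> R).
Hypothesis c1 : 1 <= c.
Hypothesis VC : Cnc 3 c [set r | 0 <= r] V.
Implicit Types x y z u v w k : E.

Local Notation dV x v := ('D_v V x).
Local Notation ddV x v w := ('D_v ('D_w V) x).

Lemma segmentE x k (t : R) : t *: (x + k) + (1 - t) *: x = x + t *: k.
Proof.
by rewrite scalerDr scalerBl scale1r [t *: x + _]addrC -addrA addrC [t *: x + _]addrC subrK.
Qed.

(** The growth estimate bounds the maximum of V on the segment in terms of itself, so the maximum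
    has to be attained. *)
Lemma segment_max x k : exists2 m, (forall r, 0 <= r <= 1 -> V (x + r *: k) <= m) &
  exists2 r, 0 <= r <= 1 & m = V (x + r *: k).
Proof.
have cf : {within `[0, 1], continuous (fun r : R => V (x + r *: k))}.
  apply: continuous_subspaceT => r.
  apply: (@continuous_comp _ _ _ (fun r : R => x + r *: k) V).
    by apply: cvgD; [exact: cvg_cst|apply: cvgZr_tmp; exact: cvg_id].
  exact: (continuousV VC).
have [r r01 h] := EVT_max ler01 cf.
exists (V (x + r *: k)); last by exists r => //; move: r01; rewrite in_itv.
by move=> s s01; apply: h; rewrite in_itv.
Qed.

(** Bounds the factor by which [1 + V] grows under a displacement of norm at most K. *)
Definition Lgrow (K : R) := (1 + c * K) `^ c.

Lemma Lgrow_ge1 K : 0 <= K -> 1 <= Lgrow K.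
Proof.
move=> K0; have c0 : 0 <= c := le_trans ler01 c1.
rewrite /Lgrow -[leLHS](powRr0 (1 + c * K)); apply: ler_powR => //.
by rewrite lerDl mulr_ge0.
Qed.

(* Dividing [m <= v + c K m^(1-1/c)] by [m^(1-1/c)] bounds [m^(1/c)] by
   [v^(1/c) (1 + c K)]. *)
Lemma V_growth_segment x k (K : R) : 0 <= K -> `|k| <= K ->
  forall r, 0 <= r <= 1 -> 1 + V (x + r *: k) <= Lgrow K * (1 + V x).
Proof.
move=> K0 kK r r01; have c0 : 0 < c := lt_le_trans ltr01 c1.
have [m0 Vm [s s01 mE]] := segment_max x k.
apply: (@le_trans _ _ (1 + m0)); first by rewrite lerD2l; exact: Vm.
pose m := 1 + m0; pose v := 1 + V x; rewrite -/m -/v.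
have v1 : 1 <= v by rewrite lerDl (V_ge0 VC).
have vm : v <= m by rewrite lerD2l; have := Vm 0; rewrite scale0r addr0; apply; rewrite lexx ler01.
have m1 : 1 <= m := le_trans v1 vm.
have mpos : 0 < m := lt_le_trans ltr01 m1.
have vpos : 0 < v := lt_le_trans ltr01 v1.
have mle : m <= v + c * K * m `^ (1 - c^-1).
  have hseg t : 0 <= t <= 1 -> V (t *: (x + s *: k) + (1 - t) *: x) <= m0.
    move=> /andP[t0 t1]; rewrite segmentE scalerA.
    by apply: Vm; case/andP: s01 => s0 s1; rewrite mulr_ge0 //= mulr_ile1.
  have [h _ _] := Cnc_lip c1 VC hseg.
  rewrite -lerBlDl; have -> : m - v = V (x + s *: k) - V x.
    by rewrite /m /v mE opprD addrACA subrr add0r.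
   apply: le_trans (ler_norm _) _; apply: le_trans h _.
  apply: ler_wpM2r; first exact: powR_ge0.
  apply: ler_wpM2l; first exact: ltW.
  rewrite addrAC subrr add0r normrZ; apply: le_trans _ kK.
  by case/andP: s01 => s0 s1; rewrite ger0_norm // ler_piMl.
have mc : m `^ c^-1 <= v `^ c^-1 * (1 + c * K).
  have mq : 0 < m `^ (1 - c^-1) by exact: powR_gt0.
  have vq : v `^ (1 - c^-1) <= m `^ (1 - c^-1).
    by apply: ge0_ler_powR; rewrite ?nnegrE ?(ltW mpos) ?(ltW vpos) // subr_ge0 invf_le1.
  rewrite -(ler_pM2r mq) -powRD ?(gt_eqF mpos) ?implybT //.
  rewrite addrC subrK powRr1 ?(ltW mpos) //; apply: le_trans mle _.
  rewrite mulrDr mulr1 mulrDl; apply: lerD.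
    rewrite -{1}(powRr1 (ltW vpos)) -{1}(subrK c^-1 1) addrC powRD ?(gt_eqF vpos) ?implybT //.
    by apply: ler_wpM2l => //; exact: powR_ge0.
  rewrite -[leRHS]mulrA; apply: ler_peMl; first by rewrite !mulr_ge0 ?powR_ge0 // ltW.
  rewrite -[leLHS](powRr0 v); apply: ler_powR => //.
  by rewrite invr_ge0 ltW.
have cK : 0 <= 1 + c * K by rewrite addr_ge0 // mulr_ge0 // ltW.
have -> : m = (m `^ c^-1) `^ c by rewrite -powRrM mulVf ?gt_eqF // powRr1 // ltW.
apply: (@le_trans _ _ ((v `^ c^-1 * (1 + c * K)) `^ c)).
  by apply: ge0_ler_powR; rewrite ?nnegrE ?powR_ge0 ?mulr_ge0 ?powR_ge0 // ltW.
rewrite powRM ?powR_ge0 // -powRrM mulVf ?gt_eqF // powRr1 ?(ltW vpos) //.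
by rewrite mulrC.
Qed.

Lemma V_growth x k (K : R) : 0 <= K -> `|k| <= K -> 1 + V (x + k) <= Lgrow K * (1 + V x).
Proof.
move=> K0 kK; have := V_growth_segment x K0 kK (r := 1).
by rewrite scale1r; apply; rewrite ler01 lexx.
Qed.

(** One quantity for all local estimates at x: a Lipschitz constant of V, V' and V'' for
    displacements of norm at most K and, when [1 <= K], a bound of V' and V'' at x. *)
Definition Llip (K : R) x := c * (Lgrow K * (1 + V x)).

Lemma Llip_ge0 K x : 0 <= K -> 0 <= Llip K x.
Proof.
move=> K0; rewrite /Llip mulr_ge0 ?(le_trans ler01 c1) // mulr_ge0 ?addr_ge0 ?(V_ge0 VC) //.
by rewrite (le_trans ler01) // Lgrow_ge1.
Qed.

Lemma V_lip_local x k (K : R) : 0 <= K -> `|k| <= K ->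
  [/\ `|V (x + k) - V x| <= Llip K x * `|k|,
      forall v, `|dV (x + k) v - dV x v| <= Llip K x * `|k| * `|v|
    & forall v w, `|ddV (x + k) v w - ddV x v w| <= Llip K x * `|k| * `|v| * `|w|].
Proof.
move=> K0 kK; have c0 : 0 < c := lt_le_trans ltr01 c1.
have hseg r : 0 <= r <= 1 -> V (r *: (x + k) + (1 - r) *: x) <= Lgrow K * (1 + V x) - 1.
  by move=> r01; rewrite segmentE lerBrDl; exact: V_growth_segment.
have := Cnc_lip c1 VC hseg.
rewrite addrAC subrr add0r [1 + (_ - 1)]addrC subrK => -[h1 h2 h3]; split => //.
apply: le_trans h1 _.
  rewrite /Llip mulrAC; apply: ler_wpM2r => //; apply: ler_wpM2l; first exact: ltW.
  have v1 : 1 <= Lgrow K * (1 + V x).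
    by rewrite -[leLHS]mulr1 ler_pM // ?Lgrow_ge1 // lerDl (V_ge0 VC).
  rewrite -[leRHS]powRr1 ?(le_trans ler01) //; apply: ler_powR => //.
  by rewrite lerBlDr lerDl invr_ge0 ltW.
Qed.

(** Passes from a neighbourhood of 0 to a small multiple of one direction, at which a linear
    quantity is estimated before the factor t is cancelled. *)
Lemma near0_scale (P : E -> Prop) v : (\forall u \near (0 : E), P u) ->
  exists2 t : R, 0 < t & P (t *: v) /\ `|t *: v| <= 1.
Proof.
move=> Pn.
have : \forall u \near (0 : E), P u /\ `|u| <= 1.
  near=> u; split; first by near: u.
  near: u; apply: filterS (nbhsx_ballx (0 : E) 1 ltr01) => u.
  by rewrite -ball_normE /= sub0r normrN => /ltW.
have zv : (fun t : R => t *: v) @ (0 : R) --> (0 : E).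
  by rewrite -[X in _ --> X](scale0r v); apply: cvgZr_tmp; exact: cvg_id.
move=> /zv /nbhs_ballP[e /= e0 h]; exists (e / 2); first by rewrite divr_gt0.
apply: h; rewrite -ball_normE /= sub0r normrN ger0_norm ?ltW ?divr_gt0 //.
by rewrite gtr_pMr // invf_lt1 // ltr1n.
Unshelve. all: by end_near. Qed.

(** The Lipschitz constant of V bounds V': at [t v] the increment of V is at most of order t, the
    Frechet error is a small multiple of t, and t cancels. [ddV_bound] is the same argument one
    order higher. *)
Lemma dV_bound x v (K : R) : 1 <= K -> `|dV x v| <= Llip K x * `|v|.
Proof.
move=> K1; apply/ler_addgt0Pr => e e0.
have K0 : 0 <= K := le_trans ler01 K1.
have e1 : 0 < e / (1 + `|v|) by rewrite divr_gt0 // ltr_wpDr.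
have [t t0 [h tv]] := near0_scale v (frechetV VC x e1).
have [h1 _ _] := V_lip_local x K0 (le_trans tv K1).
have : `|dV x (t *: v)| <= t * (Llip K x * `|v| + e).
  have -> : dV x (t *: v) = (V (x + t *: v) - V x) - (V (x + t *: v) - V x - dV x (t *: v)) by ring.
  apply: le_trans (ler_normB _ _) _; apply: le_trans (lerD h1 h) _.
  rewrite normrZ gtr0_norm // mulrDr; apply: lerD; first by rewrite mulrCA.
  rewrite mulrCA; apply: ler_wpM2l; first exact: ltW.
  by rewrite -mulrA ler_piMr ?(ltW e0) // mulrC ler_pdivrMr ?ltr_wpDr // mul1r lerDr.
by rewrite (dVZ VC) normrM gtr0_norm // ler_pM2l.
Qed.

Lemma ddV_bound x v w (K : R) : 1 <= K -> `|ddV x v w| <= Llip K x * `|v| * `|w|.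
Proof.
move=> K1; apply/ler_addgt0Pr => e e0.
have K0 : 0 <= K := le_trans ler01 K1.
pose q : R := (1 + `|v|) * (1 + `|w|).
have q0 : 0 < q by rewrite mulr_gt0 // ltr_wpDr.
have e1 : 0 < e / q by rewrite divr_gt0.
have [t t0 [h tv]] := near0_scale v (frechet_dV VC x e1).
have [_ h1 _] := V_lip_local x K0 (le_trans tv K1).
have : `|ddV x (t *: v) w| <= t * (Llip K x * `|v| * `|w| + e).
  have -> : ddV x (t *: v) w = (dV (x + t *: v) w - dV x w) - (dV (x + t *: v) w - dV x w - ddV x (t *: v) w) by ring.
  apply: le_trans (ler_normB _ _) _; apply: le_trans (lerD (h1 w) (h w)) _.
  rewrite normrZ gtr0_norm // mulrDr; apply: lerD.
    by rewrite le_eqVlt; apply/orP; left; apply/eqP; ring.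
  have -> : e / q * (t * `|v|) * `|w| = t * (e * (`|v| * `|w| / q)) by ring.
  apply: ler_wpM2l; first exact: ltW.
  rewrite ler_piMr ?(ltW e0) // ler_pdivrMr // mul1r /q.
  by rewrite ler_pM // lerDr.
by rewrite (ddVZl VC) normrM gtr0_norm // ler_pM2l.
Qed.

Lemma is_derive_V_line x k (r : R) : is_derive r 1 (fun r : R => V (x + r *: k)) (dV (x + r *: k) k).
Proof.
apply: expand_is_derive => e e0.
have e1 : 0 < e / (1 + `|k|) by rewrite divr_gt0 // ltr_wpDr.
have zv : (fun t : R => t *: k) @ (0 : R) --> (0 : E).
  by rewrite -[X in _ --> X](scale0r k); apply: cvgZr_tmp; exact: cvg_id.
have : \forall h \near (0 : R), `|V (x + r *: k + h *: k) - V (x + r *: k) -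
  dV (x + r *: k) (h *: k)| <= e / (1 + `|k|) * `|h *: k| := zv _ (frechetV VC (x + r *: k) e1).
apply: filterS => h.
rewrite scalerDl addrA (dVZ VC) normrZ => h1; apply: le_trans h1 _.
rewrite [leRHS]mulrC mulrCA; apply: ler_wpM2l => //.
by rewrite -mulrA ler_piMr ?(ltW e0) // mulrC ler_pdivrMr ?ltr_wpDr // mul1r lerDr.
Qed.

Lemma is_derive_dV_line x k w (r : R) :
  is_derive r 1 (fun r : R => dV (x + r *: k) w) (ddV (x + r *: k) k w).
Proof.
apply: expand_is_derive => e e0.
pose q : R := (1 + `|k|) * (1 + `|w|).
have q0 : 0 < q by rewrite mulr_gt0 // ltr_wpDr.
have e1 : 0 < e / q by rewrite divr_gt0.
have zv : (fun t : R => t *: k) @ (0 : R) --> (0 : E).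
  by rewrite -[X in _ --> X](scale0r k); apply: cvgZr_tmp; exact: cvg_id.
have : \forall h \near (0 : R), forall w, `|dV (x + r *: k + h *: k) w - dV (x + r *: k) w -
  ddV (x + r *: k) (h *: k) w| <= e / q * `|h *: k| * `|w| := zv _ (frechet_dV VC (x + r *: k) e1).
apply: filterS => h /(_ w).
rewrite scalerDl addrA (ddVZl VC) normrZ => h1; apply: le_trans h1 _.
have -> : e / q * (`|h| * `|k|) * `|w| = `|h| * (e * (`|k| * `|w| / q)) by ring.
rewrite [leRHS]mulrC; apply: ler_wpM2l => //.
rewrite ler_piMr ?(ltW e0) // ler_pdivrMr // mul1r /q.
by rewrite ler_pM // lerDr.
Qed.

(** V is only known to be C^2 with a locally Lipschitz second derivative, so the cubic remainder
    comes from two mean value steps along the segment instead of a third derivative. The numerical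
    factor is not optimised. *)
Lemma V_taylor x k (K : R) : 0 <= K -> `|k| <= K ->
  `|V (x + k) - V x - dV x k - 2^-1 * ddV x k k| <= Llip K x * `|k| ^+ 3.
Proof.
move=> K0 kK.
pose L := Llip K x * `|k| ^+ 3.
have L0 : 0 <= L by rewrite mulr_ge0 ?Llip_ge0 ?exprn_ge0.
have dd r : 0 <= r <= 1 -> `|ddV (x + r *: k) k k - ddV x k k| <= L.
  case/andP=> r0 r1.
  have rk : `|r *: k| <= K by rewrite normrZ ger0_norm //; apply: le_trans kK; rewrite ler_piMl.
  have [_ _ h] := V_lip_local x K0 rk.
  apply: le_trans (h k k) _; rewrite normrZ ger0_norm // /L.
  have -> : Llip K x * (r * `|k|) * `|k| * `|k| = r * (Llip K x * `|k| ^+ 3) by ring.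
  by rewrite ler_piMl.
have d1 r : 0 <= r <= 1 -> `|dV (x + r *: k) k - dV x k - r * ddV x k k| <= L.
  case/andP=> r0 r1.
  pose g (t : R) : R := dV (x + t *: k) k - t * ddV x k k - 2^-1 * t ^+ 2 * 0.
  have gd (t : R) : is_derive t (1 : R) g (ddV (x + t *: k) k k - ddV x k k - t * 0).
    by apply: is_derive_sub_quadratic; exact: is_derive_dV_line.
  have [|s sr] := @MVT_segment R g _ 0 r r0 (fun t _ => gd t).
    by apply: derivable_within_continuous => t _; have [] := gd t.
  rewrite /g scale0r addr0 mul0r !mulr0 !subr0 => hE.
  have -> : dV (x + r *: k) k - dV x k - r * ddV x k k =
     (ddV (x + s *: k) k k - ddV x k k) * r by rewrite -hE addrAC.
  have s01 : 0 <= s <= 1 by move: sr; rewrite in_itv /= => /andP[-> sr] /=; exact: le_trans sr r1.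
  by rewrite normrM (ger0_norm r0); apply: le_trans (dd s s01); rewrite ler_piMr.
pose g (t : R) : R := V (x + t *: k) - t * dV x k - 2^-1 * t ^+ 2 * ddV x k k.
have gd (t : R) : is_derive t (1 : R) g (dV (x + t *: k) k - dV x k - t * ddV x k k).
  by apply: is_derive_sub_quadratic; exact: is_derive_V_line.
have [|s sr] := @MVT_segment R g _ 0 1 ler01 (fun t _ => gd t).
  by apply: derivable_within_continuous => t _; have [] := gd t.
rewrite /g scale1r scale0r addr0 subr0 mulr1 => hE.
have s01 : 0 <= s <= 1 by move: sr; rewrite in_itv.
have -> : V (x + k) - V x - dV x k - 2^-1 * ddV x k k =
     dV (x + s *: k) k - dV x k - s * ddV x k k
    by rewrite -hE; move: (V (x + k)) (V x) (dV x k) (ddV x k k) => *; ring.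
exact: d1.
Qed.

End Cn_local.

(** * Orthonormal projections *)

Section finite_usum.
Context (R : realType) (I : choiceType) (E : normedModType R).

Lemma fsets_filter (S : set I) :
  ProperFilter (filter_from (fsets S) (fun A => [set C | fsets S C /\ A `<=` C])).
Proof.
apply: filter_from_proper.
  apply: filter_from_filter; first by exists set0; exact: fsets_set0.
  move=> A A' [fA AS] [fA' A'S]; exists (A `|` A').
    by split; [rewrite finite_setU|rewrite subUset].
  by move=> C [fC]; rewrite subUset => -[? ?].
by move=> A fA; exists A; split.
Qed.

(** The partial sums are constant on the finite sets that contain A, so the limit is this constant.
    All the unordered sums that occur below are evaluated in this way. *)
Lemma usum_finite (S A : set I) (f : I -> E) : fsets S A ->
  (forall i, S i -> ~ A i -> f i = 0) -> usum S f = \sum_(i <- fset_set A) f i.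
Proof.
move=> fA f0; have fil := fsets_filter S.
rewrite /usum; apply: lim_near_cst => //.
exists A => // C [[fC CS] AC].
rewrite -(fsbig_finite _ _ fA.1); apply/esym/fsbig_widen => // i [Ci nA].
by apply: f0 => //; exact: CS.
Qed.

End finite_usum.

Section orthonormal_seq.
Context (R : realType) (E : completeNormedModType R) (ip : {dot E for idfun}).
Hypothesis hip : hilbert_norm ip.
Variable s : seq E.
Hypothesis us : uniq s.
Hypothesis os : forall x y, x \in s -> y \in s -> ip x y = (x == y)%:R.

Definition proj (x : E) : E := \sum_(h <- s) ip h x *: h.

Lemma sum_pick (W : lmodType R) (h : E) (a : E -> R) (f : E -> W) : h \in s ->
  (forall g, g \in s -> a g = (h == g)%:R) -> \sum_(g <- s) a g *: f g = f h.
Proof.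
move=> hs ha; rewrite (bigD1_seq h) //= ha // eqxx scale1r big_seq_cond big1 ?addr0 //.
by move=> g /andP[gs gh]; rewrite ha // eq_sym (negbTE gh) scale0r.
Qed.

Lemma ip_comb (a : E -> R) h : h \in s -> ip h (\sum_(g <- s) a g *: g) = a h.
Proof.
move=> hs; rewrite ip_sumr.
transitivity (\sum_(g <- s) ip h g *: (a g : R^o)); last first.
  by apply: sum_pick => // g gs; rewrite os.
by apply: eq_bigr => g _; rewrite ipZr mulrC.
Qed.

Lemma ip_proj h x : h \in s -> ip h (proj x) = ip h x.
Proof. exact: ip_comb. Qed.

Lemma proj_comb (a : E -> R) : proj (\sum_(g <- s) a g *: g) = \sum_(g <- s) a g *: g.
Proof. by apply: eq_big_seq => h hs; rewrite ip_comb. Qed.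

Lemma projK x : proj (proj x) = proj x.
Proof. exact: proj_comb. Qed.

Lemma projP (a : R) x y : proj (a *: x + y) = a *: proj x + proj y.
Proof.
rewrite /proj scaler_sumr -big_split /=; apply: eq_bigr => h _.
by rewrite ipDr ipZr scalerDl scalerA.
Qed.

Lemma projD x y : proj (x + y) = proj x + proj y.
Proof. by have := projP 1 x y; rewrite !scale1r. Qed.

Lemma proj0 : proj 0 = 0.
Proof. by rewrite /proj big1 // => h _; rewrite ip0r scale0r. Qed.

Lemma projZ (a : R) x : proj (a *: x) = a *: proj x.
Proof. by have := projP a x 0; rewrite proj0 !addr0. Qed.

Lemma proj_sum (T : Type) (r : seq T) (f : T -> E) :
  proj (\sum_(i <- r) f i) = \sum_(i <- r) proj (f i).
Proof. exact: (big_morph proj projD proj0). Qed.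

Lemma norm_comb (a : E -> R) : `|\sum_(g <- s) a g *: g| ^+ 2 = \sum_(g <- s) a g ^+ 2.
Proof.
rewrite -hip ip_suml; apply: eq_big_seq => h hs.
by rewrite ipZl ip_comb // expr2.
Qed.

Lemma norm_proj z : proj z = z -> `|z| ^+ 2 = \sum_(h <- s) ip h z ^+ 2.
Proof. by move=> <-; rewrite norm_comb; apply: eq_big_seq => h hs; rewrite ip_proj. Qed.

Lemma norm_ip_le1 h x : h \in s -> `|ip h x| <= `|x|.
Proof.
move=> hs; apply: le_trans (ip_le hip _ _) _; apply: ler_piMl => //.
by rewrite -(@expr_le1 _ 2) // -hip os // eqxx.
Qed.

End orthonormal_seq.

Section bases.
Context (R : realType) (E : completeNormedModType R) (ip : {dot E for idfun}).
Hypothesis hip : hilbert_norm ip.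
Variables (S : set E) (basisS : orthonormal_basis ip S).
Variables (I : set E) (fI : fsets S I).

Local Notation s := (fset_set I : seq E).

Lemma mem_fsets h : (h \in s) = (h \in I).
Proof. by rewrite in_fset_set //; case: fI. Qed.

Lemma fsets_uniq : uniq s. Proof. exact: fset_uniq. Qed.

Lemma fsets_on x y : x \in s -> y \in s -> ip x y = (x == y)%:R.
Proof.
rewrite !mem_fsets !inE => Ix Iy; case: basisS => h _.
by apply: h; case: fI => _; apply.
Qed.

Lemma orthoprojE x : orthoproj ip I x = proj ip s x.
Proof.
by rewrite /orthoproj (@usum_finite _ _ _ _ I) //; split => //; case: fI.
Qed.

Lemma ip_out h z : S h -> ~ I h -> proj ip s z = z -> ip h z = 0.
Proof.
move=> Sh nI <-; rewrite ip_sumr big1_seq // => g /andP[_].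
rewrite mem_fsets inE => Ig; rewrite ipZr.
have Sg : S g by case: fI => _; apply.
have [hb _] := basisS; rewrite (hb h g) //; by case: eqP => [hg|_]; [case: nI; rewrite hg|rewrite mulr0].
Qed.

Lemma fcalcE (lam : E -> R) (f : R -> R) z : proj ip s z = z ->
  fcalc ip S lam f z = \sum_(h <- s) (f (lam h) * ip h z) *: h.
Proof.
move=> zE; apply: usum_finite => // h Sh nI.
by rewrite (ip_out Sh nI zE) mulr0 scale0r.
Qed.

(** Restricted to the range of a finite projection, where [usum] is a finite sum and no convergence
    question arises. *)
Lemma semigroupP (lam : E -> R) t a x y : proj ip s x = x -> proj ip s y = y ->
  semigroup ip S lam t (a *: x + y) = a *: semigroup ip S lam t x + semigroup ip S lam t y.
Proof.
move=> xE yE; rewrite /semigroup !fcalcE ?projP ?xE ?yE //.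
rewrite scaler_sumr -big_split /=; apply: eq_bigr => h _.
by rewrite ipDr ipZr scalerA -scalerDl; congr (_ *: _); rewrite mulrDr mulrCA.
Qed.

Lemma semigroup_zero (lam : E -> R) t : semigroup ip S lam t 0 = 0.
Proof.
rewrite /semigroup fcalcE ?proj0 // big1 // => h _.
by rewrite ip0r mulr0 scale0r.
Qed.

Lemma interp_proj (lam : E -> R) (r : R) z : proj ip s z = z -> interp ip S lam r z.
Proof.
move=> zE; rewrite /interp /=.
have -> : (\esum_(h in S) (`|lam h| `^ (2 * r) * `|ip h z| ^+ 2)%:E =
   \esum_(h in I) (`|lam h| `^ (2 * r) * `|ip h z| ^+ 2)%:E)%E.
  rewrite esum_mkcond [RHS]esum_mkcond; apply: eq_esum => h _.
  case: ifPn => hS; case: ifPn => // hI.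
    by rewrite (ip_out _ _ zE) ?normr0 ?expr0n ?mulr0 //; [rewrite inE in hS|rewrite notin_setE in hI].
  by rewrite notin_setE in hS; rewrite inE in hI; case: hS; case: fI => _; apply.
have finI : finite_set I by case: fI.
rewrite esum_fset //.
by rewrite fsbig_finite //= sumEFin ltry.
Qed.

End bases.

(** * Gradient and Hessian as Riesz representatives *)

Section gradient.
Context (R : realType) (E : completeNormedModType R) (ip : {dot E for idfun}).
Hypothesis hip : hilbert_norm ip.
Variables (c : R) (V : E -> R).
Hypothesis c1 : 1 <= c.
Hypothesis VC : Cnc 3 c [set r | 0 <= r] V.
Implicit Types x y z u v w k : E.
Local Notation dV x v := ('D_v V x).
Local Notation ddV x v w := ('D_v ('D_w V) x).

Lemma linear_pack (W : lmodType R) (f : E -> W) :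
  (forall (a : R) y z, f (a *: y + z) = a *: f y + f z) ->
  exists l : {linear E -> W}, l =1 f.
Proof.
move=> hf.
by exists (HB.pack_for {linear E -> W} f (GRing.isLinear.Build _ _ _ _ f hf)).
Qed.

(** [grad] chooses by [xget] with default 0; Riesz shows that there is something to choose, and the
    Frechet expansion identifies ['d V x] with the directional derivatives. *)
Lemma grad_ip x v : ip (grad ip V x) v = dV x v.
Proof.
have [l lE] : exists l : {linear E -> R^o}, l =1 (fun v => dV x v).
  by apply: linear_pack => a y z; rewrite (dV_lin VC).
have lM w : `|l w| <= Llip c V 1 x * `|w| by rewrite lE; exact: (dV_bound c1 VC).
have [dif dE] : is_diff x (V : E -> R^o) l.
  apply: (frechet_is_diff lM) => e e0; apply: filterS (frechetV VC x e0) => w.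
  by rewrite lE.
rewrite /grad; case: xgetP => [g _ ->|]; first by rewrite dE lE.
have [g gE] := riesz hip lM.
by move=> /(_ g); case => w; rewrite gE dE.
Qed.

(** The candidate for the differential of [grad] sends w to the Riesz representative of
    ['D_w ('D_v V) x] as a function of v. The expansion of V' is uniform in the direction of
    differentiation, so by duality it is an expansion of [grad] in norm. *)
Lemma hess_ip x h v : ip (hess ip V x h) v = ddV x h v.
Proof.
have rz w : exists g, forall v, ip g v = ddV x w v.
  have [l lE] : exists l : {linear E -> R^o}, l =1 (fun v => ddV x w v).
    by apply: linear_pack => a y z; rewrite (ddV_linr VC).
  have lM z : `|l z| <= (Llip c V 1 x * `|w|) * `|z|.
    by rewrite lE; exact: (ddV_bound c1 VC).
  by have [g gE] := riesz hip lM; exists g => z; rewrite gE lE.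
have [k kE] := choice rz.
have [l lE] : exists l : {linear E -> E}, l =1 k.
  apply: linear_pack => a y z; apply: (ip_ext hip) => w.
  by rewrite ipDl ipZl !kE (ddV_linl VC).
have lM w : `|l w| <= Llip c V 1 x * `|w|.
  apply: (norm_riesz_le hip); first by rewrite mulr_ge0 // (Llip_ge0 c1 VC).
  by move=> z; rewrite lE kE; exact: (ddV_bound c1 VC).
have [dif dE] : is_diff x (grad ip V) l.
  apply: (frechet_is_diff lM) => e e0; apply: filterS (frechet_dV VC x e0) => w hw.
  apply: (norm_riesz_le hip); first by rewrite mulr_ge0 // ltW.
  by move=> z; rewrite !ipBl !grad_ip lE kE.
by rewrite /hess dE lE kE.
Qed.

Lemma dV_sum x (T : Type) (r : seq T) (a : T -> R) (f : T -> E) :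
  dV x (\sum_(i <- r) a i *: f i) = \sum_(i <- r) a i * dV x (f i).
Proof.
elim: r => [|i r IH]; last by rewrite !big_cons (dV_lin VC) IH.
by rewrite !big_nil; have := dVZ VC x 0 0; rewrite scale0r mul0r.
Qed.

Lemma ddV_suml x (T : Type) (r : seq T) (a : T -> R) (f : T -> E) w :
  ddV x (\sum_(i <- r) a i *: f i) w = \sum_(i <- r) a i * ddV x (f i) w.
Proof.
elim: r => [|i r IH]; last by rewrite !big_cons (ddV_linl VC) IH.
by rewrite !big_nil; have := ddVZl VC x 0 0 w; rewrite scale0r mul0r.
Qed.

Lemma ddV_sumr x (T : Type) (r : seq T) (a : T -> R) (f : T -> E) w :
  ddV x w (\sum_(i <- r) a i *: f i) = \sum_(i <- r) a i * ddV x w (f i).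
Proof.
elim: r => [|i r IH]; last by rewrite !big_cons (ddV_linr VC) IH.
by rewrite !big_nil; have := ddVZr VC x 0 0 w; rewrite scale0r mul0r.
Qed.

End gradient.

(** * Operators of finite rank: adjoint, Hilbert-Schmidt norm, trace *)

Section finite_rank.
Context (R : realType) (H U : completeNormedModType R).
Context (ipH : {dot H for idfun}) (ipU : {dot U for idfun}).
Hypotheses (hH : hilbert_norm ipH) (hU : hilbert_norm ipU).
Variables (HH : set H) (UU : set U).
Hypotheses (basisHH : orthonormal_basis ipH HH) (basisUU : orthonormal_basis ipU UU).
Variables (I : set H) (J : set U) (fI : fsets HH I) (fJ : fsets UU J).
Local Notation sI := (fset_set I : seq H).
Local Notation sJ := (fset_set J : seq U).
Variable L : U -> H.
Hypothesis linL : linear L.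
Let b (j : U) : H := proj ipH sI (L j).

Lemma linear_fun_sum (r : seq U) (a : U -> R) :
  L (\sum_(u <- r) a u *: u) = \sum_(u <- r) a u *: L u.
Proof.
elim: r => [|i r IH]; last by rewrite !big_cons linL IH.
rewrite !big_nil; have := linL 1 0 0; rewrite !scale1r addr0 => h.
by apply: (@addrI _ (L 0)); rewrite addr0 -h.
Qed.

Lemma finite_rankE u :
  orthoproj ipH I (L (orthoproj ipU J u)) = \sum_(j <- sJ) ipU j u *: b j.
Proof.
rewrite (orthoprojE ipH fI) (orthoprojE ipU fJ) /proj linear_fun_sum.
rewrite -/(proj ipH sI _) proj_sum; apply: eq_bigr => j _.
exact: projZ.
Qed.

Lemma proj_b j : proj ipH sI (b j) = b j.
Proof.
by apply: projK; [exact: fsets_uniq|move=> *; exact: (fsets_on basisHH fI)].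
Qed.

Let Lr u := orthoproj ipH I (L (orthoproj ipU J u)).

Lemma finite_rank_basis j : j \in sJ -> Lr j = b j.
Proof.
move=> js; rewrite /Lr finite_rankE.
apply: sum_pick; first exact: fsets_uniq. by [].
by move=> g gs; rewrite (fsets_on basisUU fJ) // eq_sym.
Qed.

Lemma finite_rank_out u : UU u -> ~ J u -> Lr u = 0.
Proof.
move=> Uu nJ; rewrite /Lr finite_rankE big1_seq // => j /andP[_ js].
have := js; rewrite (mem_fsets fJ) inE => Jj.
have Uj : UU j by case: fJ => _; apply.
have [hb _] := basisUU; rewrite (hb j u) //; case: eqP => [ju|_]; first by case: nJ; rewrite -ju.
by rewrite scale0r.
Qed.

(** The candidate satisfies the defining identity, and a vector is determined by its inner products,
    so the choice made by [adjoint] is forced. *)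
Lemma adjoint_finite_rank y : adjoint ipU ipH Lr y = \sum_(j <- sJ) ipH (b j) y *: j.
Proof.
have adj u : ipU u (\sum_(j <- sJ) ipH (b j) y *: j) = ipH (Lr u) y.
  rewrite /Lr finite_rankE ip_suml ip_sumr; apply: eq_bigr => j _.
  by rewrite ipZr ipZl mulrC (ipC ipU).
rewrite /adjoint; case: xgetP => [g _ gE|/(_ _ adj)//].
by apply: (ip_ext hU) => u; rewrite ipC gE ipC adj.
Qed.

Lemma hs_norm2_finite_rank : hs_norm2 UU Lr = (\sum_(j <- sJ) `|b j| ^+ 2)%:E.
Proof.
have finJ : finite_set J by case: fJ.
have -> : hs_norm2 UU Lr = (\esum_(u in J) (`|Lr u| ^+ 2)%:E)%E.
  rewrite /hs_norm2 esum_mkcond [RHS]esum_mkcond; apply: eq_esum => h _.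
  case: ifPn => hS; case: ifPn => // hI.
    rewrite inE in hS; rewrite notin_setE in hI.
    by rewrite finite_rank_out // normr0 expr0n.
  by rewrite notin_setE in hS; rewrite inE in hI; case: hS; case: fJ => _; apply.
rewrite esum_fset //.
rewrite fsbig_finite //= sumEFin; congr (_%:E); apply: eq_big_seq => j js.
by rewrite finite_rank_basis.
Qed.

Variables (c : R) (V : H -> R).
Hypothesis c1 : 1 <= c.
Hypothesis VC : Cnc 3 c [set r | 0 <= r] V.

(** After the two sums are exchanged, the sum over h reassembles [b j] from its coordinates in the
    first slot of V'', because [b j] lies in the range of the projection. *)
Lemma trace_finite_rank x :
  trace ipH HH (fun h => Lr (adjoint ipU ipH Lr (hess ipH V x h))) =
  \sum_(j <- sJ) 'D_(b j) ('D_(b j) V) x.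
Proof.
have LA h : Lr (adjoint ipU ipH Lr (hess ipH V x h)) =
    \sum_(j <- sJ) 'D_h ('D_(b j) V) x *: b j.
  rewrite adjoint_finite_rank {1}/Lr finite_rankE; apply: eq_big_seq => j js.
  congr (_ *: _); rewrite ip_comb //; last by move=> *; exact: (fsets_on basisUU fJ).
    by rewrite ipC (hess_ip hH c1 VC).
  exact: fsets_uniq.
rewrite /trace (@usum_finite _ _ _ _ I) //; last first.
  move=> h Sh nI; rewrite (ip_out basisHH fI Sh nI) // LA proj_sum.
  by apply: eq_bigr => j _; rewrite projZ proj_b.
under eq_bigr do rewrite LA ip_sumr.
rewrite exchange_big /=; apply: eq_bigr => j _.
have hw w : 'D_(proj ipH sI (b j)) ('D_w V) x = \sum_(h <- sI) ipH h (b j) * 'D_h ('D_w V) x.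
  by rewrite /proj (ddV_suml VC).
have := hw (b j); rewrite proj_b => ->; apply: eq_bigr => h _.
by rewrite ipZr; exact: mulrC.
Qed.

Lemma adjoint_grad_norm x :
  `|adjoint ipU ipH Lr (grad ipH V x)| ^+ 2 = \sum_(j <- sJ) 'D_(b j) V x ^+ 2.
Proof.
rewrite adjoint_finite_rank (norm_comb hU) //.
- by apply: eq_bigr => j _; rewrite ipC (grad_ip hH c1 VC).
- exact: fsets_uniq.
- by move=> *; exact: (fsets_on basisUU fJ).
Qed.

End finite_rank.

(** * The pointwise one-step estimate *)

Section exp_estimates.
Context (R : realType).
Implicit Types x a b D g : R.

Lemma expR_sub1_le x : expR x - 1 <= x * expR x.
Proof.
have h := expR_ge1Dx (- x); have e0 := expR_gt0 x.
have : (1 - x) * expR x <= 1.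
  apply: (@le_trans _ _ (expR (- x) * expR x)); first by rewrite ler_pM2r.
  by rewrite -expRD addNr expR0.
by rewrite mulrBl mul1r; move: (x * expR x) (expR x) => *; lra.
Qed.

Lemma abs_expR_sub1 x : `|expR x - 1| <= `|x| * expR `|x|.
Proof.
have [x0|x0] := leP 0 x.
  rewrite !ger0_norm //; first exact: expR_sub1_le.
  by rewrite subr_ge0 -expR0 ler_expR.
rewrite ltr0_norm ?subr_lt0 -?expR0 ?ltr_expR // (ltr0_norm x0) opprB expR0.
have h := expR_ge1Dx x; apply: (@le_trans _ _ (- x)); first by lra.
rewrite ler_peMr //; first by rewrite oppr_ge0 ltW.
by rewrite -expR0 ler_expR oppr_ge0 ltW.
Qed.

Lemma expR_le_quadratic x : expR x <= 1 + x + x ^+ 2 * expR `|x|.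
Proof.
have h1 := expR_sub1_le x.
suff : x * (expR x - 1) <= x ^+ 2 * expR `|x|.
  by rewrite mulrBr mulr1; move: (x * expR x) (expR x) (x ^+ 2 * _) h1 => *; lra.
apply: le_trans (ler_norm _) _; rewrite normrM.
apply: le_trans (ler_wpM2l (normr_ge0 x) (abs_expR_sub1 x)) _.
by rewrite mulrA -expr2 real_normK ?num_real.
Qed.

(** The term [p * b] will be integrated to 0, so it must appear without the factor [expR a].
    Replacing [expR a * D] by D costs a multiple of [|a| |D|], and the expansion of [expR D] to
    first order costs a multiple of [D^2]. *)
Lemma expR_perturb (a b r y p : R) : 0 <= p <= 1 -> 0 <= y ->
  let D := p * b + p * r + y in
  expR (a + D) <= expR a + p * b +
    (`|r| + y + (`|a| * `|D| + D ^+ 2) * expR (`|a| + `|D|)).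
Proof.
move=> /andP[p0 p1] y0 /=; set D := p * b + p * r + y.
have ea := abs_expR_sub1 a.
have h1 : expR (a + D) <= expR a * (1 + D + D ^+ 2 * expR `|D|).
  by rewrite expRD ler_pM2l ?expR_gt0 //; exact: expR_le_quadratic.
have h2 : expR a * D <= D + `|a| * `|D| * expR (`|a| + `|D|).
  have -> : expR a * D = D + (expR a - 1) * D by rewrite mulrBl mul1r addrC subrK.
  rewrite lerD2l; apply: le_trans (ler_norm _) _; rewrite normrM mulrAC.
  apply: ler_wpM2r => //; apply: le_trans ea _; apply: ler_wpM2l => //.
  by rewrite ler_expR lerDl.
have h3 : expR a * (D ^+ 2 * expR `|D|) <= D ^+ 2 * expR (`|a| + `|D|).
  rewrite mulrCA -expRD; apply: ler_wpM2l; first exact: sqr_ge0.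
  by rewrite ler_expR lerD2r ler_norm.
have h4 : D <= p * b + `|r| + y.
  rewrite /D lerD2r lerD2l; apply: le_trans (ler_norm _) _.
  by rewrite normrM ger0_norm // ler_piMl.
apply: le_trans h1 _; rewrite 2!mulrDr mulr1 (mulrDl (`|a| * `|D|)).
move: (expR a) (expR a * D) (expR a * _) (`|a| * `|D| * _) (D ^+ 2 * _) h2 h3 h4.
by move=> *; lra.
Qed.

(** Young's inequality [k x <= 2 k^2 + x^2 / 8] for each increment, then [u v <= u^2 + v^2]: the
    bound is a sum and no longer a product, so the two noises can be integrated separately. *)
Lemma gauss_absorb (k g g' : R) : 0 <= k -> 0 <= g -> 0 <= g' ->
  expR (k * ((1 + g) + (1 + g'))) <=
  expR (2 * k + 4 * k ^+ 2) * (expR (g ^+ 2 / 4) + expR (g' ^+ 2 / 4)).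
Proof.
move=> k0 g0 g'0.
have h (x : R) : k * x <= 2 * k ^+ 2 + x ^+ 2 / 8.
  have := sqr_ge0 (4 * k - x); rewrite sqrrB; lra.
apply: (@le_trans _ _ (expR (2 * k + 4 * k ^+ 2) * (expR (g ^+ 2 / 8) * expR (g' ^+ 2 / 8)))).
  rewrite -!expRD ler_expR; have := h g; have := h g'; lra.
apply: ler_wpM2l; first exact: expR_ge0.
have e (x : R) : expR (x ^+ 2 / 4) = expR (x ^+ 2 / 8) ^+ 2.
  by rewrite [RHS]expr2 -expRD; congr expR; lra.
rewrite !e; have := sqr_ge0 (expR (g ^+ 2 / 8) - expR (g' ^+ 2 / 8)).
have := mulr_ge0 (expR_ge0 (g ^+ 2 / 8)) (expR_ge0 (g' ^+ 2 / 8)).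
move: (expR (g ^+ 2 / 8)) (expR (g' ^+ 2 / 8)) => u v; rewrite sqrrB; lra.
Qed.

(** The exponential is that of [gauss_absorb] at [k = 4 + 2 C^2]: 4 absorbs the monomial [G^4 G'^2]
    and [2 C^2] dominates [|a| + |D|]. The factor is 9 = 1 + 2 + 6, from [|r| + y], [|a| |D|] and
    [D^2]. *)
Definition absorb_const (C : R) : R :=
  9 * C ^+ 5 * expR (2 * (4 + 2 * C ^+ 2) + 4 * (4 + 2 * C ^+ 2) ^+ 2).

Lemma absorb_const_ge0 C : 0 <= C -> 0 <= absorb_const C.
Proof. by move=> C0; rewrite /absorb_const !mulr_ge0 ?exprn_ge0 ?expR_ge0. Qed.

(* [g] and [g'] are the increments [|z|/tau] and [|z_r|/tau]: the polynomial
   factors in them are absorbed into a Gaussian exponential, whereas [D] itself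
   may only grow linearly in them inside the exponential. *)
Lemma exp_step_bound (C L tau mu g g' a b r y p : R) :
  1 <= C -> 1 <= L -> 0 <= tau <= C -> 0 <= mu <= C -> L * tau <= C ->
  0 <= g -> 0 <= g' -> 0 <= p <= 1 -> 0 <= y ->
  `|a| <= C * (L * tau) * (1 + g) ->
  `|b| <= L * tau ^+ 2 * (1 + g) ^+ 2 ->
  `|r| <= C * (L * tau ^+ 3) * (1 + g) ^+ 3 ->
  y <= C * mu * (1 + g') ->
  let D := p * b + p * r + y in
  `|D| <= C * (L * tau) * (1 + g) + C * mu * (1 + g') ->
  expR (a + D) <= expR a + p * b + absorb_const C * (L ^+ 2 * tau ^+ 3 + mu) *
     (expR (g ^+ 2 / 4) + expR (g' ^+ 2 / 4)).
Proof.
move=> C1 L1 /andP[tau0 tauC] /andP[mu0 muC] nuC g0 g'0 p01 y0 ha hb hr hy D hD.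
have C0 : 0 <= C by lra.
have L0 : 0 <= L by lra.
pose G := 1 + g; pose G' := 1 + g'.
have G1 : 1 <= G by rewrite /G; lra.
have G'1 : 1 <= G' by rewrite /G'; lra.
have G0 : 0 <= G by lra.
have G'0 : 0 <= G' by lra.
rewrite -/G -/G' in ha hb hr hy hD.
pose nu := L * tau; have nu0 : 0 <= nu by rewrite mulr_ge0.
pose eta := L ^+ 2 * tau ^+ 3 + mu.
have Lt3 : 0 <= L ^+ 2 * tau ^+ 3 by rewrite mulr_ge0 ?exprn_ge0.
have eta0 : 0 <= eta by rewrite addr_ge0.
have p0 : 0 <= p by case/andP: p01. have p1 : p <= 1 by case/andP: p01.
have Cn n : 1 <= C ^+ n by exact: exprn_ege1.
have Gn n : 1 <= G ^+ n by exact: exprn_ege1.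
have G'n n : 1 <= G' ^+ n by exact: exprn_ege1.
have hr' : `|r| <= C * (L ^+ 2 * tau ^+ 3) * (G ^+ 4 * G' ^+ 2).
  apply: le_trans hr _; apply: ler_pM.
  - by rewrite !mulr_ge0 ?exprn_ge0.
  - exact: exprn_ge0.
  - apply: ler_wpM2l => //; apply: ler_wpM2r; first exact: exprn_ge0.
    by rewrite expr2 ler_peMr.
  - rewrite (_ : G ^+ 4 = G ^+ 3 * G); last by rewrite -exprSr.
    by rewrite -mulrA ler_peMr ?exprn_ge0 // -[leLHS]mulr1 ler_pM.
have hy' : y <= C * mu * (G ^+ 4 * G' ^+ 2).
  apply: le_trans hy _; apply: ler_wpM2l; first by rewrite mulr_ge0.
  by rewrite -[leLHS]mul1r ler_pM // expr2 ler_peMr.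
(* Two bounds on D are combined. This one has the small factor [L tau^2 + mu] but is polynomial in
   the increments; the other has only the factor [L tau + mu] but is linear in them. The products
   [|a| |D|] and [D^2] reach the order of [eta] through the first. *)
have hD2 : `|D| <= 2 * C ^+ 2 * (L * tau ^+ 2 + mu) * (G ^+ 3 * G').
  have d1 : `|D| <= `|b| + `|r| + y.
    rewrite /D; apply: le_trans (ler_normD _ _) _; rewrite (ger0_norm y0) lerD2r.
    apply: le_trans (ler_normD _ _) _; apply: lerD; rewrite normrM (ger0_norm p0);
    by rewrite ler_piMl.
  apply: le_trans d1 _.
  have e1 : `|b| <= C ^+ 2 * (L * tau ^+ 2) * (G ^+ 3 * G').
    apply: le_trans hb _; apply: ler_pM; rewrite ?mulr_ge0 ?exprn_ge0 //.
      by rewrite ler_peMl // mulr_ge0 ?exprn_ge0.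
    rewrite [G ^+ 3]exprSr -mulrA ler_peMr ?exprn_ge0 //.
    by rewrite -[leLHS]mulr1 ler_pM.
  have e2 : `|r| <= C ^+ 2 * (L * tau ^+ 2) * (G ^+ 3 * G').
    apply: le_trans hr _; apply: ler_pM; rewrite ?mulr_ge0 ?exprn_ge0 //.
      rewrite [tau ^+ 3]exprSr; have -> : C * (L * (tau ^+ 2 * tau)) = C * tau * (L * tau ^+ 2) by ring.
      by apply: ler_wpM2r; [rewrite mulr_ge0 ?exprn_ge0|rewrite expr2 ler_wpM2l].
    by rewrite ler_peMr ?exprn_ge0.
  have e3 : y <= 2 * C ^+ 2 * mu * (G ^+ 3 * G').
    apply: le_trans hy _; apply: ler_pM; rewrite ?mulr_ge0 //.
      apply: ler_wpM2r => //; have := Cn 1%N; rewrite expr2; have : C <= C * C by rewrite ler_peMl.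
      by rewrite expr1; lra.
    by rewrite ler_peMl.
  move: (G ^+ 3 * G') (C ^+ 2) e1 e2 e3 => u v e1 e2 e3.
  have -> : 2 * v * (L * tau ^+ 2 + mu) * u =
    v * (L * tau ^+ 2) * u + v * (L * tau ^+ 2) * u + 2 * v * mu * u by ring.
  by lra.
have hDl : `|D| <= C * (nu + mu) * (G * G').
  apply: le_trans hD _; rewrite -/nu.
  have -> : C * (nu + mu) * (G * G') = C * nu * (G * G') + C * mu * (G * G') by ring.
  apply: lerD.
    by apply: ler_wpM2l; [rewrite mulr_ge0|rewrite ler_peMr].
  by apply: ler_wpM2l; [rewrite mulr_ge0|rewrite ler_peMl].
have hDe : `|a| + `|D| <= 2 * C ^+ 2 * (G + G').
  have e1 : `|a| <= C ^+ 2 * G.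
    by apply: le_trans ha _; apply: ler_wpM2r => //; rewrite expr2 ler_wpM2l.
  have e2 : `|D| <= C ^+ 2 * G + C ^+ 2 * G'.
    apply: le_trans hD _; apply: lerD; apply: ler_wpM2r => //; rewrite expr2;
    by apply: ler_wpM2l.
  have : 0 <= C ^+ 2 * G' by rewrite mulr_ge0 ?exprn_ge0.
  by lra.
have haD : `|a| * `|D| <= 2 * C ^+ 4 * eta * (G ^+ 4 * G' ^+ 2).
  apply: le_trans (ler_pM _ _ ha hD2) _ => //.
  have -> : C * (L * tau) * G * (2 * C ^+ 2 * (L * tau ^+ 2 + mu) * (G ^+ 3 * G')) =
    2 * C ^+ 3 * (L ^+ 2 * tau ^+ 3 + nu * mu) * (G ^+ 4 * G') by rewrite /nu; ring.
  apply: ler_pM.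
  - by rewrite !mulr_ge0 ?exprn_ge0 // addr_ge0 // mulr_ge0.
  - by rewrite mulr_ge0 ?exprn_ge0.
  - rewrite [C ^+ 4]exprSr (mulrA 2) -[leRHS]mulrA; apply: ler_wpM2l.
      by rewrite mulr_ge0 ?exprn_ge0.
    rewrite /eta mulrDr; apply: lerD; first by rewrite ler_peMl.
    by apply: ler_wpM2r.
  - by apply: ler_wpM2l; [exact: exprn_ge0|rewrite expr2 ler_peMr].
have hDD : D ^+ 2 <= 6 * C ^+ 5 * eta * (G ^+ 4 * G' ^+ 2).
  rewrite -real_normK ?num_real // expr2.
  apply: le_trans (ler_pM _ _ hDl hD2) _ => //.
  have -> : C * (nu + mu) * (G * G') * (2 * C ^+ 2 * (L * tau ^+ 2 + mu) * (G ^+ 3 * G')) =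
    2 * C ^+ 3 * (L ^+ 2 * tau ^+ 3 + (nu + nu * tau + mu) * mu) * (G ^+ 4 * G' ^+ 2) by rewrite /nu; ring.
  apply: ler_wpM2r; first by rewrite mulr_ge0 ?exprn_ge0.
  have -> : 6 * C ^+ 5 * eta = 2 * C ^+ 3 * (3 * C ^+ 2 * eta) by ring.
  apply: ler_wpM2l; first by rewrite mulr_ge0 ?exprn_ge0.
  rewrite /eta mulrDr; apply: lerD.
    by rewrite ler_peMl //; have := Cn 2; lra.
  apply: ler_wpM2r => //.
  have : nu * tau <= C * C by rewrite ler_pM.
  have : C <= C * C by rewrite ler_peMl.
  by rewrite expr2; move: nuC muC; rewrite -/nu; lra.
apply: le_trans (expR_perturb _ _ _ p01 y0) _; rewrite -/D lerD2l.
have eG (x : R) : 0 <= x -> x <= expR x by move=> x0; have := expR_ge1Dx x; lra.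
have eG4 : G ^+ 4 * G' ^+ 2 <= expR (4 * (G + G')).
  have e1 : G ^+ 4 <= expR (4 * G).
    by rewrite mulrC expRM_natr; apply: lerXn2r; rewrite ?nnegrE ?expR_ge0 ?eG.
  have e2 : G' ^+ 2 <= expR (4 * G').
    apply: (@le_trans _ _ (G' ^+ 4)); first by apply: ler_weXn2l.
    by rewrite mulrC expRM_natr; apply: lerXn2r; rewrite ?nnegrE ?expR_ge0 ?eG.
  by rewrite mulrDr expRD; apply: ler_pM; rewrite ?exprn_ge0.
pose X := G ^+ 4 * G' ^+ 2; pose Ee := expR (2 * C ^+ 2 * (G + G')).
have X0 : 0 <= X by rewrite mulr_ge0 ?exprn_ge0.
have Ee1 : 1 <= Ee by rewrite -expR0 ler_expR !mulr_ge0 ?exprn_ge0 // addr_ge0.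
apply: (@le_trans _ _ (9 * C ^+ 5 * eta * X * Ee)).
  have f1 : `|r| + y <= C ^+ 5 * eta * X * Ee.
    apply: (@le_trans _ _ (C * eta * X)).
      by rewrite /eta mulrDr mulrDl; apply: lerD.
    rewrite -[leLHS]mulr1; apply: ler_pM => //; first by rewrite !mulr_ge0.
    apply: ler_wpM2r => //; apply: ler_wpM2r => //.
    by rewrite exprS ler_peMr.
  have f2 : (`|a| * `|D| + D ^+ 2) * expR (`|a| + `|D|) <= 8 * C ^+ 5 * eta * X * Ee.
    apply: ler_pM; rewrite ?expR_ge0 ?ler_expR //.
      by apply: addr_ge0; [apply: mulr_ge0|apply: sqr_ge0].
    have g1 : 2 * C ^+ 4 * eta * X <= 2 * C ^+ 5 * eta * X.
      apply: ler_wpM2r => //; apply: ler_wpM2r => //; apply: ler_wpM2l => //.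
      by rewrite [C ^+ 5]exprSr ler_peMr // exprn_ge0.
    by move: (C ^+ 5 * eta * X) haD hDD g1; rewrite -/X; move=> u; lra.
  by move: f1 f2; lra.
rewrite /absorb_const -/eta.
have -> : 9 * C ^+ 5 * expR (2 * (4 + 2 * C ^+ 2) + 4 * (4 + 2 * C ^+ 2) ^+ 2) * eta *
   (expR (g ^+ 2 / 4) + expR (g' ^+ 2 / 4)) = 9 * C ^+ 5 * eta *
   (expR (2 * (4 + 2 * C ^+ 2) + 4 * (4 + 2 * C ^+ 2) ^+ 2) * (expR (g ^+ 2 / 4) + expR (g' ^+ 2 / 4))).
  by move: (expR _) (expR _ + expR _) => u v; ring.
rewrite -mulrA; apply: ler_wpM2l; first by rewrite !mulr_ge0 ?exprn_ge0.
apply: le_trans (gauss_absorb _ g0 g'0); last by rewrite addr_ge0 // mulr_ge0 ?exprn_ge0.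
by rewrite [X in expR (X * _)]addrC -/G -/G' [_ + 4]addrC mulrDl expRD; apply: ler_wpM2r; rewrite ?expR_ge0.
Qed.

End exp_estimates.

(** * The taming map *)

Section tamed.
Context (R : realType) (E : normedModType R).
Implicit Types z : E.

Definition tame z : E := (1 + `|z| ^+ 2)^-1 *: z.

Let pos z : 0 < 1 + `|z| ^+ 2.
Proof. by rewrite ltr_pwDl // exprn_ge0. Qed.

Lemma norm_tame z : `|tame z| = (1 + `|z| ^+ 2)^-1 * `|z|.
Proof. by rewrite normrZ gtr0_norm // invr_gt0. Qed.

Lemma norm_tame_le z : `|tame z| <= `|z|.
Proof.
by rewrite norm_tame ler_piMl // invf_le1 // lerDl exprn_ge0.
Qed.

Lemma norm_tame_le1 z : `|tame z| <= 1.
Proof.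
rewrite norm_tame ler_pdivrMl // mulr1.
by have := sqr_ge0 (`|z| - 2^-1); rewrite sqrrB; lra.
Qed.

Lemma norm_sub_tame z : `|z - tame z| = `|tame z| * `|z| ^+ 2.
Proof.
have -> : z - tame z = ((1 + `|z| ^+ 2)^-1 * `|z| ^+ 2) *: z.
  rewrite /tame -{1}(scale1r z) -scalerBl; congr (_ *: _).
  by have := pos z; move: (`|z| ^+ 2) => u u0; field; rewrite gt_eqF.
by rewrite normrZ normrM (ger0_norm (exprn_ge0 _ _)) // norm_tame normfV (gtr0_norm (pos z)) mulrAC.
Qed.

(** Two orders of the same defect: the quadratic bound suffices where V'' supplies another small
    factor, while V' applied to the defect needs the cubic one. *)
Lemma norm_sub_tame2 z : `|z - tame z| <= `|z| ^+ 2.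
Proof. by rewrite norm_sub_tame ler_piMl ?exprn_ge0 // norm_tame_le1. Qed.

Lemma norm_sub_tame3 z : `|z - tame z| <= `|z| ^+ 3.
Proof. by rewrite norm_sub_tame exprS ler_wpM2r ?exprn_ge0 // norm_tame_le. Qed.

End tamed.

(** * Taylor expansion of one step *)

Section step_pointwise.
Context (R : realType) (E : completeNormedModType R) (ip : {dot E for idfun}).
Hypothesis hip : hilbert_norm ip.
Variables (c iota : R) (V Vbar : E -> R).
Hypothesis c1 : 1 <= c.
Hypothesis iota1 : 1 <= iota.
Hypothesis VC : Cnc 3 c [set r | 0 <= r] V.
Hypothesis Vbar_lip : forall x y,
  `|Vbar x - Vbar y| <= c * (1 + `|V x| `^ iota + `|V y| `^ iota) * `|x - y|.
Hypothesis Vbar_growth : forall x, `|Vbar x| <= c * (1 + `|V x| `^ iota).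
Local Notation dV x v := ('D_v V x).
Local Notation ddV x v w := ('D_v ('D_w V) x).

(* [x] is the state at the left end point of a time step of length [Dl], [f] the
   drift and [b j] the images of the basis vectors under the diffusion
   coefficient there; [tau] bounds the standard deviation of the noise. *)
Variables (T : Type) (sJ : seq T) (b : T -> E) (x f : E) (M Dl C K : R).
Hypotheses (Dl0 : 0 < Dl) (M0 : 0 < M) (K1 : Dl * M + 1 <= K).
Hypotheses (fM : `|f| <= M) (bM : \sum_(j <- sJ) `|b j| ^+ 2 <= M ^+ 2).

(** [L] bounds V within distance K of x and the first two derivatives of V at x; [Lbar] bounds
    [|Vbar x|] and the increments of Vbar from x, relative to their length, within that distance. *)
Variables (tau L Lbar : R).
Hypotheses (tauE : tau = M * Num.sqrt Dl) (LE : L = Llip c V K x).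
Hypothesis LbarE : Lbar = c * (1 + 2 * L `^ iota).
Local Notation mu := (Lbar * Dl * tau).

Hypotheses (C1 : 1 <= C) (tauC : tau <= C) (nuC : L * tau <= C) (muC : mu <= C).
Hypotheses (sqC : Num.sqrt Dl <= C * tau) (DlC : Dl <= C * tau).

(** The trace term of the generator and the square of the norm of B^* grad V, in the coordinates of
    the noise. *)
Definition gen_tr := \sum_(j <- sJ) ddV x (b j) (b j).
Definition gen_sq := \sum_(j <- sJ) dV x (b j) ^+ 2.
(** The variance of [p V'(x) z] is [p^2 Dl gen_sq], but the compensator carries p instead of [p^2]:
    this is what the generator inequality supplies when multiplied by [p Dl], and it suffices
    because [p <= 1]. *)
Definition lin_part (p : R) (z : E) := p * dV x z - p * Dl / 2 * gen_sq.
Definition quad_part (z : E) := 2^-1 * (ddV x z z - Dl * gen_tr).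
Definition rest_part (z : E) :=
  V (x + (Dl *: f + tame z)) - V x - Dl * dV x f - dV x z - 2^-1 * ddV x z z.

Let tau0 : 0 < tau. Proof. by rewrite tauE mulr_gt0 // sqrtr_gt0. Qed.
Let K_1 : 1 <= K. Proof. by apply: le_trans K1; rewrite lerDr mulr_ge0 // ltW. Qed.
Let L1 : 1 <= L.
Proof.
rewrite LE /Llip -[leLHS]mulr1; apply: ler_pM => //.
rewrite -[leLHS]mulr1; apply: ler_pM => //.
  by apply: Lgrow_ge1 => //; exact: le_trans K_1.
by rewrite lerDl (V_ge0 VC).
Qed.
Let L0 : 0 <= L. Proof. exact: le_trans L1. Qed.
Let VL : V x <= L.
Proof.
have K0 : 0 <= K by exact: le_trans K_1.
have V1 : 0 <= 1 + V x by rewrite addr_ge0 // (V_ge0 VC).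
apply: (@le_trans _ _ (1 + V x)); first by rewrite lerDr.
rewrite LE /Llip mulrA ler_peMl // -[leLHS]mulr1; apply: ler_pM => //.
exact: Lgrow_ge1.
Qed.

Let A := Dl * M.
Let A0 : 0 <= A. Proof. by rewrite mulr_ge0 // ltW. Qed.
Let C0 : 0 <= C. Proof. exact: le_trans C1. Qed.
(** The drift displacement equals [tau sqrt Dl] and so counts as a term of second order, like
    [|z|^2]. *)
Let Atau : A <= C * tau ^+ 2.
Proof.
have -> : A = tau * Num.sqrt Dl.
  by rewrite /A tauE -mulrA -expr2 sqr_sqrtr ?(ltW Dl0) // mulrC.
by rewrite expr2 mulrCA; apply: ler_wpM2l; first exact: ltW.
Qed.
Let AtauC : A <= C ^+ 2 * tau.
Proof.
apply: le_trans Atau _; rewrite [tau ^+ 2]expr2 [C ^+ 2]expr2 -mulrA.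
by apply: ler_wpM2l => //; apply: ler_wpM2r => //; exact: ltW.
Qed.

Let kbound (u : R) z : 0 <= u <= Dl -> `|u *: f + tame z| <= A + `|tame z|.
Proof.
move=> /andP[u0 uD]; apply: le_trans (ler_normD _ _) _; rewrite lerD2r normrZ.
by rewrite ger0_norm // ler_pM.
Qed.

Let kK (u : R) z : 0 <= u <= Dl -> `|u *: f + tame z| <= K.
Proof.
by move=> u0; apply: le_trans (kbound z u0) _; apply: le_trans K1; rewrite lerD2l norm_tame_le1.
Qed.

Let DlDl : 0 <= Dl <= Dl. Proof. by rewrite lexx ltW. Qed.

Let g (z : E) := `|z| / tau.
Let g0 z : 0 <= g z. Proof. by rewrite divr_ge0 // ltW. Qed.
Let gE z : `|z| = tau * g z. Proof. by rewrite /g mulrC divfK // gt_eqF. Qed.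
Let gsq z : g z ^+ 2 / 4 = `|z| ^+ 2 / (4 * tau ^+ 2).
Proof. by rewrite /g; have := tau0; move: tau => u u0; field; rewrite gt_eqF. Qed.

Let sqDl : Num.sqrt Dl ^+ 2 = Dl. Proof. by rewrite sqr_sqrtr // ltW. Qed.

Let gen_sq_bound : 0 <= Dl * gen_sq <= (L * tau) ^+ 2.
Proof.
apply/andP; split.
  by rewrite mulr_ge0 ?(ltW Dl0) // sumr_ge0 // => j _; rewrite sqr_ge0.
have -> : (L * tau) ^+ 2 = Dl * (L ^+ 2 * M ^+ 2) by rewrite tauE !exprMn sqDl; ring.
apply: ler_wpM2l; first exact: ltW.
apply: (@le_trans _ _ (L ^+ 2 * \sum_(j <- sJ) `|b j| ^+ 2)); last by rewrite ler_wpM2l ?exprn_ge0.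
rewrite mulr_sumr; apply: ler_sum => j _; rewrite -exprMn -real_normK ?num_real //.
by apply: lerXn2r; rewrite ?nnegrE ?mulr_ge0 //; rewrite LE; exact: (dV_bound c1 VC).
Qed.

Let gen_tr_bound : `|Dl * gen_tr| <= L * tau ^+ 2.
Proof.
have -> : L * tau ^+ 2 = Dl * (L * M ^+ 2) by rewrite tauE exprMn sqDl; ring.
rewrite normrM (gtr0_norm Dl0); apply: ler_wpM2l; first exact: ltW.
apply: (@le_trans _ _ (L * \sum_(j <- sJ) `|b j| ^+ 2)); last by rewrite ler_wpM2l.
apply: le_trans (ler_norm_sum _ _ _) _.
rewrite mulr_sumr; apply: ler_sum => j _; rewrite expr2 mulrA.
rewrite LE; exact: (ddV_bound c1 VC).
Qed.

Let dVz z : `|dV x z| <= L * tau * g z.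
Proof. by rewrite -mulrA -gE; rewrite LE; exact: (dV_bound c1 VC). Qed.

Let ddVz z w : `|ddV x z w| <= L * `|z| * `|w|. Proof. rewrite LE; exact: (ddV_bound c1 VC). Qed.

Let lin_bound p z : 0 <= p <= 1 -> `|lin_part p z| <= C * (L * tau) * (1 + g z).
Proof.
move=> /andP[p0 p1]; have nu0 : 0 <= L * tau by rewrite mulr_ge0 // ltW.
apply: le_trans (ler_normB _ _) _.
have h1 : `|p * dV x z| <= L * tau * g z.
  by rewrite normrM (ger0_norm p0); apply: le_trans (dVz z); rewrite ler_piMl.
have h2 : `|p * Dl / 2 * gen_sq| <= C * (L * tau).
  have /andP[s0 s1] := gen_sq_bound.
  have -> : p * Dl / 2 * gen_sq = (p / 2) * (Dl * gen_sq) by ring.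
  rewrite normrM (ger0_norm s0) ger0_norm; last by rewrite divr_ge0.
  apply: (@le_trans _ _ (Dl * gen_sq)); first by rewrite ler_piMl //; lra.
  by apply: le_trans s1 _; rewrite expr2; apply: ler_wpM2r.
rewrite mulrDr mulr1 addrC; apply: lerD => //; apply: le_trans h1 _.
by apply: ler_wpM2r => //; rewrite ler_peMl.
Qed.

Let quad_bound z : `|quad_part z| <= L * tau ^+ 2 * (1 + g z) ^+ 2.
Proof.
have h1 : `|ddV x z z| <= L * tau ^+ 2 * g z ^+ 2.
  by apply: le_trans (ddVz z z) _; rewrite gE le_eqVlt; apply/orP; left; apply/eqP; ring.
rewrite /quad_part normrM ger0_norm //.
have h2 : `|ddV x z z - Dl * gen_tr| <= L * tau ^+ 2 * (1 + g z ^+ 2).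
  by rewrite [leRHS]mulrDr mulr1 [leRHS]addrC; apply: le_trans (ler_normB _ _) _; apply: lerD.
apply: (@le_trans _ _ (L * tau ^+ 2 * (1 + g z ^+ 2))).
  by apply: le_trans h2; rewrite ler_piMl // invf_le1 // ler1n.
apply: ler_wpM2l; first by rewrite mulr_ge0 // sqr_ge0.
by have := g0 z; rewrite sqrrD; lra.
Qed.

(** With [k = Dl f + tame z], the remainder splits into the Taylor remainder at k, the defect
    [V'(x) (z - tame z)], and half of [V''(k - z, k) + V''(z, k - z)]; each is of third order in
    tau. The power [C^6] is the cube of the constant in [|k| <= C^2 tau G], and 4 = 1 + 1 + 2. *)
Let rest_bound z : `|rest_part z| <= 4 * C ^+ 6 * (L * tau ^+ 3) * (1 + g z) ^+ 3.
Proof.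
pose k := Dl *: f + tame z; pose G := 1 + g z.
have G1 : 1 <= G by rewrite lerDl.
have gG : g z <= G by rewrite lerDr.
have G0 : 0 <= G by exact: le_trans G1.
have t0 : 0 <= tau by exact: ltW.
have K0 : 0 <= K by exact: le_trans K_1.
have tay : `|V (x + k) - V x - dV x k - 2^-1 * ddV x k k| <= L * `|k| ^+ 3.
  by rewrite LE; apply: (V_taylor c1 VC) => //; exact: kK.
have kE : dV x k = Dl * dV x f + dV x (tame z).
  by rewrite /k (dVD VC) (dVZ VC).
have dkz : dV x z - dV x (tame z) = dV x (z - tame z).
  by rewrite (dVB VC).
have ddkz : ddV x k k - ddV x z z = ddV x (k - z) k + ddV x z (k - z).
  by rewrite (ddVBl VC x k z k) (ddVBr VC x k z z) addrA subrK.
have -> : rest_part z = (V (x + k) - V x - dV x k - 2^-1 * ddV x k k)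
   - dV x (z - tame z) + 2^-1 * (ddV x (k - z) k + ddV x z (k - z)).
  rewrite -ddkz -dkz kE /rest_part -/k.
  by move: (V _) (V x) (dV x f) (dV x z) (dV x (tame z)) (ddV x z z) (ddV x k k) => *; ring.
have nk : `|k| <= C ^+ 2 * tau * G.
  apply: le_trans (kbound z DlDl) _.
  apply: (@le_trans _ _ (C ^+ 2 * tau + tau * g z)).
    by apply: lerD => //; rewrite -gE norm_tame_le.
  rewrite /G mulrDr mulr1 lerD2l; apply: ler_wpM2r => //.
  by rewrite ler_peMl // exprn_ege1.
have nz : `|z| <= C ^+ 2 * tau * G.
  rewrite gE -mulrA; apply: (@le_trans _ _ (tau * G)); first by apply: ler_wpM2l.
  by rewrite ler_peMl ?mulr_ge0 // exprn_ege1.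
have nkz : `|k - z| <= 2 * C * tau ^+ 2 * G ^+ 2.
  have -> : k - z = Dl *: f - (z - tame z) by rewrite opprB addrA addrAC -addrA addrA.
  apply: le_trans (ler_normB _ _) _.
  have e1 : `|Dl *: f| <= C * tau ^+ 2 * G ^+ 2.
    rewrite normrZ gtr0_norm //; apply: (@le_trans _ _ A); first by apply: ler_wpM2l => //; exact: ltW.
    by apply: le_trans Atau _; rewrite ler_peMr ?mulr_ge0 ?sqr_ge0 // exprn_ege1.
  have e2 : `|z - tame z| <= C * tau ^+ 2 * G ^+ 2.
    apply: le_trans (norm_sub_tame2 z) _; rewrite gE exprMn -mulrA.
    apply: (@le_trans _ _ (tau ^+ 2 * G ^+ 2)).
      by apply: ler_wpM2l; [exact: sqr_ge0|apply: lerXn2r; rewrite ?nnegrE].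
    by rewrite ler_peMl // mulr_ge0 // sqr_ge0.
  have -> : 2 * C * tau ^+ 2 * G ^+ 2 = C * tau ^+ 2 * G ^+ 2 + C * tau ^+ 2 * G ^+ 2 by ring.
  exact: lerD.
have h1 : L * `|k| ^+ 3 <= C ^+ 6 * (L * tau ^+ 3) * G ^+ 3.
  have -> : C ^+ 6 * (L * tau ^+ 3) * G ^+ 3 = L * (C ^+ 2 * tau * G) ^+ 3 by ring.
  by apply: ler_wpM2l => //; apply: lerXn2r; rewrite ?nnegrE ?mulr_ge0 ?exprn_ge0.
have h2 : `|dV x (z - tame z)| <= C ^+ 6 * (L * tau ^+ 3) * G ^+ 3.
  have -> : C ^+ 6 * (L * tau ^+ 3) * G ^+ 3 = C ^+ 6 * (L * (tau ^+ 3 * G ^+ 3)) by ring.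
  have h : `|dV x (z - tame z)| <= L * (tau ^+ 3 * G ^+ 3).
    apply: (@le_trans _ _ (L * `|z - tame z|)); first by rewrite LE; exact: (dV_bound c1 VC).
    apply: ler_wpM2l => //; apply: le_trans (norm_sub_tame3 z) _; rewrite gE exprMn.
    by apply: ler_wpM2l; [exact: exprn_ge0|apply: lerXn2r; rewrite ?nnegrE].
  by apply: le_trans h _; rewrite ler_peMl ?exprn_ege1 // !mulr_ge0 ?exprn_ge0.
have C36 : C ^+ 3 <= C ^+ 6 by apply: ler_weXn2l.
have h3 (w : E) : `|w| <= C ^+ 2 * tau * G ->
    L * `|k - z| * `|w| <= 2 * C ^+ 3 * (L * tau ^+ 3) * G ^+ 3.
  move=> hw; have -> : 2 * C ^+ 3 * (L * tau ^+ 3) * G ^+ 3 =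
    L * (2 * C * tau ^+ 2 * G ^+ 2) * (C ^+ 2 * tau * G) by ring.
  by apply: ler_pM => //; [rewrite mulr_ge0|apply: ler_wpM2l].
have h4 : `|ddV x (k - z) k| <= 2 * C ^+ 3 * (L * tau ^+ 3) * G ^+ 3.
  by apply: le_trans (ddVz _ _) (h3 _ nk).
have h5 : `|ddV x z (k - z)| <= 2 * C ^+ 3 * (L * tau ^+ 3) * G ^+ 3.
  by apply: le_trans (ddVz _ _) _; rewrite mulrAC; exact: h3.
have h6 : C ^+ 3 * (L * tau ^+ 3) * G ^+ 3 <= C ^+ 6 * (L * tau ^+ 3) * G ^+ 3.
  by apply: ler_wpM2r; [exact: exprn_ge0|apply: ler_wpM2r => //; rewrite mulr_ge0 ?exprn_ge0].
apply: le_trans (ler_normD _ _) _.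
have h7 : `|2^-1 * (ddV x (k - z) k + ddV x z (k - z))| <= 2 * C ^+ 3 * (L * tau ^+ 3) * G ^+ 3.
  rewrite normrM ger0_norm //; apply: (@le_trans _ _ (2^-1 * (2 * (2 * C ^+ 3 * (L * tau ^+ 3) * G ^+ 3)))).
    apply: ler_wpM2l => //; apply: le_trans (ler_normD _ _) _.
    move: h4 h5; set X := 2 * C ^+ 3 * (L * tau ^+ 3) * G ^+ 3 => h4 h5.
    by apply: le_trans (lerD h4 h5) _; clearbody X; rewrite mulr_natl mulr2n.
  by rewrite mulKf.
apply: le_trans (lerD (ler_normB _ _) h7) _.
have -> : 4 * C ^+ 6 * (L * tau ^+ 3) * G ^+ 3 = C ^+ 6 * (L * tau ^+ 3) * G ^+ 3 +
  C ^+ 6 * (L * tau ^+ 3) * G ^+ 3 + 2 * (C ^+ 6 * (L * tau ^+ 3) * G ^+ 3) by ring.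
apply: lerD; first by apply: lerD => //; exact: le_trans tay h1.
by rewrite -mulrA -mulrA; apply: ler_wpM2l => //; rewrite mulrA.
Qed.

(** The constant of [rest_bound], which also dominates that of [rem_bound]; [exp_step_bound] takes a
    single one. *)
Let Cb := 4 * C ^+ 6.

Let C2Cb : 4 * C ^+ 2 <= Cb.
Proof. by apply: ler_wpM2l => //; apply: ler_weXn2l. Qed.

Let CCb : C <= Cb.
Proof.
apply: le_trans C2Cb; apply: (@le_trans _ _ (C ^+ 2)).
  by rewrite expr2 ler_peMr.
by rewrite ler_peMl ?sqr_ge0 // ler1n.
Qed.

Let Cb1 : 1 <= Cb. Proof. exact: le_trans CCb. Qed.

Definition step_eta := absorb_const (4 * C ^+ 6) * (L ^+ 2 * tau ^+ 3 + mu).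

Let Lbar0 : 0 <= Lbar.
Proof.
by rewrite LbarE mulr_ge0 ?(le_trans ler01 c1) // addr_ge0 // mulr_ge0 // powR_ge0.
Qed.

Let mu0 : 0 <= mu.
Proof. by rewrite mulr_ge0 ?(ltW tau0) // mulr_ge0 // ltW. Qed.

(** The separate bounds are quadratic and cubic in [g z]. In the sum the term [V''(z, z)] cancels;
    what is left is an increment of V, Lipschitz because taming keeps the displacement within K, and
    terms that are linear or constant in z. *)
Let rem_bound z : `|quad_part z + rest_part z| <= 4 * C ^+ 2 * (L * tau) * (1 + g z).
Proof.
have K0 : 0 <= K by exact: le_trans K_1.
have -> : quad_part z + rest_part z = (V (x + (Dl *: f + tame z)) - V x)
   - Dl * dV x f - dV x z - 2^-1 * (Dl * gen_tr).
  rewrite /quad_part /rest_part mulrBr.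
  by move: (V _) (V x) (dV x f) (dV x z) (ddV x z z) (Dl * gen_tr) => *; ring.
have h1 : `|V (x + (Dl *: f + tame z)) - V x| <= L * (C ^+ 2 * tau + tau * g z).
  have [h _ _] := V_lip_local c1 VC x K0 (kK z DlDl).
  rewrite -LE in h; apply: le_trans h _; apply: ler_wpM2l => //.
  apply: le_trans (kbound z DlDl) _; apply: lerD => //.
  by rewrite -gE norm_tame_le.
have h2 : `|Dl * dV x f| <= L * (C ^+ 2 * tau).
  rewrite normrM gtr0_norm //; apply: (@le_trans _ _ (Dl * (L * M))).
    apply: ler_wpM2l; first exact: ltW.
    apply: (@le_trans _ _ (L * `|f|)); last exact: ler_wpM2l.
    by rewrite LE; exact: (dV_bound c1 VC).
  by rewrite mulrCA; apply: ler_wpM2l.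
have h3 : `|2^-1 * (Dl * gen_tr)| <= L * (C ^+ 2 * tau).
  rewrite normrM ger0_norm //; apply: (@le_trans _ _ (L * tau ^+ 2)).
    by apply: le_trans gen_tr_bound; rewrite ler_piMl // invf_le1 // ler1n.
  apply: ler_wpM2l => //; rewrite expr2; apply: ler_wpM2r; first exact: ltW.
  by apply: le_trans tauC _; rewrite expr2 ler_peMr.
apply: le_trans (ler_normB _ _) _; apply: le_trans (lerD (ler_normB _ _) h3) _.
apply: le_trans (lerD (lerD (ler_normB _ _) (dVz z)) (lexx _)) _.
apply: le_trans (lerD (lerD (lerD h1 h2) (lexx _)) (lexx _)) _.
have C2 : 1 <= C ^+ 2 by exact: exprn_ege1.
have t0 : 0 <= L * tau * g z by rewrite mulr_ge0 // mulr_ge0 // ltW.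
have t1 : L * tau * g z <= C ^+ 2 * (L * tau * g z) by rewrite ler_peMl.
have t2 : 0 <= C ^+ 2 * (L * tau) by rewrite mulr_ge0 ?sqr_ge0 // mulr_ge0 // ltW.
have -> : 4 * C ^+ 2 * (L * tau) * (1 + g z) = 4 * (C ^+ 2 * (L * tau)) + 4 * (C ^+ 2 * (L * tau * g z)) by ring.
have -> : L * (C ^+ 2 * tau + tau * g z) + L * (C ^+ 2 * tau) + L * tau * g z + L * (C ^+ 2 * tau)
  = 3 * (C ^+ 2 * (L * tau)) + 2 * (L * tau * g z) by ring.
by move: (C ^+ 2 * (L * tau * g z)) (C ^+ 2 * (L * tau)) (L * tau * g z) t0 t1 t2 => *; lra.
Qed.

Let main_bound (p y : R) z z' : 0 <= p <= 1 -> 0 <= y -> y <= Cb * mu * (1 + g z') ->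
  expR (lin_part p z + (p * quad_part z + p * rest_part z + y)) <=
  expR (lin_part p z) + p * quad_part z +
  step_eta * (expR (`|z| ^+ 2 / (4 * tau ^+ 2)) + expR (`|z'| ^+ 2 / (4 * tau ^+ 2))).
Proof.
move=> p01 y0 yb; rewrite -!gsq /step_eta.
have nu0 : 0 <= L * tau by rewrite mulr_ge0 // ltW.
have G0 : 0 <= 1 + g z by rewrite addr_ge0.
have /andP[p0 p1] := p01.
apply: exp_step_bound => //.
- by rewrite (ltW tau0) (le_trans tauC).
- by rewrite mu0 (le_trans muC).
- exact: le_trans nuC _.
- apply: le_trans (lin_bound z p01) _; apply: ler_wpM2r => //.
  by apply: ler_wpM2r.
- rewrite -mulrDr; apply: le_trans (ler_normD _ _) _; rewrite (ger0_norm y0).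
  apply: lerD => //; rewrite normrM (ger0_norm p0).
  apply: (@le_trans _ _ `|quad_part z + rest_part z|); first by rewrite ler_piMl.
  apply: le_trans (rem_bound z) _; apply: ler_wpM2r => //.
  by apply: ler_wpM2r.
Qed.

(** Needed for Tonelli in the decoupling. Taking [y = 0] and the same noise twice in [main_bound]
    puts an exponential below the majorant, whence the factor 2 before [step_eta]. *)
Lemma step_majorant_ge0 (p : R) z : 0 <= p <= 1 ->
  0 <= expR (lin_part p z) + p * quad_part z +
  2 * step_eta * expR (`|z| ^+ 2 / (4 * tau ^+ 2)).
Proof.
move=> p01; have y0 : 0 <= Cb * mu * (1 + g z).
  by apply: mulr_ge0; [rewrite mulr_ge0 // (le_trans ler01 Cb1)|rewrite addr_ge0].
have := @main_bound p 0 z z p01 (lexx 0) y0; move/(le_trans (expR_ge0 _))/le_trans; apply.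
rewrite lerD2l; set e := expR _; rewrite le_eqVlt; apply/orP; left; apply/eqP; ring.
Qed.

(** The generator inequality is multiplied by [p Dl], and [p (1 + rho Dl) <= q] turns its right-hand
    side into the change of discount from t to s. What remains is the sum of the linear, quadratic
    and remainder parts and an error y of the time integral. *)
Lemma step_pointwise (rho s r t : R) (Yt Yr z zr : E) :
  0 <= rho <= C -> Dl = t - s -> 0 <= s -> s <= r <= t ->
  dV x f + 2^-1 * gen_tr + 2^-1 * gen_sq + Vbar x <= rho * V x ->
  V Yt <= V (x + (Dl *: f + tame z)) ->
  Vbar Yr <= Vbar (x + ((r - s) *: f + tame zr)) ->
  let p := expR (- (rho * t)) in
  expR (p * V Yt + Dl * (expR (- (rho * r)) * Vbar Yr)) <=
  expR (expR (- (rho * s)) * V x) *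
   (expR (lin_part p z) + p * quad_part z +
    step_eta * (expR (`|z| ^+ 2 / (4 * tau ^+ 2)) + expR (`|zr| ^+ 2 / (4 * tau ^+ 2)))).
Proof.
move=> /andP[rho0 rhoC] DlE s0 /andP[sr rt] gen hYt hYr /=; set p := expR (- (rho * t)).
have t0 : 0 <= t by rewrite (le_trans s0) // (le_trans sr).
have K0 : 0 <= K by exact: le_trans K_1.
pose q := expR (- (rho * s)); pose w := expR (- (rho * r)).
have p0 : 0 <= p by exact: expR_ge0.
have p1 : p <= 1 by rewrite -expR0 ler_expR oppr_le0 mulr_ge0.
have pw : p <= w by rewrite ler_expR lerN2 ler_wpM2l.
have wq : w <= q by rewrite ler_expR lerN2 ler_wpM2l.
have q1 : q <= 1 by rewrite -expR0 ler_expR oppr_le0 mulr_ge0.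
have w0 : 0 <= w by exact: expR_ge0.
have w1 : w <= 1 by exact: le_trans wq q1.
have pE : p = q * expR (- (rho * Dl)) by rewrite -expRD DlE; congr expR; ring.
have qE : q = p * expR (rho * Dl) by rewrite pE -mulrA -expRD addNr expR0 mulr1.
have qp1 : p * (1 + rho * Dl) <= q by rewrite qE; apply: ler_wpM2l => //; exact: expR_ge1Dx.
have qp2 : q - p <= rho * Dl.
  have h : 1 - rho * Dl <= expR (- (rho * Dl)) by exact: expR_ge1Dx.
  have : q * (1 - rho * Dl) <= p by rewrite pE; apply: ler_wpM2l => //; exact: expR_ge0.
  have : q * (rho * Dl) <= rho * Dl by rewrite ler_piMl // mulr_ge0 // ltW.
  by rewrite mulrBr mulr1; lra.
(* The first summand pays for the weight p in place of [e^(-rho r)], which differ by at most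
   [rho Dl]; the second for [Vbar x] in place of [Vbar Yr]. *)
pose y := rho * Dl ^+ 2 * Lbar + Lbar * Dl * (A + tau * g zr).
have Vi0 : 0 <= L `^ iota by exact: powR_ge0.
have Vbx : `|Vbar x| <= Lbar.
  apply: le_trans (Vbar_growth x) _; rewrite LbarE; apply: ler_wpM2l; first exact: le_trans c1.
  rewrite lerD2l ger0_norm ?(V_ge0 VC) //.
  apply: (@le_trans _ _ (L `^ iota)); last by rewrite ler_peMl // ler1n.
  by apply: ge0_ler_powR; rewrite ?nnegrE ?(V_ge0 VC) // (le_trans ler01).
have rDl : 0 <= r - s <= Dl by rewrite subr_ge0 sr DlE lerD2r.
pose kr := (r - s) *: f + tame zr.
have Vbr : Vbar (x + kr) - Vbar x <= Lbar * (A + tau * g zr).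
  apply: le_trans (ler_norm _) _; apply: le_trans (Vbar_lip _ _) _.
  rewrite [x + kr - x]addrAC subrr add0r LbarE; apply: ler_pM => //.
  - by rewrite mulr_ge0 ?(le_trans ler01 c1) // !addr_ge0 // powR_ge0.
  - apply: ler_wpM2l; first exact: le_trans c1.
    have hV u : 0 <= u -> u <= L -> `|u| `^ iota <= L `^ iota.
      by move=> u0 uL; rewrite ger0_norm //; apply: ge0_ler_powR; rewrite ?nnegrE // (le_trans ler01).
    have hx := hV _ (V_ge0 VC x) VL.
    have hk := hV _ (V_ge0 VC (x + kr)).
    have : V (x + kr) <= L.
      apply: (@le_trans _ _ (1 + V (x + kr))); first by rewrite lerDr.
      apply: le_trans (V_growth c1 VC x K0 (kK zr rDl)) _.
      rewrite LE /Llip ler_peMl // mulr_ge0 ?addr_ge0 ?(V_ge0 VC) //.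
      by rewrite (le_trans ler01) // Lgrow_ge1.
    by move=> /hk; move: hx; move: (`|V x| `^ iota) (`|V (x + kr)| `^ iota) (L `^ iota) => *; lra.
  - apply: le_trans (kbound zr rDl) _; rewrite lerD2l -gE; exact: norm_tame_le.
have y0 : 0 <= y.
  apply: addr_ge0.
    by apply: mulr_ge0 => //; apply: mulr_ge0 => //; exact: sqr_ge0.
  by rewrite mulr_ge0 ?(mulr_ge0 _ (ltW Dl0)) // addr_ge0 // mulr_ge0 // ltW.
have yb : y <= Cb * mu * (1 + g zr).
  have e1 : rho * Dl ^+ 2 * Lbar <= C ^+ 2 * mu.
    have -> : C ^+ 2 * mu = (C * (C * tau)) * (Dl * Lbar) by ring.
    have -> : rho * Dl ^+ 2 * Lbar = rho * Dl * (Dl * Lbar) by ring.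
    by apply: ler_wpM2r; [rewrite mulr_ge0 // ltW|apply: ler_pM => //; exact: ltW].
  have e2 : Lbar * Dl * (A + tau * g zr) <= C ^+ 2 * mu + mu * g zr.
    rewrite mulrDr; apply: lerD; last by rewrite mulrA.
    have -> : C ^+ 2 * mu = Lbar * Dl * (C ^+ 2 * tau) by ring.
    by apply: ler_wpM2l => //; rewrite mulr_ge0 // ltW.
  have e3 : mu * g zr <= Cb * mu * g zr by apply: ler_wpM2r => //; rewrite ler_peMl.
  have e4 : 4 * C ^+ 2 * mu <= Cb * mu by apply: ler_wpM2r.
  have e5 : 0 <= C ^+ 2 * mu by rewrite mulr_ge0 ?sqr_ge0.
  rewrite /y [leRHS]mulrDr mulr1; rewrite -mulrA in e4.
  by move: (C ^+ 2 * mu) (Cb * mu * g zr) (mu * g zr) (Cb * mu) e1 e2 e3 e4 e5 => *; lra.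
have expo : p * V Yt + Dl * (w * Vbar Yr) <=
    q * V x + (lin_part p z + (p * quad_part z + p * rest_part z + y)).
  have f1 : p * V Yt <= p * V (x + (Dl *: f + tame z)) by apply: ler_wpM2l.
  have f2 : w * Vbar Yr <= w * Vbar x + Lbar * (A + tau * g zr).
    apply: (@le_trans _ _ (w * Vbar (x + kr))); first by apply: ler_wpM2l.
    rewrite -lerBlDl -mulrBr; apply: (@le_trans _ _ (w * (Lbar * (A + tau * g zr)))).
      by apply: ler_wpM2l.
    by rewrite ler_piMl // mulr_ge0 // addr_ge0 // mulr_ge0 // ltW.
  have f3 : w * Vbar x <= p * Vbar x + rho * Dl * Lbar.
    rewrite -lerBlDl -mulrBl; apply: le_trans (ler_norm _) _; rewrite normrM.
    apply: ler_pM => //; rewrite ger0_norm ?subr_ge0 //.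
    by apply: le_trans qp2; rewrite lerD2r.
  have f4 : Dl * (w * Vbar Yr) <= Dl * (p * Vbar x) + y.
    have -> : Dl * (p * Vbar x) + y = Dl * (p * Vbar x + rho * Dl * Lbar + Lbar * (A + tau * g zr)).
      by rewrite /y; ring.
    apply: ler_wpM2l; first exact: ltW.
    by apply: le_trans f2 _; rewrite lerD2r.
  have f5 : p * V x + p * (rho * Dl) * V x <= q * V x.
    rewrite -mulrDl; apply: ler_wpM2r; first exact: (V_ge0 VC).
    by rewrite -{1}(mulr1 p) -mulrDr.
  have f6 : (p * Dl) * (dV x f + 2^-1 * gen_tr + 2^-1 * gen_sq + Vbar x) <= (p * Dl) * (rho * V x).
    by apply: ler_wpM2l => //; rewrite mulr_ge0 // ltW.
  have -> : lin_part p z + (p * quad_part z + p * rest_part z + y) =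
     p * (V (x + (Dl *: f + tame z)) - V x) - (p * Dl) * (dV x f + 2^-1 * gen_tr + 2^-1 * gen_sq) + y.
    rewrite /lin_part /quad_part /rest_part.
    clearbody y; move: (V (x + _)) (V x) (dV x f) (dV x z) (ddV x z z) gen_tr gen_sq => *; by field.
  move: f1 f4 f5 f6; clearbody p q w y.
  move: (V Yt) (V (x + _)) (V x) (Vbar Yr) (Vbar x) (dV x f) gen_tr gen_sq => *; lra.
apply: (@le_trans _ _ (expR (q * V x + (lin_part p z + (p * quad_part z + p * rest_part z + y))))).
  by rewrite ler_expR.
rewrite expRD; apply: ler_wpM2l; first exact: expR_ge0.
by apply: main_bound => //; rewrite p0.
Qed.

End step_pointwise.

(** * Gaussian increments *)

Section integral_scale.
Context d (T : measurableType d) (R : realType) (mu : {measure set T -> \bar R}).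
Local Open Scope ereal_scope.

Lemma ge0_integral_scale (r : R) (f : T -> \bar R) : (0 <= r)%R ->
  measurable_fun setT f -> (forall x, 0 <= f x) ->
  \int[mu]_x (r%:E * f x) = r%:E * \int[mu]_x f x.
Proof. by move=> r0 mf f0; apply: ge0_integralZl => //; rewrite lee_fin. Qed.

End integral_scale.

Section normal_moments.
Context (R : realType).
Local Notation mu := (@lebesgue_measure R).
Local Open Scope ereal_scope.

(** Identifies the Radon-Nikodym derivative with the density almost everywhere: both have the same
    integral over every measurable set. *)
Lemma integral_normal_prob (m s : R) (f : measurableTypeR R -> \bar R) :
  measurable_fun setT f -> (forall x, 0 <= f x) ->
  \int[normal_prob m s]_x f x = \int[mu]_x (f x * (normal_pdf m s x)%:E).
Proof.
move=> mf f0; have dom := normal_prob_dominates m s.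
rewrite -(Radon_Nikodym_SigmaFinite.change_of_variables dom f0 measurableT mf).
have mpdf : measurable_fun setT (fun x : measurableTypeR R => (normal_pdf m s x)%:E).
  by apply/measurable_EFinP; exact: measurable_normal_pdf.
have If := Radon_Nikodym_SigmaFinite.f_integrable dom.
apply: ae_eq_integral => //.
- by apply: emeasurable_funM => //; exact: measurable_int If.
- exact: emeasurable_funM.
- apply: filterS (integral_ae_eq measurableT If mpdf _).
    by move=> x h /h ->.
  by move=> A _ mA; rewrite -Radon_Nikodym_SigmaFinite.f_integral.
Qed.

(** Completing the square gives a multiple of the density with mean [c s^2]. *)
Lemma normal_expR (c s : R) : (s != 0)%R ->
  \int[normal_prob 0 s]_x (expR (c * x))%:E = (expR (c ^+ 2 * s ^+ 2 / 2))%:E.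
Proof.
move=> s0; rewrite integral_normal_prob; last 2 first.
- apply/measurable_EFinP/measurableT_comp => //; exact: measurable_funM.
- by move=> x; rewrite lee_fin expR_ge0.
transitivity (\int[mu]_x ((expR (c ^+ 2 * s ^+ 2 / 2))%:E * (normal_pdf (c * s ^+ 2) s x)%:E)).
  apply: eq_integral => x _; rewrite -!EFinM; congr (_%:E).
  rewrite /normal_pdf (negbTE s0) /normal_fun [LHS]mulrCA [RHS]mulrCA -!expRD.
  congr (_ * expR _)%R; rewrite subr0 -(mulr_natr (s ^+ 2) 2).
  by move: (x : R) s0 => y s0; field.
have mp : measurable_fun setT (fun x : measurableTypeR R => (normal_pdf (c * s ^+ 2) s x)%:E).
  by apply/measurable_EFinP; exact: measurable_normal_pdf.
rewrite (ge0_integral_scale _ _ mp) ?expR_ge0 //.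
  by rewrite integral_normal_pdf mule1.
by move=> x; rewrite lee_fin normal_pdf_ge0.
Qed.

(* [v] parametrises the exponent [a = (1 - v^-2) / 2] by the value
   [(1 - 2 a)^(-1/2)] of the integral. *)
Lemma normal_expR_sqr (s v : R) : (0 < s)%R -> (0 < v)%R ->
  \int[normal_prob 0 s]_x (expR ((1 - v ^- 2) / 2 * (x ^+ 2 / s ^+ 2)))%:E = v%:E.
Proof.
move=> s0 v0; rewrite integral_normal_prob; last 2 first.
- apply/measurable_EFinP/measurableT_comp => //; apply: measurable_funM => //.
  by apply: measurable_funM => //; exact: measurable_funX.
- by move=> x; rewrite lee_fin expR_ge0.
have s0' : (s != 0)%R by rewrite gt_eqF.
have v0' : (v != 0)%R by rewrite gt_eqF.
have sv0 : (s * v != 0)%R by rewrite mulf_neq0.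
transitivity (\int[mu]_x (v%:E * (normal_pdf 0 (s * v) x)%:E)).
  apply: eq_integral => x _; rewrite -!EFinM; congr (_%:E).
  rewrite /normal_pdf (negbTE s0') (negbTE sv0) /normal_fun [LHS]mulrCA -!expRD [RHS]mulrA.
  congr (_ * expR _)%R.
    rewrite /normal_peak.
    have -> : ((s * v) ^+ 2 * pi *+ 2 = v ^+ 2 * (s ^+ 2 * pi *+ 2))%R.
      by rewrite exprMn mulrnAr mulrA [(v ^+ 2 * _)%R]mulrC.
    by rewrite sqrtrM ?sqr_ge0 // sqrtr_sqr (gtr0_norm v0) invfM mulrA divff // mul1r.
  rewrite subr0 -(mulr_natr (s ^+ 2) 2) -(mulr_natr ((s * v) ^+ 2) 2).
  by move: (x : R) => y; field; rewrite s0' v0'.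
have mp : measurable_fun setT (fun x : measurableTypeR R => (normal_pdf 0 (s * v) x)%:E).
  by apply/measurable_EFinP; exact: measurable_normal_pdf.
rewrite (ge0_integral_scale _ (ltW v0) mp) //.
  by rewrite integral_normal_pdf mule1.
by move=> x; rewrite lee_fin normal_pdf_ge0.
Qed.

(** Domination by the exponential of [normal_expR_sqr] at [v = 2], whose coefficient is 3/8; the
    factor 8/3 undoes it in [y <= e^y]. *)
Lemma normal_sqr_integrable (s : R) : (0 < s)%R ->
  (normal_prob 0 s).-integrable setT (fun x => (x ^+ 2)%:E).
Proof.
move=> s0; apply/integrableP; split.
  by apply/measurable_EFinP; exact: measurable_funX.
have s2 : (0 < s ^+ 2)%R by rewrite exprn_gt0.
apply: (@le_lt_trans _ _ (\int[normal_prob 0 s]_x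
   ((8 / 3 * s ^+ 2)%:E * (expR ((1 - 2 ^- 2) / 2 * (x ^+ 2 / s ^+ 2)))%:E))).
  apply: ge0_le_integral => //.
  - apply: measurableT_comp => //; apply/measurable_EFinP; exact: measurable_funX.
  - apply: emeasurable_funM => //; apply/measurable_EFinP/measurableT_comp => //.
    by apply: measurable_funM => //; apply: measurable_funM => //; exact: measurable_funX.
  - move=> x _ /=; rewrite lee_fin ger0_norm ?sqr_ge0 //.
    have := expR_ge1Dx ((1 - 2 ^- 2) / 2 * (x ^+ 2 / s ^+ 2))%R.
    have -> : ((1 - 2 ^- 2) / 2 * (x ^+ 2 / s ^+ 2) = 3 / 8 * (x ^+ 2 / s ^+ 2))%R by field; rewrite gt_eqF.
    set e := expR _ => h.
    have -> : (x ^+ 2 = 8 / 3 * s ^+ 2 * (3 / 8 * (x ^+ 2 / s ^+ 2)))%R by field; rewrite gt_eqF.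
    apply: ler_wpM2l; first by rewrite mulr_ge0 // ltW.
    by apply: le_trans h; rewrite lerDr.
have me : measurable_fun setT (fun x : measurableTypeR R => (expR ((1 - 2 ^- 2) / 2 * (x ^+ 2 / s ^+ 2)))%:E).
  apply/measurable_EFinP/measurableT_comp => //.
  by apply: measurable_funM => //; apply: measurable_funM => //; exact: measurable_funX.
have c0 : (0 <= 8 / 3 * s ^+ 2)%R by rewrite mulr_ge0 // ltW.
rewrite (ge0_integral_scale _ c0 me); last by move=> x; rewrite lee_fin expR_ge0.
by rewrite normal_expR_sqr // ltry.
Qed.

(* Jensen's bound [1 + a x^2 <= exp (a x^2)] integrates to
   [m (v + 1) <= 2 v^2] for v > 1 and to the converse for v < 1; let v -> 1. *)
Lemma normal_sqr (s : R) : (0 < s)%R ->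
  \int[normal_prob 0 s]_x (x ^+ 2)%:E = (s ^+ 2)%:E.
Proof.
move=> s0.
have s2 : (0 < s ^+ 2)%R by rewrite exprn_gt0.
have int2 := normal_sqr_integrable s0.
have fin2 := integrable_fin_num measurableT int2.
set I := \int[_]_x _ in fin2 *.
pose m := (fine I / s ^+ 2)%R.
have IE : I = (m * s ^+ 2)%:E by rewrite /m divfK ?gt_eqF // fineK.
suff m1 : m = 1%R by rewrite IE m1 mul1r.
have key v : (0 < v)%R -> ((1 - v ^- 2) / 2 * m <= v - 1)%R.
  move=> v0; pose a : R := ((1 - v ^- 2) / 2)%R.
  have inta : (normal_prob 0 s).-integrable setT (fun x => (1 + a * (x ^+ 2 / s ^+ 2))%:E).
    under eq_fun do rewrite EFinD.
    apply: integrableD => //; first exact: finite_measure_integrable_cst.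
    under eq_fun do rewrite mulrCA EFinM muleC.
    exact: integrableZl.
  have : \int[normal_prob 0 s]_x (1 + a * (x ^+ 2 / s ^+ 2))%:E <= v%:E.
    rewrite -(normal_expR_sqr s0 v0); apply: le_integral => //.
      apply/integrableP; split.
        apply/measurable_EFinP/measurableT_comp => //; apply: measurable_funM => //.
        by apply: measurable_funM => //; exact: measurable_funX.
      under eq_integral do rewrite gee0_abs ?lee_fin ?expR_ge0//.
      by rewrite normal_expR_sqr // ltry.
    by move=> x _; rewrite lee_fin; exact: expR_ge1Dx.
  under eq_integral do rewrite EFinD.
  rewrite integralD //; last 2 first.
  - exact: finite_measure_integrable_cst.
  - under eq_fun do rewrite mulrCA EFinM muleC; exact: integrableZl.
  have N1 : normal_prob 0 s setT = 1 by rewrite /normal_prob integral_normal_pdf.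
  rewrite integral_cst // [X in (1%:E * X)%E]N1 mule1.
  under eq_integral do rewrite mulrCA EFinM muleC.
  rewrite integralZl // -/I IE -EFinM -EFinD lee_fin.
  have -> : (a / s ^+ 2 * (m * s ^+ 2) = a * m)%R by field; rewrite gt_eqF.
  by rewrite -/a; lra.
have m0 : (0 <= m)%R.
  by rewrite /m divr_ge0 ?sqr_ge0 // fine_ge0 // integral_ge0 // => x _; rewrite lee_fin sqr_ge0.
clearbody m.
have up (e : R) : (0 < e)%R -> (m <= (1 + e) ^+ 2)%R.
  move=> e0; have v0 : (0 < 1 + e)%R by lra.
  have := key _ v0.
  have -> : ((1 - (1 + e) ^- 2) / 2 * m = e * ((m * (2 + e)) / (2 * (1 + e) ^+ 2)))%R.
    by field; rewrite gt_eqF.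
  rewrite [X in (_ <= X)%R](_ : _ = e * 1)%R; last by ring.
  rewrite ler_pM2l // ler_pdivrMr ?mul1r; last by rewrite mulr_gt0 // exprn_gt0.
  have := mulr_ge0 m0 (ltW e0); rewrite mulrDr.
  by move: (m * e)%R ((1 + e) ^+ 2)%R => u w; lra.
have lo (e : R) : (0 < e < 1)%R -> ((1 - e) ^+ 2 <= m)%R.
  move=> /andP[e0 e1]; have v0 : (0 < 1 - e)%R by lra.
  have := key _ v0.
  have -> : ((1 - (1 - e) ^- 2) / 2 * m = - (e * ((m * (2 - e)) / (2 * (1 - e) ^+ 2))))%R.
    by field; rewrite gt_eqF.
  rewrite [X in (_ <= X)%R](_ : _ = - (e * 1))%R; last by ring.
  rewrite lerN2 ler_pM2l // ler_pdivlMr ?mul1r; last by rewrite mulr_gt0 // exprn_gt0.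
  have := mulr_ge0 m0 (ltW e0); rewrite mulrBr.
  by move: (m * e)%R ((1 - e) ^+ 2)%R => u w; lra.
apply/eqP; rewrite eq_le; apply/andP; split.
  suff H (e : R) : (0 < e)%R -> (m <= 1 + e)%R by apply/ler_addgt0Pr.
  move=> e0; have d0 : (0 < Num.min 1 (e / 3))%R by rewrite lt_min ltr01 divr_gt0.
  have h1 : (Num.min 1 (e / 3) <= 1)%R by rewrite ge_min lexx.
  have h2 : (Num.min 1 (e / 3) <= e / 3)%R by rewrite ge_min lexx orbT.
  move: (Num.min _ _)%R d0 h1 h2 => w d0 h1 h2.
  by apply: le_trans (up _ d0) _; nra.
suff H (e : R) : (0 < e)%R -> (1 <= m + e)%R by apply/ler_addgt0Pr.
move=> e0; have d0 : (0 < Num.min 2^-1 (e / 2))%R by rewrite lt_min invr_gt0 ltr0n divr_gt0.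
have h1 : (Num.min 2^-1 (e / 2) <= 2^-1)%R by rewrite ge_min lexx.
have h2 : (Num.min 2^-1 (e / 2) <= e / 2)%R by rewrite ge_min lexx orbT.
move: (Num.min _ _)%R d0 h1 h2 => w d0 h1 h2.
have w01 : (0 < w < 1)%R by apply/andP; split; lra.
by have := lo _ w01; nra.
Qed.

Context d (Om : measurableType d) (P : probability Om R) (X : Om -> R) (s : R).
Hypothesis mX : measurable_fun setT X.
Hypothesis XN : forall S : set R, measurable S -> P (X @^-1` S) = normal_prob 0 s S.

Lemma ge0_integral_normal_rv (f : R -> \bar R) : measurable_fun setT f ->
  (forall x, 0 <= f x) ->
  \int[P]_w f (X w) = \int[normal_prob 0 s]_x f x.
Proof.
move=> mf f0.
pose X' : Om -> measurableTypeR R := X.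
have mX' : measurable_fun setT X' by exact: mX.
transitivity (\int[pushforward P X']_x f x).
  by rewrite ge0_integral_pushforward // preimage_setT.
by apply: eq_measure_integral => A mA _; exact: XN.
Qed.

End normal_moments.

(** * Decoupling of independent sigma-algebras *)

Section decoupling.
Context d (Om : measurableType d) (R : realType) (P : probability Om R).
Variables (G1 : set (set Om)) (n : nat) (be : 'I_n -> Om -> R).
Hypotheses (sG1 : sigma_algebra setT G1) (G1m : G1 `<=` measurable).
Hypothesis mbe : forall i, measurable_fun setT (be i).
Local Open Scope ereal_scope.

(** The events for which [wiener_increments] gives independence. They are closed under intersection
    and generate the sigma-algebra of the increments, as a pi-lambda argument requires. *)
Definition rectangles : set (set Om) :=
  [set B | exists2 S : 'I_n -> set R, forall i, measurable (S i) &
     B = [set w | forall i, S i (be i w)]].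

Hypothesis ind : forall A B, G1 A -> rectangles B -> P (A `&` B) = P A * P B.

Let T1 : measurableType _ := g_sigma_algebraType G1.
Let T2 : measurableType _ := g_sigma_algebraType rectangles.

Lemma rectangles_measurable B : rectangles B -> measurable B.
Proof.
move=> [S mS ->].
have -> : [set w | forall i, S i (be i w)] = \bigcap_(i in setT) (be i @^-1` S i).
  by apply/seteqP; split => w /= h i; [move=> _; exact: h|exact: h].
apply: fin_bigcap_measurable => // i _; rewrite -[X in measurable X]setTI.
exact: mbe.
Qed.

Lemma rectangles_setI : setI_closed rectangles.
Proof.
move=> _ _ [S mS ->] [S' mS' ->]; exists (fun i => S i `&` S' i).
  by move=> i; exact: measurableI.
apply/seteqP; split => w /=; first by move=> [h h'] i; split.
by move=> h; split => i; have [] := h i.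
Qed.

Lemma g_rectangles_measurable B : <<s rectangles >> B -> measurable B.
Proof.
apply: smallest_sub; last exact: rectangles_measurable.
exact: sigma_algebra_measurable.
Qed.

(** For fixed A, the finite measures [P (B & A)] and [P A * P B] in B agree on a generating
    pi-system, hence on the sigma-algebra it generates. *)
Lemma independent_g_rectangles A B : G1 A -> <<s rectangles >> B ->
  P (A `&` B) = P A * P B.
Proof.
move=> GA GB; have mA := G1m GA.
have PA : P A \is a fin_num by exact: fin_num_measure.
pose c : {nonneg R} := NngNum (fine_ge0 (measure_ge0 P A)).
pose m2 := mscale c P.
have cE : c%:num%:E = P A by rewrite /c /= fineK.
rewrite setIC; transitivity (m2 B); last by rewrite /m2 /mscale cE.
apply: (@g_sigma_algebra_measure_unique _ _ _ rectangles _ (fun=> setT) _ _ (mrestr P mA) m2) => //.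
- exact: rectangles_measurable.
- by move=> k; exists (fun=> setT) => //; apply/seteqP.
- by rewrite bigcup_const //; exists 0%N.
- exact: rectangles_setI.
- by move=> C rC; change (P (C `&` A) = c%:num%:E * P C); rewrite cE setIC; exact: ind.
- by move=> k; change (P (setT `&` A) < +oo); rewrite setTI ltey_eq PA.
Qed.

(** The identity onto the same set with a coarser sigma-algebra: its image measure is the
    restriction of P. *)
Let id1 : Om -> T1 := id.
Let id2 : Om -> T2 := id.

Let mid1 : measurable_fun setT id1.
Proof.
move=> _ A mA; rewrite setTI; apply: G1m.
by move: mA; rewrite /T1 measurable_g_measurableTypeE.
Qed.

Let mid2 : measurable_fun setT id2.
Proof. by move=> _ A mA; rewrite setTI; apply: g_rectangles_measurable. Qed.

HB.instance Definition _ := isMeasurableFun.Build _ _ _ _ id1 mid1.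
HB.instance Definition _ := isMeasurableFun.Build _ _ _ _ id2 mid2.

Let idp : Om -> T1 * T2 := fun w => (id1 w, id2 w).
Let midp : measurable_fun setT idp.
Proof. exact: measurable_fun_pair. Qed.
HB.instance Definition _ := isMeasurableFun.Build _ _ _ _ idp midp.

(* Under [w |-> (w, w)] into the product of the two sub-sigma-algebras, [P] is
   mapped to the product of its restrictions. *)
Lemma decouple (f : Om -> Om -> \bar R) :
  measurable_fun setT (fun z : T1 * T2 => f z.1 z.2) ->
  (forall w w', 0 <= f w w') ->
  \int[P]_w f w w = \int[P]_w \int[P]_w' f w w'.
Proof.
move=> mf f0.
pose g (z : T1 * T2) := f z.1 z.2.
have g0 z : 0 <= g z by exact: f0.
rewrite -[LHS](ge0_integral_distribution idp (f := g) mf g0).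
have -> : \int[distribution P idp]_z g z =
    \int[distribution P id1 \x distribution P id2]_z g z.
  apply: eq_measure_integral => A mA _; apply/esym/product_measure_unique => // A' B mA' mB.
  apply: independent_g_rectangles => //.
  by move: mA'; rewrite /T1 measurable_g_measurableTypeE.
rewrite fubini_tonelli1 //.
rewrite ge0_integral_distribution; last 2 first.
- exact: measurable_fun_fubini_tonelli_F.
- by move=> w; apply: integral_ge0.
apply: eq_integral => w _ /=; rewrite /fubini_F ge0_integral_distribution //=.
by apply: (measurableT_comp mf); exact: measurable_pair1.
Qed.

(** Takes the place of a bound on a conditional expectation: the first argument is frozen, the
    second integrated. *)
Lemma decouple_le (f : Om -> Om -> \bar R) (g : Om -> \bar R) :
  measurable_fun setT (fun z : T1 * T2 => f z.1 z.2) ->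
  (forall w w', 0 <= f w w') -> measurable_fun setT g ->
  (forall w, \int[P]_w' f w w' <= g w) ->
  \int[P]_w f w w <= \int[P]_w g w.
Proof.
move=> mf f0 mg fg; rewrite decouple //; apply: ge0_le_integral => //.
- by move=> w _; exact: integral_ge0.
pose h (z : T1 * T2) := f z.1 z.2.
have h0 z : 0 <= h z by exact: f0.
have -> : (fun w => \int[P]_w' f w w') = fubini_F (distribution P id2) h \o id1.
  apply/funext => w /=; rewrite /fubini_F ge0_integral_distribution //=.
  by apply: (measurableT_comp mf); exact: measurable_pair1.
apply: measurableT_comp; last exact: mid1.
exact: measurable_fun_fubini_tonelli_F.
Qed.

Lemma measurable_right i : measurable_fun setT (fun z : T1 * T2 => be i z.2).
Proof.
apply: (measurableT_comp (f := be i : T2 -> R)); last exact: measurable_snd.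
move=> _ S mS; rewrite setTI; apply: sub_sigma_algebra.
exists (fun j => if j == i then S else setT); first by move=> j; case: ifP.
apply/seteqP; split => w /=.
  by move=> Sw j; case: eqP => [->|].
by move=> /(_ i); rewrite eqxx.
Qed.

End decoupling.

Section integral_seq.
Context d (Om : measurableType d) (R : realType) (mu : {measure set Om -> \bar R}).
Local Open Scope ereal_scope.

Lemma integral_sum_seq (S : eqType) (r : seq S) (f : S -> Om -> R) :
  (forall i, i \in r -> mu.-integrable setT (fun w => (f i w)%:E)) ->
  mu.-integrable setT (fun w => (\sum_(i <- r) f i w)%:E) /\
  \int[mu]_w (\sum_(i <- r) f i w)%:E = \sum_(i <- r) \int[mu]_w (f i w)%:E.
Proof.
elim: r => [|i r IH] fr.
  under eq_fun do rewrite big_nil; split; first exact: integrable0.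
  by rewrite integral0 big_nil.
have [|I1 E1] := IH; first by move=> j jr; apply: fr; rewrite inE jr orbT.
have Ii := fr i (mem_head _ _).
split; first by under eq_fun do rewrite big_cons EFinD; exact: integrableD.
under eq_integral do rewrite big_cons EFinD.
by rewrite integralD // E1 big_cons.
Qed.

End integral_seq.

Section measurable_exponentials.
Context (R : realType).

Lemma measurable_exp_affine (p k : R) :
  measurable_fun setT (fun x : measurableTypeR R => (expR (p * x - k))%:E).
Proof.
apply/measurable_EFinP; apply: measurableT_comp => //.
by apply: measurable_funB; [exact: measurable_funM|].
Qed.

Lemma measurable_exp_sqr (k : R) :
  measurable_fun setT (fun x : measurableTypeR R => (expR (x ^+ 2 * k))%:E).
Proof.
apply/measurable_EFinP; apply: measurableT_comp => //.
by apply: measurable_funM; [exact: measurable_funX|].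
Qed.

End measurable_exponentials.

Lemma measurable_sum_seq d (Om : measurableType d) (R : realType) (S : eqType) (r : seq S)
    (f : S -> Om -> R) :
  (forall i, i \in r -> measurable_fun setT (f i)) ->
  measurable_fun setT (fun w => \sum_(i <- r) f i w).
Proof.
elim: r => [|i r IH] mf.
  by under eq_fun do rewrite big_nil; exact: measurable_cst.
under eq_fun do rewrite big_cons.
apply: measurable_funD; first exact/mf/mem_head.
by apply: IH => j jr; apply: mf; rewrite inE jr orbT.
Qed.

Section filtration_measurable.
Context d (Om : measurableType d) (R : realType) (T : R) (FF : R -> set (set Om)).
Hypothesis filtrFF : filtration T FF.

Lemma measurable_filtration s (g : Om -> R) : 0 <= s <= T ->
  measurable_fun [set: g_sigma_algebraType (FF s)] g -> measurable_fun [set: Om] g.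
Proof.
move=> sT mg _ S mS; have [sF Fm] := filtrFF.1 _ sT.
have := mg measurableT _ mS; rewrite !setTI => h; apply: Fm.
by move: h; rewrite measurable_g_measurableTypeE.
Qed.

Lemma measurable_filtrationS s t (g : Om -> R) : 0 <= s -> s <= t -> t <= T ->
  measurable_fun [set: g_sigma_algebraType (FF s)] g ->
  measurable_fun [set: g_sigma_algebraType (FF t)] g.
Proof.
move=> s0 st tT mg _ S mS.
have sT : 0 <= s <= T by rewrite s0 (le_trans st).
have t0 : 0 <= t <= T by rewrite (le_trans s0).
have := mg measurableT _ mS; rewrite !setTI.
rewrite (measurable_g_measurableTypeE (filtrFF.1 _ sT).1).
rewrite (measurable_g_measurableTypeE (filtrFF.1 _ t0).1).
exact: filtrFF.2.
Qed.

End filtration_measurable.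

(** * Moments of Wiener increments *)

Section gaussian_increments.
Context d (Om : measurableType d) (R : realType) (P : probability Om R).
Context (T : R) (FF : R -> set (set Om)) (U : completeNormedModType R).
Context (ipU : {dot U for idfun}) (W : R -> U -> Om -> R).
Hypotheses (hU : hilbert_norm ipU).
Hypotheses (filtrFF : filtration T FF) (wienerW : cylindrical_wiener P T FF ipU W).
Variables (s t : R).
Hypotheses (s0 : 0 <= s) (st : s < t) (tT : t <= T).

Definition incr (u : U) (w : Om) : R := W t u w - W s u w.

Let t0 : 0 <= t. Proof. exact: le_trans (ltW st). Qed.
Let sT : s <= T. Proof. exact: le_trans (ltW st) tT. Qed.
Let s_in : 0 <= s <= T. Proof. by rewrite s0. Qed.
Let t_in : 0 <= t <= T. Proof. by rewrite t0. Qed.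

Lemma filtration_setT r : 0 <= r <= T -> FF r setT.
Proof.
move=> rT; have [[h0 hD _] _] := filtrFF.1 _ rT.
by have := hD _ h0; rewrite setD0.
Qed.

Lemma measurable_wiener r u : 0 <= r <= T -> measurable_fun setT (W r u).
Proof.
move=> rT _ S mS; rewrite setTI; apply: (filtrFF.1 _ rT).2.
exact: (wiener_adapted wienerW).
Qed.

Lemma measurable_incr u : measurable_fun setT (incr u).
Proof. by apply: measurable_funB; exact: measurable_wiener. Qed.

Lemma incr_normal v (S : set R) : ipU v v = 1 -> measurable S ->
  P (incr v @^-1` S) = normal_prob 0 (Num.sqrt (t - s)) S.
Proof.
move=> v1 mS.
have := wiener_increments wienerW (u := fun _ : 'I_1 => v) (A := setT) (S := fun _ => S) s0 st tT.
rewrite setTI probability_setT mul1e big_ord1 => <- //.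
- by congr (P _); apply/seteqP; split => w /= h; [move=> _|exact: (h ord0)].
- by move=> i j; rewrite !ord1 eqxx.
- exact: filtration_setT.
Qed.

Lemma incr_comb (r : seq U) (a : U -> R) :
  {ae P, forall w, incr (\sum_(j <- r) a j *: j) w = \sum_(j <- r) a j * incr j w}.
Proof.
have lin q : 0 <= q <= T ->
    {ae P, forall w, W q (\sum_(j <- r) a j *: j) w = \sum_(j <- r) a j * W q j w}.
  move=> qT; elim: r => [|j r IH].
    apply: filterS (wiener_linear wienerW 1 0 0 qT) => w.
    by rewrite !big_nil scale1r addr0 mul1r => h; apply: (@addrI _ (W q 0 w)); rewrite addr0 -h.
  apply: filterS2 IH (wiener_linear wienerW (a j) j (\sum_(j <- r) a j *: j) qT) => w IH.
  by rewrite !big_cons IH.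
apply: filterS2 (lin _ s_in) (lin _ t_in) => w hs ht.
by rewrite /incr hs ht -sumrB; apply: eq_bigr => j _; rewrite mulrBr.
Qed.

Variable sJ : seq U.
Hypotheses (uJ : uniq sJ) (oJ : forall x y, x \in sJ -> y \in sJ -> ipU x y = (x == y)%:R).
Local Open Scope ereal_scope.
Let nu := normal_prob (0 : R) (Num.sqrt (t - s)).
Let Dl0 : (0 < t - s)%R. Proof. by rewrite subr_gt0. Qed.
Let sq0 : (0 < Num.sqrt (t - s))%R. Proof. by rewrite sqrtr_gt0. Qed.
Let sqE : (Num.sqrt (t - s) ^+ 2 = t - s)%R. Proof. by rewrite sqr_sqrtr // ltW. Qed.

Lemma measurable_incr_comb (a : U -> R) :
  measurable_fun setT (fun w => \sum_(j <- sJ) a j * incr j w)%R.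
Proof.
apply: measurable_sum => j; apply: measurable_funM => //; exact: measurable_incr.
Qed.

(** Up to a null set the combination is [sg] times the increment along a unit vector, whose law is
    known. Coefficients that all vanish cannot be normalised and are treated apart. *)
Lemma integral_incr_comb (a : U -> R) (g : measurableTypeR R -> \bar R) :
  measurable_fun setT g -> (forall x, 0 <= g x) ->
  \int[P]_w g (\sum_(j <- sJ) a j * incr j w)%R =
  \int[nu]_x g (Num.sqrt (\sum_(j <- sJ) a j ^+ 2) * x)%R.
Proof.
move=> mg g0; set v := (\sum_(j <- sJ) a j ^+ 2)%R.
have v_ge0 : (0 <= v)%R by apply: sumr_ge0 => j _; exact: sqr_ge0.
have [v0|v0] := eqVneq v 0%R.
  have aj j : j \in sJ -> a j = 0%R.
    move=> js; apply/eqP; rewrite -sqrf_eq0 eq_le sqr_ge0 andbT -v0 /v (bigD1_seq j) //= lerDl.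
    by apply: sumr_ge0 => i _; exact: sqr_ge0.
  have -> : (fun w => g (\sum_(j <- sJ) a j * incr j w)%R) = cst (g 0%R).
    by apply/funext => w /=; rewrite big1_seq // => j /andP[_ /aj ->]; rewrite mul0r.
  rewrite v0 sqrtr0; under [RHS]eq_integral do rewrite mul0r.
  have N1 : nu setT = 1 by rewrite /nu /normal_prob integral_normal_pdf.
  have P1 := probability_setT P.
  transitivity (g 0%R); first by rewrite integral_cst // [X in _ * X]P1 mule1.
  by rewrite integral_cst // [X in _ * X]N1 mule1.
pose sg := Num.sqrt v.
have sg0 : (0 < sg)%R by rewrite sqrtr_gt0 lt_neqAle eq_sym v0.
have sgE : (sg ^+ 2 = v)%R by rewrite sqr_sqrtr.
pose e := (\sum_(j <- sJ) (a j / sg) *: j)%R.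
have e1 : ipU e e = 1%R.
  rewrite hU (norm_comb hU uJ oJ).
  under eq_bigr do rewrite expr_div_n.
  by rewrite -mulr_suml sgE divff.
have mgs : measurable_fun setT (fun x : measurableTypeR R => g (sg * x)%R).
  by apply: (measurableT_comp mg); exact: measurable_funM.
have <- := ge0_integral_normal_rv (measurable_incr e) (fun S => incr_normal e1) mgs (fun x => g0 _).
apply: ae_eq_integral => //.
- by apply: (measurableT_comp (f := g) (T2 := measurableTypeR R)) => //; exact: measurable_incr_comb.
- apply: (measurableT_comp (f := fun x : measurableTypeR R => g (sg * x)%R)) => //.
  exact: measurable_incr.
- apply: filterS (incr_comb sJ (fun j => a j / sg)%R) => w h _; rewrite h mulr_sumr.
  congr (g _); apply: eq_bigr => j _; rewrite mulrA; congr (_ * _)%R.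
  by rewrite mulrC divfK // gt_eqF.
Qed.

(** The Gaussian moment is [e^(p^2 (t - s) v / 2)], while the compensator carries p; the difference
    of exponents has the sign of [p (1 - p)]. *)
Lemma expectation_exp_lin (p : R) (a : U -> R) : (0 <= p <= 1)%R ->
  \int[P]_w (expR (p * (\sum_(j <- sJ) a j * incr j w) -
     p * (t - s) / 2 * \sum_(j <- sJ) a j ^+ 2))%:E <= 1.
Proof.
move=> /andP[p0 p1]; set v := (\sum_(j <- sJ) a j ^+ 2)%R.
have v_ge0 : (0 <= v)%R by apply: sumr_ge0 => j _; exact: sqr_ge0.
pose k := (p * (t - s) / 2 * v)%R.
pose g := fun x : measurableTypeR R => (expR (p * x - k))%:E.
have mg : measurable_fun setT g.
  exact: measurable_exp_affine.
have g0 x : 0 <= g x by rewrite lee_fin expR_ge0.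
rewrite -/k (integral_incr_comb a mg g0) -/v.
have me : measurable_fun setT (fun x : measurableTypeR R => (expR (p * Num.sqrt v * x))%:E).
  by apply/measurable_EFinP; apply: measurableT_comp => //; exact: measurable_funM.
under eq_integral do rewrite /g mulrA addrC expRD EFinM.
rewrite (ge0_integral_scale _ (expR_ge0 _) me); last by move=> x; rewrite lee_fin expR_ge0.
rewrite normal_expR ?gt_eqF // -EFinM lee_fin -expRD -[leRHS]expR0 ler_expR /k exprMn sqr_sqrtr // sqE.
rewrite -subr_ge0 (_ : _ - _ = p * (1 - p) * ((t - s) / 2 * v))%R; last by field.
by rewrite !mulr_ge0 ?subr_ge0 ?(ltW st).
Qed.

Lemma expectation_sqr_comb (a : U -> R) :
  \int[P]_w ((\sum_(j <- sJ) a j * incr j w) ^+ 2)%:E = ((t - s) * \sum_(j <- sJ) a j ^+ 2)%:E.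
Proof.
set v := (\sum_(j <- sJ) a j ^+ 2)%R.
have v_ge0 : (0 <= v)%R by apply: sumr_ge0 => j _; exact: sqr_ge0.
pose g := fun x : measurableTypeR R => (x ^+ 2)%:E.
have mg : measurable_fun setT g by apply/measurable_EFinP; exact: measurable_funX.
have g0 x : 0 <= g x by rewrite lee_fin sqr_ge0.
rewrite (integral_incr_comb a mg g0) -/v.
under eq_integral do rewrite /g exprMn sqr_sqrtr // EFinM.
by rewrite (ge0_integral_scale _ v_ge0 mg g0) normal_sqr // sqE -EFinM mulrC.
Qed.

Let sqr_comb_integrable (a : U -> R) :
  P.-integrable setT (fun w => ((\sum_(j <- sJ) a j * incr j w) ^+ 2)%:E).
Proof.
apply/integrableP; split.
  by apply/measurable_EFinP/measurable_funX; exact: measurable_incr_comb.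
under eq_integral do rewrite gee0_abs ?lee_fin ?sqr_ge0//.
by rewrite expectation_sqr_comb ltry.
Qed.

(** Coefficients of [x + e y], also when [x = y]. With [e = 1] and [e = -1] the second moments give
    the mixed ones by polarisation. *)
Let pick (x y j : U) e : R := ((j == x)%:R + e * (j == y)%:R)%R.

Let pick_comb x y e w : x \in sJ -> y \in sJ ->
  (\sum_(j <- sJ) pick x y j e * incr j w = incr x w + e * incr y w)%R.
Proof.
move=> xs ys; rewrite /pick; under eq_bigr do rewrite mulrDl -mulrA.
rewrite big_split /= -mulr_sumr; congr (_ + _ * _)%R.
  by rewrite (bigD1_seq x) //= eqxx mul1r big1 ?addr0 // => j /negbTE ->; rewrite mul0r.
by rewrite (bigD1_seq y) //= eqxx mul1r big1 ?addr0 // => j /negbTE ->; rewrite mul0r.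
Qed.

Let pick_sqr x y e : x \in sJ -> y \in sJ ->
  (\sum_(j <- sJ) pick x y j e ^+ 2 = 1 + 2 * e * (x == y)%:R + e ^+ 2)%R.
Proof.
move=> xs ys.
have -> : (\sum_(j <- sJ) pick x y j e ^+ 2 = \sum_(j <- sJ)
   ((j == x)%:R + 2 * e * (x == y)%:R * (j == x)%:R + e ^+ 2 * (j == y)%:R))%R.
  apply: eq_bigr => j _; rewrite /pick.
  have [->|jx] := eqVneq j x; last by case: (j == y) => /=; ring.
  by case: (x == y) => /=; ring.
have S1 z : z \in sJ -> (\sum_(j <- sJ) (j == z)%:R = 1 :> R)%R.
  by move=> zs; rewrite (bigD1_seq z) //= eqxx big1 ?addr0 // => j /negbTE ->.
by rewrite !big_split /= -!mulr_sumr !S1 // !mulr1.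
Qed.

Let polar x y w : x \in sJ -> y \in sJ -> (incr x w * incr y w)%:E =
  4^-1%:E * ((\sum_(j <- sJ) pick x y j 1 * incr j w) ^+ 2)%:E -
  4^-1%:E * ((\sum_(j <- sJ) pick x y j (-1) * incr j w) ^+ 2)%:E.
Proof.
move=> xs ys; rewrite !pick_comb // -!EFinM -EFinB; congr (_%:E).
by move: (incr x w) (incr y w) => *; field.
Qed.

Lemma incr_prod_integrable x y : x \in sJ -> y \in sJ ->
  P.-integrable setT (fun w => (incr x w * incr y w)%:E).
Proof.
move=> xs ys; apply: (eq_integrable _ (fun w =>
  4^-1%:E * ((\sum_(j <- sJ) pick x y j 1 * incr j w) ^+ 2)%:E -
  4^-1%:E * ((\sum_(j <- sJ) pick x y j (-1) * incr j w) ^+ 2)%:E)) => //.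
  by move=> w _; rewrite polar.
by apply: integrableB => //; apply: integrableZl.
Qed.

Lemma expectation_incr_prod x y : x \in sJ -> y \in sJ ->
  \int[P]_w (incr x w * incr y w)%:E = ((t - s) * (x == y)%:R)%:E.
Proof.
move=> xs ys; under eq_integral do rewrite polar //.
rewrite integralB //; try by apply: integrableZl.
rewrite !integralZl // !expectation_sqr_comb !pick_sqr // -!EFinM -EFinB; congr (_%:E).
by move: (x == y)%:R (t - s)%R => *; field.
Qed.

Let prod_integrable (m : U -> U -> R) i j : i \in sJ -> j \in sJ ->
  P.-integrable setT (fun w => (incr i w * incr j w * m i j)%:E).
Proof.
move=> iJ jJ; under eq_fun do rewrite EFinM muleC.
by apply: integrableZl => //; exact: incr_prod_integrable.
Qed.

Let quad_incr (m : U -> U -> R) :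
  P.-integrable setT (fun w => (\sum_(i <- sJ) \sum_(j <- sJ) incr i w * incr j w * m i j)%:E) /\
  \int[P]_w (\sum_(i <- sJ) \sum_(j <- sJ) incr i w * incr j w * m i j)%:E =
  ((t - s) * \sum_(j <- sJ) m j j)%:E.
Proof.
have row i : i \in sJ ->
    P.-integrable setT (fun w => (\sum_(j <- sJ) incr i w * incr j w * m i j)%:E) /\
    \int[P]_w (\sum_(j <- sJ) incr i w * incr j w * m i j)%:E = ((t - s) * m i i)%:E.
  move=> iJ; have [I1 E1] := integral_sum_seq (fun j jJ => prod_integrable m iJ jJ).
  split => //; rewrite E1 (bigD1_seq i) //=.
  under eq_bigr do under eq_integral do rewrite EFinM muleC.
  under eq_integral do rewrite EFinM muleC.
  rewrite integralZl ?expectation_incr_prod //; last exact: incr_prod_integrable.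
  rewrite eqxx mulr1 big1_seq ?addr0 ?adde0 -?EFinM 1?mulrC //.
  move=> j /andP[ji jJ]; rewrite integralZl ?expectation_incr_prod //; last exact: incr_prod_integrable.
  by rewrite eq_sym (negbTE ji) mulr0 mule0.
have [I1 E1] := integral_sum_seq (fun i iJ => (row i iJ).1).
split => //; rewrite E1 mulr_sumr -sumEFin; apply: eq_big_seq => i iJ; exact: (row i iJ).2.
Qed.

Lemma quad_incr_integrable (m : U -> U -> R) :
  P.-integrable setT (fun w => (\sum_(i <- sJ) \sum_(j <- sJ) incr i w * incr j w * m i j)%:E).
Proof. exact: (quad_incr m).1. Qed.

Lemma expectation_quad_incr (m : U -> U -> R) :
  \int[P]_w (\sum_(i <- sJ) \sum_(j <- sJ) incr i w * incr j w * m i j)%:E =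
  ((t - s) * \sum_(j <- sJ) m j j)%:E.
Proof. exact: (quad_incr m).2. Qed.

(** Jensen for weights of total mass at most 1, the missing mass being placed at 0; the tangent of
    the exponential at the mean m is summed over all the points. *)
Lemma expR_convex (S : Type) (r : seq S) (a x : S -> R) : (forall i, 0 <= a i)%R ->
  (\sum_(i <- r) a i <= 1)%R ->
  (expR (\sum_(i <- r) a i * x i) <= 1 + \sum_(i <- r) a i * (expR (x i) - 1))%R.
Proof.
move=> a0 a1; set m := (\sum_(i <- r) a i * x i)%R; set A := (\sum_(i <- r) a i)%R in a1.
have tang y : (expR m * (1 + y - m) <= expR y)%R.
  have -> : (expR y = expR m * expR (y - m))%R by rewrite -expRD addrC subrK.
  by rewrite ler_wpM2l ?expR_ge0 // -addrA expR_ge1Dx.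
have h : (\sum_(i <- r) a i * (expR m * (1 + x i - m)) <= \sum_(i <- r) a i * expR (x i))%R.
  by apply: ler_sum => i _; apply: ler_wpM2l.
have := ler_wpM2l (_ : 0 <= 1 - A)%R (tang 0%R); rewrite subr_ge0 => /(_ a1).
rewrite expR0 mulr1 addr0 => h0.
under [in leRHS]eq_bigr do rewrite mulrBr mulr1.
rewrite sumrB -/A; apply: (@le_trans _ _ (\sum_(i <- r) a i * (expR m * (1 + x i - m)) +
    (1 - A) * (expR m * (1 - m)))%R); last by move: (\sum_(i <- r) a i * expR _)%R h h0 => *; lra.
have -> : (\sum_(i <- r) a i * (expR m * (1 + x i - m)) = expR m * (A * (1 - m) + m))%R.
  rewrite /A /m mulr_suml -big_split /= mulr_sumr; apply: eq_bigr => i _; ring.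
rewrite le_eqVlt; apply/orP; left; apply/eqP; ring.
Qed.

(* Jensen over the coordinates [h] with weights [v h / M^2]: each normalised
   square has exponential moment [sqrt 2] at [1/4]. *)
Lemma expectation_exp_norm (S : eqType) (sI : seq S) (be : S -> U -> R) (M Dl : R) :
  (0 < M)%R -> (t - s <= Dl)%R ->
  (\sum_(h <- sI) \sum_(j <- sJ) be h j ^+ 2 <= M ^+ 2)%R ->
  \int[P]_w (expR ((\sum_(h <- sI) (\sum_(j <- sJ) be h j * incr j w) ^+ 2) /
                   (4 * (M * Num.sqrt Dl) ^+ 2)))%:E <= 2%:E.
Proof.
move=> M0 tsD beM.
have D0 : (0 < Dl)%R by exact: lt_le_trans tsD.
pose v h := (\sum_(j <- sJ) be h j ^+ 2)%R.
have v0 h : (0 <= v h)%R by apply: sumr_ge0 => j _; exact: sqr_ge0.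
pose z h w := (\sum_(j <- sJ) be h j * incr j w)%R.
pose a h := (v h / M ^+ 2)%R.
pose x h w := (z h w ^+ 2 / (4 * v h * Dl))%R.
have a0 h : (0 <= a h)%R by rewrite divr_ge0 // sqr_ge0.
have M2 : (0 < M ^+ 2)%R by rewrite exprn_gt0.
have a1 : (\sum_(h <- sI) a h <= 1)%R.
  by rewrite -mulr_suml ler_pdivrMr // mul1r.
(* If [v h = 0], the quotient [x h w] is 0 by convention and the coordinate [z h w] vanishes, so the
   identity persists. *)
have xE h w : (z h w ^+ 2 / (4 * (M * Num.sqrt Dl) ^+ 2) = a h * x h w)%R.
  rewrite exprMn sqr_sqrtr ?(ltW D0) // /a /x.
  have [vh0|vh0] := eqVneq (v h) 0%R; last by field; rewrite vh0 !gt_eqF.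
  have bj j : j \in sJ -> be h j = 0%R.
    move=> js; apply/eqP; rewrite -sqrf_eq0 eq_le sqr_ge0 andbT -vh0 /v (bigD1_seq j) //= lerDl.
    by apply: sumr_ge0 => i _; exact: sqr_ge0.
  have -> : z h w = 0%R by rewrite /z big1_seq // => j /andP[_ /bj ->]; rewrite mul0r.
  by rewrite vh0 expr0n /= !mul0r.
have mx h : measurable_fun setT (fun w => (expR (x h w))%:E).
  apply/measurable_EFinP; apply: measurableT_comp => //; apply: measurable_funM => //.
  by apply: measurable_funX; exact: measurable_incr_comb.
have Ex h : \int[P]_w (expR (x h w))%:E <= 2%:E.
  pose k := (4 * v h * Dl)^-1%R.
  have k0 : (0 <= k)%R by rewrite invr_ge0 !mulr_ge0 // ltW.
  pose g := fun y : measurableTypeR R => (expR (y ^+ 2 * k))%:E.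
  have mg : measurable_fun setT g.
    exact: measurable_exp_sqr.
  have g0 y : 0 <= g y by rewrite lee_fin expR_ge0.
  have -> : \int[P]_w (expR (x h w))%:E = \int[P]_w g (\sum_(j <- sJ) be h j * incr j w)%R by [].
  rewrite (integral_incr_comb (be h) mg g0) -/(v h).
  have s2 : (0 < Num.sqrt 2 :> R)%R by rewrite sqrtr_gt0.
  apply: (@le_trans _ _ (Num.sqrt 2)%:E); last first.
    rewrite lee_fin -(@ler_pXn2r _ 2) ?nnegrE ?sqrtr_ge0 //.
    by rewrite sqr_sqrtr // expr2; lra.
  rewrite -(normal_expR_sqr sq0 s2); apply: ge0_le_integral => //.
  - by apply: (measurableT_comp mg); exact: measurable_funM.
  - apply/measurable_EFinP; apply: measurableT_comp => //; apply: measurable_funM => //.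
    by apply: measurable_funM => //; exact: measurable_funX.
  - move=> y _; rewrite /g lee_fin ler_expR exprMn !sqr_sqrtr ?(ltW Dl0) // /k.
    have [->|vh0] := eqVneq (v h) 0%R.
      rewrite mul0r mul0r mulr_ge0 ?divr_ge0 ?sqr_ge0 ?(ltW Dl0) // subr_ge0 invf_le1 ?ler1n //.
    have -> : (v h * y ^+ 2 / (4 * v h * Dl) = y ^+ 2 / 4 * Dl^-1)%R by field; rewrite vh0 gt_eqF.
    have -> : ((1 - 2^-1) / 2 * (y ^+ 2 / (t - s)) = y ^+ 2 / 4 * (t - s)^-1)%R by field; rewrite gt_eqF.
    apply: ler_wpM2l; first by rewrite divr_ge0 // sqr_ge0.
    by rewrite lef_pV2.
have Ix h : P.-integrable setT (fun w => (expR (x h w))%:E).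
  apply/integrableP; split => //.
  under eq_integral do rewrite gee0_abs ?lee_fin ?expR_ge0//.
  by apply: le_lt_trans (Ex h) _; rewrite ltry.
have I1 (r : R) : P.-integrable setT (fun _ : Om => r%:E) by exact: finite_measure_integrable_cst.
have P1 (r : R) : \int[P]_w (r%:E) = r%:E.
  by rewrite integral_cst // [X in _ * X]probability_setT mule1.
have Ib h : P.-integrable setT (fun w => (expR (x h w) - 1)%:E).
  by under eq_fun do rewrite EFinB; exact: integrableB.
have Ih h : h \in sI -> P.-integrable setT (fun w => (a h * (expR (x h w) - 1))%:E).
  by move=> _; under eq_fun do rewrite EFinM; exact: integrableZl.
have [Is Es] := integral_sum_seq Ih.
apply: (@le_trans _ _ (\int[P]_w ((1%R)%:E + (\sum_(h <- sI) (a h * (expR (x h w) - 1))%R)%:E))).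
  apply: ge0_le_integral => //.
  - apply/measurable_EFinP; apply: measurableT_comp => //; apply: measurable_funM => //.
    by apply: measurable_sum => h; apply: measurable_funX; exact: measurable_incr_comb.
  - by apply: emeasurable_funD => //; exact: (measurable_int _ Is).
  - move=> w _; rewrite -EFinD lee_fin mulr_suml; under eq_bigr do rewrite xE.
    exact: expR_convex.
rewrite integralD // P1 Es.
apply: (@le_trans _ _ ((1%R)%:E + \sum_(h <- sI) (a h)%:E)).
  apply: leeD2l; apply: lee_sum => h _; under eq_integral do rewrite EFinM.
  rewrite integralZl //; under eq_integral do rewrite EFinB.
  rewrite integralB // P1 -[leRHS]mule1; apply: lee_wpmul2l; first by rewrite lee_fin.
  by rewrite leeBlDr // -EFinD; apply: Ex.
by rewrite sumEFin -EFinD lee_fin; lra.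
Qed.

(** [wiener_increments] for A, and again for the full event, yields the same product of normal
    probabilities, which is therefore the probability of B. *)
Lemma incr_independent A B : FF s A ->
  rectangles (fun i : 'I_(size sJ) => incr (tnth (in_tuple sJ) i)) B ->
  P (A `&` B) = P A * P B.
Proof.
move=> FA [S mS ->].
have on i j : ipU (tnth (in_tuple sJ) i) (tnth (in_tuple sJ) j) = (i == j)%:R.
  by rewrite oJ ?mem_tnth // !(tnth_nth (0%R : U)) nth_uniq.
have key := wiener_increments wienerW s0 st tT on.
rewrite /incr (key A) //; congr (_ * _); apply/esym.
rewrite -(setTI [set w | _]) (key setT) // ?[X in X * _]probability_setT ?mul1e //.
exact: filtration_setT.
Qed.

Local Close Scope ereal_scope.

Let T1 : measurableType _ := g_sigma_algebraType (FF s).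
Let be0 := fun i : 'I_(size sJ) => incr (tnth (in_tuple sJ) i).
Let T2 : measurableType _ := g_sigma_algebraType (rectangles be0).

Let sFF := (filtrFF.1 _ s_in).1.
Let FFm := (filtrFF.1 _ s_in).2.

Let mdW j : j \in sJ -> measurable_fun setT (fun z : T1 * T2 => incr j z.2).
Proof.
move=> js; have := @measurable_right _ Om R (FF s) _ be0 (Ordinal (etrans (index_mem j sJ) js)).
by rewrite /be0 (tnth_nth j) /= nth_index.
Qed.

Let mleft (g : Om -> R) : measurable_fun [set: T1] (g : T1 -> R) ->
  measurable_fun setT (fun z : T1 * T2 => g z.1).
Proof. by move=> mg; apply: (measurableT_comp mg); exact: measurable_fst. Qed.

Let mbe0 i : measurable_fun setT (be0 i).
Proof. exact: measurable_incr. Qed.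

Let dec (f : Om -> Om -> \bar R) (g : Om -> \bar R) :
  measurable_fun setT (fun z : T1 * T2 => f z.1 z.2) ->
  (forall w w', 0 <= f w w')%E -> measurable_fun [set: Om] g ->
  (forall w, \int[P]_w' f w w' <= g w)%E ->
  (\int[P]_w f w w <= \int[P]_w g w)%E.
Proof.
apply: (decouple_le sFF FFm mbe0) => A B FA RB.
exact: incr_independent.
Qed.

Let mdiag (g : Om -> Om -> R) : measurable_fun setT (fun z : T1 * T2 => g z.1 z.2) ->
  measurable_fun [set: Om] (fun w => g w w).
Proof.
move=> mg; pose h (z : T1 * T2) := g z.1 z.2; pose e (w : Om) : T1 * T2 := (w, w).
suff me : measurable_fun setT e by exact: (measurableT_comp (f := h) mg me).
apply: measurable_fun_pair => _ A mA; rewrite setTI.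
  by apply: FFm; move: mA; rewrite /T1 measurable_g_measurableTypeE.
exact: (g_rectangles_measurable mbe0).
Qed.

Variables (S : eqType) (sI : seq S) (K : Om -> R) (al : U -> Om -> R)
  (m : U -> U -> Om -> R) (be : S -> U -> Om -> R).
Hypotheses (mK : measurable_fun [set: T1] (K : T1 -> R))
  (mal : forall j, j \in sJ -> measurable_fun [set: T1] (al j : T1 -> R))
  (mm : forall i j, i \in sJ -> j \in sJ -> measurable_fun [set: T1] (m i j : T1 -> R))
  (mbe : forall h j, h \in sI -> j \in sJ -> measurable_fun [set: T1] (be h j : T1 -> R)).
Hypothesis K0 : forall w, 0 <= K w.
Variables (M Dl : R).
Hypotheses (M0 : 0 < M) (tsD : t - s <= Dl).
(** Stated only where the weight is nonzero: the coefficients are bounded on D, and the weight will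
    contain the indicator of D. *)
Hypothesis beM : forall w, K w != 0 -> \sum_(h <- sI) \sum_(j <- sJ) be h j w ^+ 2 <= M ^+ 2.

(** The first sample point enters the F_s-measurable coefficients and the second the increments; the
    scheme itself lives on the diagonal. *)
Definition gauss_lin (p : R) (w w' : Om) :=
  p * (\sum_(j <- sJ) al j w * incr j w') - p * (t - s) / 2 * \sum_(j <- sJ) al j w ^+ 2.
Definition gauss_quad (w w' : Om) :=
  2^-1 * (\sum_(i <- sJ) \sum_(j <- sJ) incr i w' * incr j w' * m i j w -
          (t - s) * \sum_(j <- sJ) m j j w).
Definition gauss_norm (w w' : Om) :=
  expR ((\sum_(h <- sI) (\sum_(j <- sJ) be h j w * incr j w') ^+ 2) /
        (4 * (M * Num.sqrt Dl) ^+ 2)).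

Let mlin p : measurable_fun setT (fun z : T1 * T2 => gauss_lin p z.1 z.2).
Proof.
apply: measurable_funB.
  apply: measurable_funM => //; apply: measurable_sum_seq => j js.
  by apply: measurable_funM; [exact: mleft (mal js)|exact: mdW].
apply: measurable_funM => //; apply: measurable_sum_seq => j js.
by apply: measurable_funX; exact: mleft (mal js).
Qed.

Let mquad : measurable_fun setT (fun z : T1 * T2 => gauss_quad z.1 z.2).
Proof.
apply: measurable_funM => //; apply: measurable_funB.
  apply: measurable_sum_seq => i is_; apply: measurable_sum_seq => j js.
  apply: measurable_funM; last exact: mleft (mm is_ js).
  by apply: measurable_funM; exact: mdW.
apply: measurable_funM => //; apply: measurable_sum_seq => j js.
exact: mleft (mm js js).
Qed.

Let mnorm : measurable_fun setT (fun z : T1 * T2 => gauss_norm z.1 z.2).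
Proof.
apply: measurableT_comp => //; apply: measurable_funM => //.
apply: measurable_sum_seq => h hs; apply: measurable_funX.
apply: measurable_sum_seq => j js.
by apply: measurable_funM; [exact: mleft (mbe hs js)|exact: mdW].
Qed.

Local Open Scope ereal_scope.

Let mincr j : measurable_fun [set: Om] (incr j). Proof. exact: measurable_incr. Qed.

Let norm_le2 w : K w != 0%R -> \int[P]_w' (gauss_norm w w')%:E <= 2%:E.
Proof.
move=> Kw.
exact: (expectation_exp_norm M0 tsD (be := fun h j => be h j w) (beM Kw)).
Qed.

Let mnormw w : measurable_fun [set: Om] (fun w' => (gauss_norm w w')%:E).
Proof.
apply/measurable_EFinP; apply: measurableT_comp => //; apply: measurable_funM => //.
apply: measurable_sum => h; apply: measurable_funX.
by apply: measurable_sum => j; apply: measurable_funM.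
Qed.

Let mKE : measurable_fun [set: Om] (fun w => (K w)%:E).
Proof. by apply/measurable_EFinP; exact: (measurable_filtration filtrFF s_in). Qed.

Lemma measurable_gauss_norm : measurable_fun [set: Om] (fun w => gauss_norm w w).
Proof. exact: mdiag. Qed.

Lemma integral_gauss_norm :
  \int[P]_w (K w * gauss_norm w w)%:E <= 2%:E * \int[P]_w (K w)%:E.
Proof.
have K0' w : 0 <= (K w)%:E by rewrite lee_fin.
rewrite -(ge0_integral_scale P (ler0n _ 2) mKE) //.
apply: (dec (f := fun w w' => (K w * gauss_norm w w')%:E)).
- by apply/measurable_EFinP; apply: measurable_funM => //; exact: mleft.
- by move=> w w'; rewrite lee_fin mulr_ge0 // expR_ge0.
- exact: emeasurable_funM.
move=> w; under eq_integral do rewrite EFinM.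
rewrite (ge0_integral_scale P (K0 w) (mnormw w)); last by move=> w'; rewrite lee_fin expR_ge0.
have [->|Kw] := eqVneq (K w) 0%R; first by rewrite mul0e mule0.
by rewrite muleC; apply: lee_wpmul2r => //; exact: norm_le2.
Qed.

Variables (p eta : R).
Hypotheses (p01 : (0 <= p <= 1)%R) (eta0 : (0 <= eta)%R).
Let maj w w' := (expR (gauss_lin p w w') + p * gauss_quad w w' + 2 * eta * gauss_norm w w')%R.
Hypothesis maj0 : forall w w', K w != 0%R -> (0 <= maj w w')%R.

Let mmaj : measurable_fun setT (fun z : T1 * T2 => maj z.1 z.2).
Proof.
apply: measurable_funD; last exact: measurable_funM.
by apply: measurable_funD; [exact: measurableT_comp|exact: measurable_funM].
Qed.

Lemma measurable_gauss_majorant : measurable_fun [set: Om] (fun w => maj w w).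
Proof. exact: (mdiag (g := maj)). Qed.

(** For frozen w the three summands of the majorant integrate to at most 1, to 0 and to at most
    [4 eta]. *)
Lemma integral_gauss_majorant :
  \int[P]_w (K w * maj w w)%:E <= (1 + 4 * eta)%:E * \int[P]_w (K w)%:E.
Proof.
have K0' w : 0 <= (K w)%:E by rewrite lee_fin.
have e4 : (0 <= 1 + 4 * eta)%R by rewrite addr_ge0 // mulr_ge0.
rewrite -(ge0_integral_scale P e4 mKE) //.
have pos w w' : (0 <= K w * maj w w')%R.
  by have [->|Kw] := eqVneq (K w) 0%R; rewrite ?mul0r // mulr_ge0 // maj0.
apply: (dec (f := fun w w' => (K w * maj w w')%:E)).
- by apply/measurable_EFinP; apply: measurable_funM => //; exact: mleft.
- by move=> w w'; rewrite lee_fin.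
- exact: emeasurable_funM.
move=> w; have [->|Kw] := eqVneq (K w) 0%R.
  by under eq_integral do rewrite mul0r; rewrite integral0 mule0.
have Il : P.-integrable setT (fun w' => (expR (gauss_lin p w w'))%:E).
  apply/integrableP; split.
    apply/measurable_EFinP; apply: measurableT_comp => //; apply: measurable_funB => //.
    by apply: measurable_funM => //; apply: measurable_sum => j; apply: measurable_funM.
  under eq_integral do rewrite gee0_abs ?lee_fin ?expR_ge0//.
  apply: le_lt_trans (expectation_exp_lin (fun j => al j w) p01) _.
  by rewrite ltry.
have P1 (r : R) : \int[P]_w (r%:E) = r%:E.
  by rewrite integral_cst // [X in _ * X]probability_setT mule1.
have I1 (r : R) : P.-integrable setT (fun _ : Om => r%:E) by exact: finite_measure_integrable_cst.
have Iq0 := quad_incr_integrable (fun i j => m i j w).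
have Eq0 := expectation_quad_incr (fun i j => m i j w).
have Iq : P.-integrable setT (fun w' => (gauss_quad w w')%:E).
  under eq_fun do rewrite EFinM EFinB.
  by apply: integrableZl => //; apply: integrableB.
have Eq : \int[P]_w' (gauss_quad w w')%:E = 0.
  under eq_integral do rewrite EFinM EFinB.
  rewrite integralZl //; last exact: integrableB.
  by rewrite integralB // Eq0 P1 subee // mule0.
have In : P.-integrable setT (fun w' => (gauss_norm w w')%:E).
  apply/integrableP; split => //.
  under eq_integral do rewrite gee0_abs ?lee_fin ?expR_ge0//.
  by apply: le_lt_trans (norm_le2 Kw) _; rewrite ltry.
have Iqp : P.-integrable setT (fun w' => (p * gauss_quad w w')%:E).
  by under eq_fun do rewrite EFinM; exact: integrableZl.
have Inp : P.-integrable setT (fun w' => (2 * eta * gauss_norm w w')%:E).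
  by under eq_fun do rewrite EFinM; exact: integrableZl.
have Im : P.-integrable setT (fun w' => (maj w w')%:E).
  by under eq_fun do rewrite /maj !EFinD; apply: integrableD => //; exact: integrableD.
under eq_integral do rewrite EFinM.
rewrite integralZl // muleC; apply: lee_wpmul2r => //.
under eq_integral do rewrite /maj !EFinD.
rewrite integralD //; last exact: integrableD.
rewrite integralD //.
under [X in _ + X + _]eq_integral do rewrite EFinM.
rewrite integralZl // Eq mule0 adde0.
under [X in _ + X]eq_integral do rewrite EFinM.
rewrite integralZl // EFinD; apply: leeD.
  exact: (expectation_exp_lin (fun j => al j w) p01).
have -> : (4 * eta = 2 * eta * 2)%R by ring.
rewrite [leRHS]EFinM; apply: lee_wpmul2l; first by rewrite lee_fin mulr_ge0.
exact: norm_le2.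
Qed.

End gaussian_increments.

(** * Measurability of the coefficients *)

Section random_elements.
Context d (Om : measurableType d) (R : realType) (G : set (set Om)).
Hypothesis sG : sigma_algebra setT G.
Let T1 : measurableType _ := g_sigma_algebraType G.

Lemma random_element_measurable (Z : Type) (E : set Z) (e : Z -> Z -> R) (X : Om -> Z)
    (g : Z -> R) : random_element G E e X ->
  (forall x (r : R), E x -> 0 < r ->
     exists2 q, 0 < q & forall y, E y -> e x y < q -> `|g x - g y| < r) ->
  measurable_fun [set: T1] (fun w : T1 => g (X w)).
Proof.
move=> [EX GX] cg; apply: (measurability _ (RGenOInfty.measurableE R)).
move=> /= _ [_ [a ->] <-]; rewrite setTI /T1 measurable_g_measurableTypeE //.
have -> : (fun w : T1 => g (X w)) @^-1` `]a, +oo[ = X @^-1` (E `&` [set x | a < g x]).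
  by apply/seteqP; split => w /=; rewrite in_itv /= andbT => // -[].
apply: GX; apply: sub_sigma_algebra; split; first by move=> x [].
move=> x [Ex /= ax]; have [|q q0 hq] := cg x (g x - a) Ex; first by rewrite subr_gt0.
exists q => // y Ey /(hq y Ey); rewrite ltr_norml => /andP[_ h].
by split => //=; lra.
Qed.

Lemma random_element_comp (Z Z' : Type) (E : set Z) (e : Z -> Z -> R) (E' : set Z')
    (e' : Z' -> Z' -> R) (X : Om -> Z) (f : Z -> Z') :
  random_element G E e X -> borel_measurable_on E e E' e' f ->
  random_element G E' e' (fun w => f (X w)).
Proof.
move=> [EX GX] [Ef Bf]; split; first by move=> w; apply: Ef.
move=> S BS; have := GX _ (Bf S BS); congr (G _).
by apply/seteqP; split => w /=; [case|split].
Qed.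

(** Enlarges the state space and changes its metric. Continuity of the inclusion is asked on E only,
    where X takes its values. *)
Lemma random_element_widen (Z : Type) (E : set Z) (e : Z -> Z -> R) (E' : set Z)
    (e' : Z -> Z -> R) (X : Om -> Z) : random_element G E e X -> E `<=` E' ->
  (forall x (r : R), E x -> 0 < r -> exists2 q, 0 < q & forall y, E y -> e x y < q -> e' x y < r) ->
  random_element G E' e' X.
Proof.
move=> [EX GX] EE' ee'; have E'X w : E' (X w) by exact/EE'/EX.
split => // S; move: S; apply: smallest_sub.
  have [G0 GD GU] := sG; split.
  - by rewrite /= preimage_set0.
  - move=> A /GD /=; congr (G _).
    by apply/seteqP; split => w /=; [case=> _ nA; split|case=> _ nA; split].
  - by move=> F /GU /=; rewrite preimage_bigcup.
move=> O [OE' oO]; have -> : X @^-1` O = X @^-1` (E `&` O).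
  by apply/seteqP; split => w /=; [split|case].
apply: GX; apply: sub_sigma_algebra; split; first by move=> x [].
move=> x [Ex Ox]; have [r r0 hr] := oO x Ox; have [q q0 hq] := ee' x r Ex r0.
by exists q => // y Ey xy; split => //; apply: hr; [exact: EE'|exact: hq].
Qed.

Lemma random_element_indic (Z : Type) (E : set Z) (e : Z -> Z -> R) (X : Om -> Z) (D : set Z) :
  random_element G E e X -> borel_on E e D ->
  measurable_fun [set: T1] (fun w : T1 => \1_D (X w) : R).
Proof.
move=> [_ GX] /GX GD; have -> : (fun w : T1 => \1_D (X w) : R) = \1_(X @^-1` D : set T1).
  by apply/funext => w; rewrite !indicE; congr (nat_of_bool _)%:R; apply/idP/idP; rewrite !inE.
by apply: measurable_indic; rewrite /T1 measurable_g_measurableTypeE.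
Qed.

End random_elements.

Section hs_coordinates.
Context (R : realType) (U H : normedModType R) (UU : set U).

Lemma hs_norm2_sub (L M : U -> H) :
  (hs_norm2 UU L < +oo)%E -> (hs_norm2 UU M < +oo)%E ->
  (hs_norm2 UU (fun u => (L u - M u)%R) < +oo)%E.
Proof.
move=> hL hM; have n0 (N : U -> H) u : (0 <= (`|N u| ^+ 2)%:E)%E by rewrite lee_fin exprn_ge0.
apply: (@le_lt_trans _ _ ((hs_norm2 UU L + hs_norm2 UU L) + (hs_norm2 UU M + hs_norm2 UU M))%E); last first.
  by rewrite !lte_add_pinfty.
rewrite /hs_norm2 -!esumD //; try by move=> u _; rewrite adde_ge0.
apply: le_esum => u _; rewrite -!EFinD lee_fin.
have : `|L u - M u| ^+ 2 <= (`|L u| + `|M u|) ^+ 2.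
  by apply: lerXn2r; rewrite ?nnegrE ?addr_ge0 // ler_normB.
by have := sqr_ge0 (`|L u| - `|M u|); rewrite sqrrB sqrrD; lra.
Qed.

(** One term of the sum that defines the norm. Finiteness of the sum matters because [fine] sends
    +oo to 0. *)
Lemma le_hs_dist (L M : U -> H) u : hilbert_schmidt UU L -> hilbert_schmidt UU M -> UU u ->
  `|L u - M u| <= hs_dist UU L M.
Proof.
move=> [_ _ hL] [_ _ hM] Uu; have hLM := hs_norm2_sub hL hM.
rewrite /hs_dist /hs_norm -[leLHS]ger0_norm // -sqrtr_sqr ler_wsqrtr // -lee_fin fineK.
  apply: esum_ge; exists [set u]; first by split => // v ->.
  by rewrite fsbig_set1.
by rewrite ge0_fin_numE //; apply: esum_ge0 => v _; rewrite lee_fin exprn_ge0.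
Qed.

End hs_coordinates.

Section measurable_coefficients.
Context d (Om : measurableType d) (R : realType) (G : set (set Om)).
Hypothesis sG : sigma_algebra setT G.
Let T1 : measurableType _ := g_sigma_algebraType G.
Context (H U : completeNormedModType R) (ipH : {dot H for idfun}).
Hypothesis hH : hilbert_norm ipH.
Variables (HH : set H) (UU : set U) (lam : H -> R) (gamma : R).
Hypothesis basisHH : orthonormal_basis ipH HH.
Variables (I : set H) (fI : fsets HH I).
Local Notation sI := (fset_set I : seq H).
Local Notation span := (orthoproj ipH I @` interp ipH HH lam gamma).
Variable X : Om -> H.
Hypothesis GX : random_element G span (@norm_dist R H) X.

Lemma spanP x : span x -> proj ipH sI x = x.
Proof.
move=> [y _ <-]; rewrite (orthoprojE ipH fI); apply: projK; first exact: fsets_uniq.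
by move=> *; exact: (fsets_on basisHH fI).
Qed.

Lemma interp_norm_le x : proj ipH sI x = x ->
  interp_norm ipH HH lam gamma x <= (\sum_(h <- sI) `|(- lam h) `^ gamma|) * `|x|.
Proof.
move=> xE; rewrite /interp_norm (fcalcE basisHH fI) //.
apply: le_trans (ler_norm_sum _ _ _) _; rewrite mulr_suml.
rewrite big_seq [leRHS]big_seq; apply: ler_sum => h hs.
have on := fsets_on basisHH fI.
rewrite normrZ normrM -mulrA; apply: ler_wpM2l => //.
have h1 : `|h| = 1.
  by apply/eqP; rewrite -(@eqrXn2 _ 2) ?expr1n // -hH on // eqxx.
by rewrite h1 mulr1; exact: (norm_ip_le1 hH on).
Qed.

(** Adaptedness is given in the norm of H, whereas the coefficients are Borel for that of H_gamma.
    On the finite-dimensional range the second norm is at most a constant times the first. *)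
Lemma random_element_interp :
  random_element G (interp ipH HH lam gamma) (interp_dist ipH HH lam gamma) X.
Proof.
apply: (random_element_widen sG GX).
  by move=> x /spanP; exact: (interp_proj basisHH fI).
move=> x r sx r0; set k := \sum_(h <- sI) `|(- lam h) `^ gamma|.
have k0 : 0 <= k by apply: sumr_ge0.
exists (r / (1 + k)); first by rewrite divr_gt0 // ltr_pwDl.
move=> y sy; rewrite /norm_dist /interp_dist ltr_pdivlMr ?ltr_pwDl // => xy.
have xyE : proj ipH sI (x - y) = x - y.
  by rewrite projD -scaleN1r projZ !spanP.
apply: le_lt_trans (interp_norm_le xyE) _; apply: le_lt_trans xy.
by rewrite mulrC ler_wpM2l // lerDr.
Qed.

Lemma measurable_loc_lip (g : H -> R) :
  (forall x, exists2 L, 0 <= L & forall k, `|k| <= 1 -> `|g (x + k) - g x| <= L * `|k|) ->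
  measurable_fun [set: T1] (fun w : T1 => g (X w)).
Proof.
move=> gL; apply: (random_element_measurable sG GX) => x r _ r0.
have [L L0 hL] := gL x; exists (Num.min 1 (r / (1 + L))).
  by rewrite lt_min ltr01 divr_gt0 // ltr_pwDl.
move=> y _; rewrite /norm_dist lt_min => /andP[xy1]; rewrite ltr_pdivlMr ?ltr_pwDl // => xy.
have yx : `|y - x| <= 1 by rewrite distrC ltW.
have := hL _ yx; rewrite [x + _]addrC subrK (distrC (g y)) (distrC y) => h.
apply: le_lt_trans h _; apply: le_lt_trans xy.
by rewrite mulrC ler_wpM2l // lerDr.
Qed.

Variables (c : R) (V : H -> R).
Hypothesis c1 : 1 <= c.
Hypothesis VC : Cnc 3 c [set r | 0 <= r] V.

Lemma measurable_V : measurable_fun [set: T1] (fun w : T1 => V (X w)).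
Proof.
apply: measurable_loc_lip => x; exists (Llip c V 1 x); first exact: (Llip_ge0 c1 VC).
by move=> k k1; have [] := V_lip_local c1 VC x ler01 k1.
Qed.

Lemma measurable_dV h : measurable_fun [set: T1] (fun w : T1 => 'D_h V (X w)).
Proof.
apply: (measurable_loc_lip (g := fun x => 'D_h V x)) => x; exists (Llip c V 1 x * `|h|).
  by rewrite mulr_ge0 // (Llip_ge0 c1 VC).
move=> k k1; have [_ hk _] := V_lip_local c1 VC x ler01 k1.
by apply: le_trans (hk h) _; rewrite mulrAC.
Qed.

Lemma measurable_ddV h h' : measurable_fun [set: T1] (fun w : T1 => 'D_h ('D_h' V) (X w)).
Proof.
apply: (measurable_loc_lip (g := fun x => 'D_h ('D_h' V) x)) => x; exists (Llip c V 1 x * `|h| * `|h'|).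
  by apply: mulr_ge0 => //; apply: mulr_ge0 => //; exact: (Llip_ge0 c1 VC).
move=> k k1; have [_ _ hk] := V_lip_local c1 VC x ler01 k1.
apply: le_trans (hk h h') _; rewrite le_eqVlt; apply/orP; left; apply/eqP.
by move: (Llip _ _ _ _) => *; ring.
Qed.

Variable B : H -> U -> H.
Hypothesis B_meas : borel_measurable_on
  (interp ipH HH lam gamma) (interp_dist ipH HH lam gamma)
  (hilbert_schmidt UU) (hs_dist UU) B.

Lemma measurable_B_coord h u : UU u ->
  measurable_fun [set: T1] (fun w : T1 => ipH h (B (X w) u)).
Proof.
move=> Uu; have GB := random_element_comp random_element_interp B_meas.
apply: (random_element_measurable sG GB (g := fun L => ipH h (L u))) => L r hL r0.
exists (r / (1 + `|h|)); first by rewrite divr_gt0 // ltr_pwDl.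
move=> M hM; rewrite ltr_pdivlMr ?ltr_pwDl // => LM.
rewrite -ipBr; apply: le_lt_trans (ip_le hH _ _) _.
apply: le_lt_trans LM; rewrite mulrC; apply: ler_pM => //.
  exact: le_hs_dist.
by rewrite lerDr.
Qed.

End measurable_coefficients.

(** * The rate of the one-step error *)

Section rate.
Context (R : realType).
Implicit Types (a b e h x T : R).

Lemma powR_le_bound h T e : 0 < h <= T -> 0 <= e -> h `^ e <= T `^ e.
Proof.
move=> /andP[h0 hT] e0; apply: ge0_ler_powR => //; rewrite nnegrE ltW //.
exact: lt_le_trans hT.
Qed.

Lemma powR_neg_bound h T e : 0 < h <= T -> 0 <= e -> 1 <= T `^ e * h `^ (- e).
Proof.
move=> hT e0; have /andP[h0 _] := hT.
by rewrite powRN ler_pdivlMr ?powR_gt0 // mul1r; exact: powR_le_bound.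
Qed.

Lemma powR_small e (r : R) : 0 < e -> 0 < r ->
  exists2 q, 0 < q & forall h, 0 < h < q -> h `^ e <= r.
Proof.
move=> e0 r0; exists (r `^ e^-1); first by rewrite powR_gt0.
move=> h /andP[h0 hq]; apply: (@le_trans _ _ ((r `^ e^-1) `^ e)).
  by apply: ge0_ler_powR; rewrite ?nnegrE ?powR_ge0 ?ltW.
by rewrite -powRrM mulVf ?gt_eqF // powRr1 // ltW.
Qed.

Lemma sqrt_le_powR Dl h : 0 < Dl <= h -> Num.sqrt Dl <= h `^ (2^-1).
Proof.
move=> /andP[D0 Dh]; rewrite powR12_sqrt ?ler_wsqrtr //.
exact: le_trans (ltW D0) Dh.
Qed.

(** The noise scale tau is at most of order [h^(1/2 - delta)], L of order [h^(-varsigma)] and Lbar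
    of order [h^(-varsigma iota)]. The upper bound on varsigma makes the exponents in [om] positive;
    the factor Dl in the last estimate lets the errors add up to at most [T om(h)] along the
    grid. *)
Lemma step_constants (T c iota rho delta varsigma : R) (Lg : R -> R) :
  0 < T -> 1 <= c -> 1 <= iota -> 0 <= rho -> 0 <= delta < 14^-1 ->
  0 < varsigma < (1 - 14 * delta) / (2 + 2 * iota) ->
  (forall K, 1 <= K -> 1 <= Lg K) ->
  exists (C K : R) (om : R -> R),
    [/\ 1 <= C, rho <= C,
        forall e, 0 < e -> exists2 q, 0 < q & forall h, 0 < h < q -> 0 <= om h <= e,
        exists Om, forall h, 0 < h <= T -> 0 <= om h <= Om &
        forall h Dl v, 0 < h <= T -> 0 < Dl <= h -> 0 <= v <= c * h `^ (- varsigma) ->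
        let M := c * h `^ (- delta) in
        let tau := M * Num.sqrt Dl in
        let L := c * (Lg K * (1 + v)) in
        let Lbar := c * (1 + 2 * L `^ iota) in
        [/\ 0 < M, Dl * M + 1 <= K, tau <= C, L * tau <= C &
         [/\ Lbar * Dl * tau <= C, Num.sqrt Dl <= C * tau, Dl <= C * tau &
            absorb_const (4 * C ^+ 6) * (L ^+ 2 * tau ^+ 3 + Lbar * Dl * tau) <= Dl * om h]]].
Proof.
move=> T0 c1 i1 r0 /andP[d0 d1] /andP[v0 v1] Lg1.
have i2 : 0 < 2 + 2 * iota by lra.
have {}v1 : varsigma * (2 + 2 * iota) < 1 - 14 * delta by rewrite -ltr_pdivlMr.
have vi0 : 0 < varsigma * iota by rewrite mulr_gt0 //; lra.
have viE : varsigma <= varsigma * iota by rewrite ler_peMr // ltW.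
have {}v1 : 2 * varsigma + 2 * (varsigma * iota) < 1 - 14 * delta.
  by move: v1; rewrite mulrDr mulrCA [varsigma * 2]mulrC.
(* Once a factor Dl is split off, [L^2 tau^3] leaves [h^e1] and [Lbar Dl tau] leaves [h^e2]; [tau]
   and [L tau] are at most of order [h^e3] and [h^e4]. *)
pose e1 := 2^-1 - 2 * varsigma - 3 * delta; have e10 : 0 < e1 by rewrite /e1; lra.
pose e2 := 2^-1 - delta - varsigma * iota; have e20 : 0 < e2 by rewrite /e2; lra.
pose e3 := 2^-1 - delta; have e30 : 0 <= e3 by rewrite /e3; lra.
pose e4 := 2^-1 - delta - varsigma; have e40 : 0 <= e4 by rewrite /e4; lra.
(* Largest displacement in one step: at most [c T^(1 - delta)] from the drift and 1 from the tamed
   noise. *)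
pose K := c * T `^ (1 - delta) + 1.
have c0 : 0 <= c by exact: le_trans c1.
have K1 : 1 <= K by rewrite lerDr mulr_ge0 // powR_ge0.
pose C3 := c * Lg K * (T `^ varsigma + c).
have LK1 := Lg1 _ K1; have LK0 : 0 <= Lg K by exact: le_trans LK1.
have C30 : 0 <= C3 by rewrite !mulr_ge0 // addr_ge0 // powR_ge0.
pose C4 := c * (T `^ (varsigma * iota) + 2 * C3 `^ iota).
have C40 : 0 <= C4 by rewrite mulr_ge0 // addr_ge0 ?mulr_ge0 // powR_ge0.
pose A1 := c * T `^ e3; have A10 : 0 <= A1 by rewrite mulr_ge0 // powR_ge0.
pose A2 := C3 * c * T `^ e4; have A20 : 0 <= A2 by apply: mulr_ge0 (powR_ge0 _ _); exact: mulr_ge0.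
pose A3 := T * (C4 * c * T `^ e2); have A30 : 0 <= A3.
  by apply: mulr_ge0 (ltW T0) _; apply: mulr_ge0 (powR_ge0 _ _); exact: mulr_ge0.
pose A4 := T `^ delta; have A40 : 0 <= A4 by rewrite powR_ge0.
pose A5 := T `^ 2^-1 * T `^ delta; have A50 : 0 <= A5 by rewrite mulr_ge0 // powR_ge0.
(* [A1] to [A5] bound [tau], [L tau], [Lbar Dl tau], [sqrt Dl / tau] and [Dl / tau] for all h up to
   T. *)
pose C := 1 + rho + A1 + A2 + A3 + A4 + A5.
have [[C1 rC CA1 CA2] [CA3 CA4 CA5]] :
    [/\ 1 <= C, rho <= C, A1 <= C & A2 <= C] /\ [/\ A3 <= C, A4 <= C & A5 <= C].
  rewrite /C; clear C; clear -r0 A10 A20 A30 A40 A50; move: A1 A2 A3 A4 A5 A10 A20 A30 A40 A50 => *.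
  by split; split; lra.
clearbody C; pose ac := absorb_const (4 * C ^+ 6).
have C0 : 0 <= C by exact: le_trans C1.
have ac0 : 0 <= ac by apply: absorb_const_ge0; rewrite mulr_ge0 // exprn_ge0.
pose om h := ac * (C3 ^+ 2 * c ^+ 3 * h `^ e1 + C4 * c * h `^ e2).
have B10 : 0 <= C3 ^+ 2 * c ^+ 3 by rewrite mulr_ge0 // exprn_ge0.
have B20 : 0 <= C4 * c by rewrite mulr_ge0.
have om0 h : 0 <= om h.
  by rewrite mulr_ge0 // addr_ge0 // mulr_ge0 // powR_ge0.
exists C, K, om; split.
- exact: C1.
- exact: rC.
- move=> e e0; pose A := 1 + ac * (C3 ^+ 2 * c ^+ 3 + C4 * c).
  have A0 : 0 < A by rewrite ltr_pwDl // mulr_ge0 // addr_ge0.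
  have [q1 q10 hq1] := powR_small e10 (divr_gt0 e0 A0).
  have [q2 q20 hq2] := powR_small e20 (divr_gt0 e0 A0).
  exists (Num.min q1 q2); first by rewrite lt_min q10.
  move=> h /andP[h0]; rewrite lt_min => /andP[h1 h2]; rewrite om0 /=.
  apply: (@le_trans _ _ (ac * (C3 ^+ 2 * c ^+ 3 + C4 * c) * (e / A))).
    rewrite -mulrA; apply: ler_wpM2l => //; rewrite mulrDl.
    by apply: lerD; apply: ler_wpM2l => //; [apply: hq1|apply: hq2]; rewrite h0.
  rewrite mulrCA ler_piMr ?(ltW e0) // ler_pdivrMr // mul1r lerDr //.
- exists (om T) => h hT; rewrite om0 /=; apply: ler_wpM2l => //.
  by apply: lerD; apply: ler_wpM2l => //; apply: powR_le_bound => //; exact: ltW.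
move=> h Dl v hT hD /andP[vx0 vx1] /=.
have /andP[h0 hT'] := hT; have /andP[D0 Dh] := hD.
have h0' := ltW h0.
set M := c * h `^ (- delta); set tau := M * Num.sqrt Dl.
set L := c * (Lg K * (1 + v)); set Lbar := c * (1 + 2 * L `^ iota).
have hD' (x y : R) : h `^ (x + y) = h `^ x * h `^ y by rewrite powRD //; apply/implyP => _; rewrite gt_eqF.
have cp : 0 < c by exact: lt_le_trans c1.
have M0 : 0 < M by rewrite mulr_gt0 // powR_gt0.
have sq0 : 0 < Num.sqrt Dl by rewrite sqrtr_gt0.
have sqE : Num.sqrt Dl ^+ 2 = Dl by rewrite sqr_sqrtr // ltW.
have sqh := sqrt_le_powR hD.
have tau0 : 0 < tau by rewrite mulr_gt0.
have tauh : tau <= c * h `^ e3.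
  rewrite /tau /M -mulrA; apply: ler_wpM2l => //; rewrite /e3 addrC hD'.
  by apply: ler_wpM2l => //; exact: powR_ge0.
have Lh : L <= C3 * h `^ (- varsigma).
  have -> : C3 * h `^ (- varsigma) = c * (Lg K * (T `^ varsigma * h `^ (- varsigma) + c * h `^ (- varsigma))).
    by rewrite /C3; ring.
  apply: ler_wpM2l => //; apply: ler_wpM2l => //; apply: lerD => //.
  by apply: powR_neg_bound => //; exact: ltW.
have L0 : 0 <= L by rewrite !mulr_ge0 // addr_ge0.
have Lbarh : Lbar <= C4 * h `^ (- (varsigma * iota)).
  set hvi := h `^ (- (varsigma * iota)).
  have -> : C4 * hvi = c * (T `^ (varsigma * iota) * hvi + 2 * (C3 `^ iota * hvi)).
    by rewrite /C4; ring.
  apply: ler_wpM2l => //; apply: lerD; first by apply: powR_neg_bound => //; exact: ltW.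
  apply: ler_wpM2l => //.
  have -> : hvi = (h `^ (- varsigma)) `^ iota by rewrite -powRrM mulNr.
  rewrite -powRM ?powR_ge0 //; apply: ge0_ler_powR; rewrite ?nnegrE //.
  - exact: le_trans i1.
  - by rewrite mulr_ge0 // powR_ge0.
have Lbar0 : 0 <= Lbar by rewrite mulr_ge0 // addr_ge0 // mulr_ge0 // powR_ge0.
have mu1 : Lbar * Dl * tau <= Dl * (C4 * c * h `^ e2).
  rewrite mulrAC mulrC; apply: ler_wpM2l; first exact: ltW.
  have -> : C4 * c * h `^ e2 = (C4 * h `^ (- (varsigma * iota))) * (c * h `^ e3).
    have -> : e2 = - (varsigma * iota) + e3 by rewrite /e2 /e3; ring.
    by rewrite hD'; ring.
  by apply: ler_pM => //; exact: ltW.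
split => //.
- rewrite /K lerD2r; apply: (@le_trans _ _ (c * h `^ (1 - delta))).
    rewrite /M mulrCA; apply: ler_wpM2l => //; rewrite hD' powRr1 //.
    by apply: ler_wpM2r => //; exact: powR_ge0.
  by apply: ler_wpM2l => //; apply: powR_le_bound => //; lra.
- apply: le_trans tauh _; apply: le_trans CA1.
  by apply: ler_wpM2l => //; exact: powR_le_bound.
- apply: le_trans CA2.
  apply: (@le_trans _ _ (C3 * c * h `^ e4)); last first.
    by apply: ler_wpM2l; [rewrite mulr_ge0|exact: powR_le_bound].
  have -> : C3 * c * h `^ e4 = (C3 * h `^ (- varsigma)) * (c * h `^ e3).
    have -> : e4 = - varsigma + e3 by rewrite /e4 /e3; ring.
    by rewrite hD'; ring.
  by apply: ler_pM => //; exact: ltW.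
have hd : 1 <= T `^ delta * h `^ (- delta) by exact: powR_neg_bound.
have hd0 : 0 <= h `^ (- delta) by exact: powR_ge0.
split.
- apply: le_trans mu1 _; apply: le_trans CA3.
  apply: ler_pM; first exact: ltW.
  - by apply: mulr_ge0 (powR_ge0 _ _); exact: mulr_ge0.
  - exact: le_trans Dh hT'.
  by apply: ler_wpM2l => //; apply: powR_le_bound => //; exact: ltW.
- rewrite /tau mulrA ler_peMl ?(ltW sq0) //.
  apply: (le_trans hd); apply: (@le_trans _ _ (C * h `^ (- delta))).
    exact: ler_wpM2r CA4.
  by apply: ler_wpM2l => //; rewrite /M ler_peMl.
- rewrite -[leLHS]sqE expr2 /tau mulrA; apply: ler_wpM2r; first exact: ltW.
  apply: (@le_trans _ _ (T `^ 2^-1)).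
    by apply: le_trans sqh _; apply: powR_le_bound.
  apply: (@le_trans _ _ (T `^ 2^-1 * (T `^ delta * h `^ (- delta)))).
    by rewrite ler_peMr // powR_ge0.
  rewrite mulrA; apply: (@le_trans _ _ (C * h `^ (- delta))).
    exact: ler_wpM2r CA5.
  by apply: ler_wpM2l => //; rewrite /M ler_peMl.
rewrite /om -/ac [leRHS]mulrCA; apply: ler_wpM2l => //; rewrite mulrDr; apply: lerD => //.
have -> : tau ^+ 3 = Dl * (M ^+ 3 * Num.sqrt Dl) by rewrite -[X in _ = X * _]sqE /tau; ring.
rewrite [leLHS]mulrCA; apply: ler_wpM2l; first exact: ltW.
have -> : C3 ^+ 2 * c ^+ 3 * h `^ e1 = (C3 * h `^ (- varsigma)) ^+ 2 * ((c * h `^ (- delta)) ^+ 3 * h `^ (2^-1)).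
  have -> : e1 = - varsigma + (- varsigma + (- delta + (- delta + (- delta + 2^-1)))) by rewrite /e1; ring.
  by rewrite !hD'; ring.
apply: ler_pM.
- by rewrite exprn_ge0.
- by rewrite mulr_ge0 ?(ltW sq0) // exprn_ge0 // ltW.
- by apply: lerXn2r; rewrite ?nnegrE // mulr_ge0 // powR_ge0.
- by apply: ler_wpM2l => //; rewrite exprn_ge0 // ltW.
Qed.

End rate.

(** * The scheme on one step *)

Section scheme.
Context d (Om : measurableType d) (R : realType).
Context (H U : completeNormedModType R).
Context (ipH : {dot H for idfun}) (ipU : {dot U for idfun}).
Hypotheses (hH : hilbert_norm ipH) (hU : hilbert_norm ipU).
Variables (HH : set H) (UU : set U).
Hypotheses (basisHH : orthonormal_basis ipH HH) (basisUU : orthonormal_basis ipU UU).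
Variables (I : set H) (J : set U) (fI : fsets HH I) (fJ : fsets UU J).
Local Notation sI := (fset_set I : seq H).
Local Notation sJ := (fset_set J : seq U).
Variables (lam : H -> R) (W : R -> U -> Om -> R).

Lemma semigroup_sum (S : Type) (r : seq S) (a : S -> R) (f : S -> H) t :
  (forall i, proj ipH sI (f i) = f i) ->
  semigroup ipH HH lam t (\sum_(i <- r) a i *: f i) =
  \sum_(i <- r) a i *: semigroup ipH HH lam t (f i).
Proof.
move=> fE; elim: r => [|i r IH].
  by rewrite !big_nil (semigroup_zero basisHH fI).
rewrite !big_cons (semigroupP basisHH fI) // ?IH // proj_sum.
by apply: eq_bigr => j _; rewrite projZ fE.
Qed.

Lemma elementary_ito_finite (Phi : Om -> U -> H) s t w :
  (forall u, UU u -> ~ J u -> Phi w u = 0) ->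
  elementary_ito UU W Phi s t w = \sum_(j <- sJ) incr W s t j w *: Phi w j.
Proof.
move=> P0; have finJ : finite_set J by case: fJ.
rewrite /elementary_ito -(fsbig_finite _ _ finJ); apply/esym/fsbig_widen.
  by case: fJ.
by move=> u [Uu nJ] /=; rewrite P0 ?scaler0.
Qed.

Variables (X Yr : H) (f : H) (L : U -> H) (D : set H).
Hypotheses (linL : linear L) (XE : proj ipH sI X = X) (fE : proj ipH sI f = f).
Let b j := proj ipH sI (L j).
Variables (s r : R) (w : Om).
Let S := semigroup ipH HH lam (r - s).
Let PBP u := orthoproj ipH I (L (orthoproj ipU J u)).
Let z := \sum_(j <- sJ) incr W s r j w *: b j.
Hypothesis YE : Yr = S (X + (\1_D X * (r - s)) *: f) +
  (1 + `|elementary_ito UU W (fun _ => PBP) s r w| ^+ 2)^-1 *: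
    elementary_ito UU W (fun _ u => S (\1_D X *: PBP u)) s r w.

Lemma proj_comb_b (a : U -> R) :
  proj ipH sI (\sum_(j <- sJ) a j *: b j) = \sum_(j <- sJ) a j *: b j.
Proof.
by rewrite proj_sum; apply: eq_bigr => j _; rewrite projZ (proj_b basisHH fI).
Qed.

Lemma scheme_in : D X -> Yr = S (X + ((r - s) *: f + tame z)).
Proof.
move=> DX; rewrite YE indicE mem_set //= mul1r.
have out u : UU u -> ~ J u -> PBP u = 0.
  exact: (finite_rank_out ipH basisUU fI fJ linL).
rewrite !elementary_ito_finite; last 2 first.
- by move=> u Uu nJ; rewrite out // scaler0; exact: (semigroup_zero basisHH fI).
- exact: out.
have bE j : j \in sJ -> PBP j = b j by exact: (finite_rank_basis ipH basisUU fI fJ linL).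
have -> : \sum_(j <- sJ) incr W s r j w *: PBP j = z by apply: eq_big_seq => j /bE ->.
have -> : \sum_(j <- sJ) incr W s r j w *: S (1 *: PBP j) = S z.
  rewrite /S semigroup_sum; first by apply: eq_big_seq => j /bE ->; rewrite scale1r.
  by move=> j; exact: (proj_b basisHH fI).
have zE : proj ipH sI z = z by exact: proj_comb_b.
rewrite addrA [X + _ + _]addrC /S /tame (semigroupP basisHH fI) // 1?addrC //.
by rewrite projD projZ XE fE.
Qed.

Lemma scheme_out : ~ D X -> Yr = S X.
Proof.
move=> DX; rewrite YE indicE memNset //= mul0r scale0r addr0.
rewrite [X in _ *: X]/elementary_ito fsbig1 ?scaler0 ?addr0 // => u _.
by rewrite scale0r /S (semigroup_zero basisHH fI) scaler0.
Qed.

End scheme.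

(** * Riemann sums and time grids *)

Section uniform_continuity.
Context (R : realType).
Notation mu := (@lebesgue_measure R).

(** Only x is confined to the segment; y may leave it, as f is continuous on the whole line. The
    radius comes from the covering form of compactness. *)
Lemma uniform_continuous_segment (f : R -> R) (a b e : R) : continuous f -> 0 < e ->
  exists2 q, 0 < q & forall x y, `[a, b]%classic x -> `|x - y| < q -> `|f x - f y| <= e.
Proof.
move=> cf e0; have /compact_near_coveringP cov := @segment_compact R a b.
have [|q /= q0 hq] := cov R (0^'+)%classic (fun q x => forall y, `|x - y| < q -> `|f x - f y| <= e) _.
  move=> x _; have e2 : 0 < e / 2 by rewrite divr_gt0.
  have /cvgrPdist_lt /(_ _ e2) [r /= r0 hr] := cf x.
  exists ([set x' | `|x - x'| < r / 2], [set q | q < r / 2]).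
    split => /=; first by exists (r / 2) => //=; rewrite divr_gt0.
    by apply: nbhs_right_lt; rewrite divr_gt0.
  move=> [x' q] /= [xx' qr] y x'y.
  have h1 : `|f x - f x'| < e / 2 by apply: hr => /=; lra.
  have h2 : `|f x - f y| < e / 2.
    apply: hr => /=; rewrite (_ : x - y = (x - x') + (x' - y)); last by ring.
    by apply: le_lt_trans (ler_normD _ _) _; lra.
  rewrite (_ : f x' - f y = (f x - f y) - (f x - f x')); last by ring.
  by apply: le_trans (ler_normB _ _) _; lra.
exists (q / 2); first by rewrite divr_gt0.
move=> x y xab xy; apply: (hq (q / 2)) => //=.
- by rewrite sub0r normrN gtr0_norm ?divr_gt0 //; lra.
- by rewrite divr_gt0.
Qed.

Lemma continuous_integrable (f : R -> R) (a b : R) : continuous f ->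
  mu.-integrable `[a, b] (EFin \o f).
Proof.
move=> cf; apply: continuous_compact_integrable; first exact: segment_compact.
by apply: continuous_subspaceT => x; exact: cf.
Qed.

Let cell (f : R -> R) (x de e : R) : continuous f -> 0 < de ->
  (forall y, x <= y <= x + de -> `|f (x + de) - f y| <= e) ->
  `|\int[mu]_(u in `]x, x + de]) f u - de * f (x + de)| <= de * e.
Proof.
move=> cf d0 fe; set v := f (x + de).
have sub : `]x, x + de] `<=` `[x, x + de].
  by move=> y /=; rewrite !in_itv /= => /andP[/ltW -> ->].
have fin (k : R) : \int[mu]_(u in `]x, x + de]) k = de * k.
  rewrite Rintegral_cst //= lebesgue_measure_itv /= lte_fin ltrDl d0 /= mulrC.
  by congr (_ * _); ring.
have If : mu.-integrable `]x, x + de] (EFin \o f).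
  by apply: integrableS (continuous_integrable x (x + de) cf).
have Ic (k : R) : mu.-integrable `]x, x + de] (EFin \o (fun _ : R => k)).
  have ck : continuous (fun _ : R => k) by move=> y; exact: cst_continuous.
  by apply: integrableS (continuous_integrable x (x + de) ck).
rewrite ler_distl -mulrBr -mulrDr -!fin; apply/andP; split; apply: le_Rintegral => //.
  move=> y; rewrite /= in_itv /= => /andP[/ltW xy yx].
  by have := fe y; rewrite xy yx => /(_ isT); rewrite ler_distl -/v => /andP[]; lra.
move=> y; rewrite /= in_itv /= => /andP[/ltW xy yx].
by have := fe y; rewrite xy yx => /(_ isT); rewrite ler_distl -/v => /andP[]; lra.
Qed.

Let riemann_bound (f : R -> R) (a de e : R) (N : nat) : continuous f -> 0 < de ->
  (forall x y, a <= x <= a + N%:R * de -> `|x - y| <= de -> `|f x - f y| <= e) ->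
  `|\int[mu]_(u in `[a, a + N%:R * de]) f u - de * \sum_(i < N) f (a + i.+1%:R * de)|
     <= N%:R * de * e.
Proof.
move=> cf d0; elim: N => [|N IH] fe.
  by rewrite big_ord0 mul0r addr0 set_itv1 Rintegral_set1 mulr0 subrr normr0 !mul0r.
have Nd : 0 <= N%:R * de by rewrite mulr_ge0 // ltW.
have NE : a + N.+1%:R * de = a + N%:R * de + de by rewrite -natr1; ring.
have := Rintegral_itvB (continuous_integrable a (a + N.+1%:R * de) cf) (x := a + N%:R * de).
rewrite !bnd_simp lerDl Nd NE lerDl (ltW d0) => /(_ isT isT) /eqP; rewrite subr_eq => /eqP ->.
rewrite big_ord_recr /= mulrDr NE.
set I1 := Rintegral _ _ _; set I2 := Rintegral _ _ _; set S := \sum_(i < N) _.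
have -> : I1 + I2 - (de * S + de * f (a + N%:R * de + de)) =
  (I2 - de * S) + (I1 - de * f (a + N%:R * de + de)) by ring.
apply: le_trans (ler_normD _ _) _.
have -> : N.+1%:R * de * e = N%:R * de * e + de * e by rewrite -natr1; ring.
apply: lerD; last first.
  apply: cell => // y /andP[xy yx]; apply: fe.
    by rewrite NE lexx andbT -addrA lerDl addr_ge0 // ltW.
  by rewrite ger0_norm; lra.
apply: IH => x y /andP[ax xa]; apply: fe; rewrite ax /= NE (le_trans xa) //.
by rewrite lerDl ltW.
Qed.

Lemma riemann_cvg (f : R -> R) (a b : R) : a < b -> continuous f ->
  (b - a) / n.+1%:R * (\sum_(i < n.+1) f (a + i.+1%:R * ((b - a) / n.+1%:R)))
    @[n --> \oo] --> \int[mu]_(u in `[a, b]) f u.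
Proof.
move=> ab cf; have ba : 0 < b - a by rewrite subr_gt0.
apply/cvgrPdist_le => e e0.
have [q q0 hq] := uniform_continuous_segment a b cf (divr_gt0 e0 ba).
near=> n; have n0 : 0 < n.+1%:R :> R by [].
pose de := (b - a) / n.+1%:R; have de0 : 0 < de by rewrite divr_gt0.
have deq : de < q.
  rewrite ltr_pdivrMr // -ltr_pdivrMl //.
  apply: (@lt_trans _ _ n%:R); last by rewrite ltr_nat.
  near: n; exact: nbhs_infty_gtr.
have bE : a + n.+1%:R * de = b by rewrite /de mulrCA divff ?gt_eqF // mulr1 addrC subrK.
have := @riemann_bound f a de (e / (b - a)) n.+1 cf de0; rewrite bE => h.
apply: le_trans (h _) _; last first.
  have -> : n.+1%:R * de = b - a by rewrite /de mulrCA divff ?gt_eqF // mulr1.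
  by rewrite mulrCA divff ?gt_eqF // mulr1.
move=> x y xab xy; apply: hq; first by rewrite /= in_itv.
exact: le_lt_trans deq.
Unshelve. all: by end_near.
Qed.

(** Extends a path to the whole line by freezing it outside [[a, b]], so that the Riemann sum
    estimates apply to it. *)
Lemma continuous_clamp (Z : topologicalType) (f : R -> Z) (a b : R) : a <= b ->
  {within `[a, b], continuous f} -> continuous (fun u => f (Num.max a (Num.min b u))).
Proof.
move=> ab /subspace_continuousP cf u; set cl := fun u : R => Num.max a (Num.min b u).
have clI v : `[a, b]%classic (cl v).
  by rewrite /= in_itv /= /cl le_max lexx /= ge_max ab ge_min lexx.
have ccl : continuous cl.
  move=> v; apply: continuous_max; first exact: cst_continuous.
  by apply: continuous_min; [exact: cst_continuous|exact: cvg_id].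
move=> A nA; have h : nbhs u (fun v => `[a, b]%classic (cl v) -> A (f (cl v))).
  exact: ccl u _ (cf _ (clI u) A nA).
change (nbhs u (fun v => A (f (cl v)))).
by apply: filterS h => v; apply; exact: clI.
Qed.

End uniform_continuity.

Section grids.
Context (R : realType).

Lemma finite_set_max (A : set R) : finite_set A -> A !=set0 ->
  exists2 m, A m & forall x, A x -> x <= m.
Proof.
move=> /finite_seqP[l ->{A}] [x /= xl].
suff [m ml hm] : exists2 m, m \in l & forall y, y \in l -> y <= m by exists m.
elim: l x xl => [|y [|z l] IH] x xl //.
  by exists y => [|z]; rewrite mem_seq1 // => /eqP ->.
have [m ml hm] := IH z (mem_head _ _).
have [my|ym] := leP m y.
  exists y; first exact: mem_head.
  by move=> u; rewrite inE => /predU1P[->|/hm um] //; exact: le_trans my.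
exists m; first by rewrite inE ml orbT.
by move=> u; rewrite inE => /predU1P[->|/hm um] //; exact: ltW.
Qed.

Lemma finite_set_min (A : set R) : finite_set A -> A !=set0 ->
  exists2 m, A m & forall x, A x -> m <= x.
Proof.
move=> fA [x Ax]; have [||m [y Ay <-] hm] := @finite_set_max (-%R @` A).
- exact: finite_image.
- by exists (- x), x.
by exists y => // z Az; rewrite -lerN2; apply: hm; exists z.
Qed.

Lemma sup_max (A : set R) m : A m -> (forall x, A x -> x <= m) -> sup A = m.
Proof.
move=> Am hm; apply/eqP; rewrite eq_le; apply/andP; split.
  by apply: ge_sup; [exists m|move=> x; exact: hm].
by apply: ub_le_sup => //; exists m => x; exact: hm.
Qed.

Variables (T : R) (th : set R).
Hypotheses (T0 : 0 < T) (gth : grids T th).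

Let th_itv x : th x -> 0 <= x <= T.
Proof. by have [_ h _ _] := gth => /h /=; rewrite in_itv. Qed.

Lemma grid_lfloorP t : 0 < t -> let s := grid_lfloor th t in
  [/\ th s, 0 <= s, s < t & forall x, th x -> x < t -> x <= s].
Proof.
move=> t0 /=; rewrite /grid_lfloor gt_eqF //; have [fth _ th0 _] := gth.
have [||m [/= + thm] hm] := @finite_set_max (`[0, t[ `&` th).
- exact: finite_setIr.
- by exists 0; split => //=; rewrite in_itv /= lexx.
rewrite in_itv /= => /andP[m0 mt].
have mI : (`[0, t[ `&` th) m by split => //=; rewrite in_itv /= m0.
rewrite (sup_max mI hm); split => // x thx xt; apply: hm; split => //=.
by have /andP[x0 _] := th_itv thx; rewrite in_itv /= x0.
Qed.

Lemma grid_lfloor_eq s t r : th s -> (forall x, th x -> x < t -> x <= s) ->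
  s < r <= t -> grid_lfloor th r = s.
Proof.
move=> ths hs /andP[sr rt]; have /andP[s0 _] := th_itv ths.
rewrite /grid_lfloor gt_eqF ?(le_lt_trans s0) //; apply: sup_max.
  by split => //=; rewrite in_itv /= s0.
by move=> x [/=]; rewrite in_itv /= => /andP[_ xr] thx; apply: hs => //; exact: lt_le_trans rt.
Qed.

Lemma grid_floor_eq s t r : th s -> (forall x, th x -> x < t -> x <= s) ->
  s <= r < t -> grid_floor th r = s.
Proof.
move=> ths hs /andP[sr rt]; have /andP[s0 _] := th_itv ths.
rewrite /grid_floor; case: eqP => [r0|_].
  by apply/eqP; rewrite eq_le s0 -r0 sr.
apply: sup_max; first by split => //=; rewrite in_itv /= s0.
by move=> x [/=]; rewrite in_itv /= => /andP[_ xr] thx; apply: hs => //; exact: le_lt_trans rt.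
Qed.

Let gaps := [set l | exists a b, [/\ th a, th b, a < b,
    (forall x, th x -> ~ (a < x < b)) & l = b - a]].

Let gaps_ub l : gaps l -> l <= T.
Proof.
move=> [a [b [/th_itv /andP[a0 _] /th_itv /andP[_ bT] _ _ ->]]].
by rewrite lerBlDr (le_trans bT) // lerDl.
Qed.

(** The first grid point at or after t closes the gap that starts at s and contains []s, t[]. *)
Lemma mesh_ge s t : th s -> s < t <= T -> (forall x, th x -> x < t -> x <= s) -> t - s <= mesh th.
Proof.
move=> ths /andP[st tT] hs; have [fth _ _ thT] := gth.
have [||b [/= tb thb] hb] := @finite_set_min ([set x | t <= x] `&` th).
- exact: finite_setIr.
- by exists T.
have sb : s < b by exact: lt_le_trans tb.
apply: (@le_trans _ _ (b - s)); first by rewrite lerD2r.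
apply: ub_le_sup; first by exists T => l; exact: gaps_ub.
exists s, b; split => // x thx /andP[sx xb].
have [tx|xt] := leP t x; first by have := hb x (conj tx thx); rewrite leNgt xb.
by have := hs x thx xt; rewrite leNgt sx.
Qed.

Lemma mesh_itv : 0 < mesh th <= T.
Proof.
have /= [ths s0 sT hs] := grid_lfloorP T0.
have Ts : T - grid_lfloor th T <= mesh th by apply: mesh_ge => //; rewrite sT lexx.
apply/andP; split; first by apply: lt_le_trans Ts; rewrite subr_gt0.
(* Without a supremum the mesh would take the default value 0, which the lower bound excludes. *)
have [Ax _] : has_sup gaps.
  apply: contrapT => /sup_out h; have : 0 < mesh th by apply: lt_le_trans Ts; rewrite subr_gt0.
  by rewrite /mesh -/gaps h ltxx.
by apply: ge_sup => // l; exact: gaps_ub.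
Qed.

(** The number of grid points before t decreases along [grid_lfloor], also when t is not a grid
    point; it drives the induction. *)
Lemma grid_rank : exists f : R -> nat, forall s t, th s -> s < t -> (f s < f t)%N.
Proof.
have [/finite_fsetP[X thE] _ _ _] := gth.
exists (fun t => size [seq x <- X : seq R | x < t]) => s t ths st.
apply: (@uniq_leq_size _ (s :: [seq x <- X : seq R | x < s])).
  by rewrite /= mem_filter ltxx /= filter_uniq // fset_uniq.
move=> x; rewrite inE !mem_filter => /predU1P[->|/andP[xs xX]].
  by rewrite st /=; move: ths; rewrite thE.
by rewrite xX (lt_trans xs).
Qed.

End grids.

(** * Exponential moments of the scheme *)

Section integrable_union.
Context d (X : measurableType d) (R : realType) (mu : {measure set X -> \bar R}).

Lemma integrable_setU_disjoint (A B : set X) (f : X -> R) :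
  measurable A -> measurable B -> [disjoint A & B] ->
  mu.-integrable A (EFin \o f) -> mu.-integrable B (EFin \o f) ->
  mu.-integrable (A `|` B) (EFin \o f).
Proof.
move=> mA mB AB /integrableP[mfA fA] /integrableP[mfB fB]; apply/integrableP.
have mf : measurable_fun (A `|` B) (EFin \o f) by apply/measurable_funU.
split => //; rewrite ge0_integral_setU //; first by rewrite lte_add_pinfty.
exact: measurableT_comp.
Qed.

End integrable_union.

Section measurable_continuous.
Context d (Om : measurableType d) (R : realType) (G : set (set Om)).
Hypothesis sG : sigma_algebra setT G.
Context (H : normedModType R) (E : set H) (X : Om -> H) (g : H -> R).

Lemma measurable_continuous : random_element G E (@norm_dist R H) X -> continuous g ->
  measurable_fun [set: g_sigma_algebraType G] (fun w : g_sigma_algebraType G => g (X w)).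
Proof.
move=> GX cg; apply: (random_element_measurable sG GX) => x r _ r0.
have /cvgrPdist_lt /(_ _ r0) /nbhs_ballP [q /= q0 hq] := cg x.
exists q => // y _ xy; apply: hq.
by rewrite -ball_normE.
Qed.

End measurable_continuous.

Section exponential_moments.
Context d (Om : measurableType d) (R : realType) (P : probability Om R).
Context (T : R) (FF : R -> set (set Om)) (H U : completeNormedModType R).
Context (ipH : {dot H for idfun}) (ipU : {dot U for idfun}).
Hypotheses (hH : hilbert_norm ipH) (hU : hilbert_norm ipU).
Variables (HH : set H) (UU : set U).
Hypotheses (basisHH : orthonormal_basis ipH HH) (basisUU : orthonormal_basis ipU UU).
Variables (W : R -> U -> Om -> R).
Hypotheses (filtrFF : filtration T FF) (wienerW : cylindrical_wiener P T FF ipU W).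
Variables (lam : H -> R) (gamma : R) (F : H -> H) (B : H -> U -> H).
Local Notation interpH := (interp ipH HH lam gamma).
Local Notation distH := (interp_dist ipH HH lam gamma).
Hypothesis B_meas : borel_measurable_on interpH distH (hilbert_schmidt UU) (hs_dist UU) B.
Variables (I : set H) (J : set U) (fI : fsets HH I) (fJ : fsets UU J).
Local Notation sI := (fset_set I : seq H).
Local Notation sJ := (fset_set J : seq U).
Local Notation S := (semigroup ipH HH lam).
Variables (rho c iota : R) (V Vbar : H -> R).
Hypotheses (rho0 : 0 <= rho) (c1 : 1 <= c) (iota1 : 1 <= iota).
Hypothesis VC : Cnc 3 c [set r | 0 <= r] V.
Hypothesis Vbar_cont : continuous Vbar.
Hypothesis V_semigroup : forall (h : R) x, 0 < h <= T -> V (S h x) <= V x.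
Hypothesis Vbar_semigroup : forall (h : R) x, 0 < h <= T -> Vbar (S h x) <= Vbar x.
Hypothesis Vbar_lip : forall x y,
  `|Vbar x - Vbar y| <= c * (1 + `|V x| `^ iota + `|V y| `^ iota) * `|x - y|.
Hypothesis Vbar_growth : forall x, `|Vbar x| <= c * (1 + `|V x| `^ iota).
Local Notation Lr x := (fun u => orthoproj ipH I (B x (orthoproj ipU J u))).
Local Notation span := (orthoproj ipH I @` interpH).
Variables (D : set H) (M C K : R).
Hypothesis D_borel : borel_on interpH distH D.
Hypothesis D_bounds : forall x, D x ->
  Num.max `|orthoproj ipH I (F x)| (hs_norm UU (Lr x)) <= M /\
  generator ipU ipH HH (fun y => orthoproj ipH I (F y)) (fun y => Lr y) V x
    + 2^-1 * `|adjoint ipU ipH (Lr x) (grad ipH V x)| ^+ 2 + Vbar x <= rho * V x.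
Hypotheses (C1 : 1 <= C) (rhoC : rho <= C).

(** * Growth of the exponential moment over one step *)

Section one_step.
Variables (s t : R).
Hypotheses (s0 : 0 <= s) (st : s < t) (tT : t <= T).
Local Notation Dl := (t - s).
Variable eta : R.
Local Notation tau := (M * Num.sqrt Dl).
Local Notation L x := (Llip c V K x).
Local Notation Lb x := (c * (1 + 2 * (L x) `^ iota)).
Hypotheses (M0 : 0 < M) (K1 : Dl * M + 1 <= K).
Hypotheses (tauC : tau <= C) (sqC : Num.sqrt Dl <= C * tau) (DlC : Dl <= C * tau).
Hypothesis D_const : forall x, D x ->
  [/\ L x * tau <= C, Lb x * Dl * tau <= C & step_eta Dl C tau (L x) (Lb x) <= eta].
Hypothesis eta0 : 0 <= eta.
Variable Y : R -> Om -> H.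
Hypothesis Ys : random_element (FF s) span (@norm_dist R H) (Y s).
Hypothesis mVY : forall r, s <= r <= t -> measurable_fun setT (fun w => V (Y r w)).
Hypothesis mVbarY : forall r, s <= r <= t -> measurable_fun setT (fun w => Vbar (Y r w)).
Definition scheme_eq (r : R) (w : Om) : Prop :=
  Y r w = S (r - s) (Y s w + (\1_D (Y s w) * (r - s)) *: orthoproj ipH I (F (Y s w))) +
   (1 + `|elementary_ito UU W (fun w => Lr (Y s w)) s r w| ^+ 2)^-1 *:
     elementary_ito UU W (fun w u => S (r - s) (\1_D (Y s w) *: Lr (Y s w) u)) s r w.
Hypothesis Ystep : forall r, s < r <= t -> {ae P, forall w, scheme_eq r w}.

Let Dl0 : 0 < Dl. Proof. by rewrite subr_gt0. Qed.
Let sT : 0 <= s <= T. Proof. by rewrite s0 (le_trans (ltW st)). Qed.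
Let T1 : measurableType _ := g_sigma_algebraType (FF s).
Let sFF := (filtrFF.1 _ sT).1.
Let uJ : uniq sJ. Proof. exact: fsets_uniq. Qed.
Let uI : uniq sI. Proof. exact: fsets_uniq. Qed.
Let oJ := fsets_on basisUU fJ.
Let oI := fsets_on basisHH fI.

Let XE w : proj ipH sI (Y s w) = Y s w.
Proof. by apply: (spanP basisHH fI); have [+ _] := Ys; apply. Qed.
Let f w := orthoproj ipH I (F (Y s w)).
Let fE w : proj ipH sI (f w) = f w.
Proof.
rewrite /f (orthoprojE ipH fI); apply: projK; first exact: fsets_uniq.
by move=> *; exact: oI.
Qed.
Let linB w : linear (B (Y s w)).
Proof.
have [EX _] := random_element_interp sFF hH basisHH fI Ys.
by have [+ _] := B_meas; move=> /(_ _ (EX w)) [].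
Qed.
Let b w j := proj ipH sI (B (Y s w) j).
Let bE w j : proj ipH sI (b w j) = b w j.
Proof. exact: (proj_b basisHH fI). Qed.
Let zz r w w' := \sum_(j <- sJ) incr W s r j w' *: b w j.
Let zzE r w w' : proj ipH sI (zz r w w') = zz r w w'.
Proof. by rewrite /zz proj_sum; apply: eq_bigr => j _; rewrite projZ bE. Qed.
Let al j w := 'D_(b w j) V (Y s w).
Let m i j w := 'D_(b w i) ('D_(b w j) V) (Y s w).
Let be h j w := ipH h (b w j).

Let linE p w w' : gauss_lin W s t sJ al p w w' = lin_part V sJ (b w) (Y s w) Dl p (zz t w w').
Proof.
rewrite /gauss_lin /lin_part /gen_sq /zz (dV_sum VC); congr (p * _ - _).
by apply: eq_bigr => j _; rewrite mulrC.
Qed.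

Let quadE w w' : gauss_quad W s t sJ m w w' = quad_part V sJ (b w) (Y s w) Dl (zz t w w').
Proof.
rewrite /gauss_quad /quad_part /gen_tr /zz (ddV_suml VC); congr (_ * (_ - _)).
apply: eq_bigr => i _; rewrite (ddV_sumr VC) mulr_sumr.
by apply: eq_bigr => j _; rewrite mulrA.
Qed.

Let normE r w w' : gauss_norm W s r sJ sI be M Dl w w' =
  expR (`|zz r w w'| ^+ 2 / (4 * tau ^+ 2)).
Proof.
rewrite /gauss_norm (norm_proj hH uI oI (zzE r w w')).
have e h : \sum_(j <- sJ) be h j w * incr W s r j w' = ipH h (zz r w w').
  by rewrite /zz ip_sumr; apply: eq_bigr => j _; rewrite ipZr mulrC.
by under eq_bigr do rewrite e.
Qed.

Let be_sum w : \sum_(h <- sI) \sum_(j <- sJ) be h j w ^+ 2 = \sum_(j <- sJ) `|b w j| ^+ 2.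
Proof.
rewrite exchange_big /=; apply: eq_bigr => j _.
by rewrite (norm_proj hH uI oI (bE w j)).
Qed.

Let bM w : D (Y s w) -> \sum_(j <- sJ) `|b w j| ^+ 2 <= M ^+ 2.
Proof.
move=> /D_bounds [+ _]; rewrite ge_max => /andP[_].
rewrite /hs_norm (hs_norm2_finite_rank ipH basisUU fI fJ (linB w)) /= => h.
have n0 : 0 <= \sum_(j <- sJ) `|b w j| ^+ 2 by apply: sumr_ge0 => j _; exact: exprn_ge0.
by rewrite -[leLHS]sqr_sqrtr //; apply: lerXn2r; rewrite ?nnegrE ?sqrtr_ge0 // ltW.
Qed.

Let f_le w : D (Y s w) -> `|f w| <= M.
Proof. by move=> /D_bounds [+ _]; rewrite ge_max => /andP[]. Qed.

Let gen_bound w : D (Y s w) ->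
  'D_(f w) V (Y s w) + 2^-1 * gen_tr V sJ (b w) (Y s w) + 2^-1 * gen_sq V sJ (b w) (Y s w)
    + Vbar (Y s w) <= rho * V (Y s w).
Proof.
move=> /D_bounds [_]; rewrite /generator.
rewrite (trace_finite_rank hH hU basisHH basisUU fI fJ (linB w) c1 VC).
rewrite (adjoint_grad_norm hH hU basisUU fI fJ (linB w) c1 VC).
by rewrite ipC (grad_ip hH c1 VC).
Qed.

Let p := expR (- (rho * t)).
Let q := expR (- (rho * s)).
Let p01 : 0 <= p <= 1.
Proof.
rewrite expR_ge0 -expR0 ler_expR oppr_le0 mulr_ge0 // (le_trans s0) // ltW //.
Qed.

(** Carries [2 * eta] because this is the multiple for which [step_majorant_ge0] gives nonnegativity
    at every pair of sample points. *)
Definition step_maj w w' := expR (gauss_lin W s t sJ al p w w') +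
  p * gauss_quad W s t sJ m w w' + 2 * eta * gauss_norm W s t sJ sI be M Dl w w'.

Let step_maj_ge0 w w' : D (Y s w) -> 0 <= step_maj w w'.
Proof.
move=> DX; have fM := f_le DX; have [nuC muC etaC] := D_const DX.
have := step_majorant_ge0 c1 VC Dl0 M0 K1 fM (bM DX) erefl erefl erefl C1 tauC nuC muC sqC
  (zz t w w') p01.
rewrite /step_maj linE quadE normE => /le_trans; apply.
by rewrite lerD2l ler_wpM2r ?expR_ge0 // ler_wpM2l.
Qed.

Let V_at r w : s < r <= t -> scheme_eq r w -> D (Y s w) ->
  V (Y r w) <= V (Y s w + ((r - s) *: f w + tame (zz r w w))) /\
  Vbar (Y r w) <= Vbar (Y s w + ((r - s) *: f w + tame (zz r w w))).
Proof.
move=> /andP[sr rt] YE DX.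
have rsT : 0 < r - s <= T.
  by rewrite subr_gt0 sr lerBlDr (le_trans rt) // (le_trans tT) // lerDl.
rewrite (scheme_in basisHH basisUU fI fJ (linB w) (XE w) (fE w) YE DX).
by split; [exact: V_semigroup|exact: Vbar_semigroup].
Qed.

Let V_out w : scheme_eq t w -> ~ D (Y s w) -> V (Y t w) <= V (Y s w).
Proof.
move=> YE DX.
rewrite (scheme_out basisHH fI (ipU := ipU) (J := J) (f := f w) (L := B (Y s w)) YE DX).
apply: V_semigroup.
by rewrite Dl0 lerBlDr (le_trans tT) // lerDl.
Qed.

Let point_in r w : s < r <= t -> scheme_eq t w -> scheme_eq r w -> D (Y s w) ->
  expR (p * V (Y t w) + Dl * (expR (- (rho * r)) * Vbar (Y r w))) <=
  expR (q * V (Y s w)) * (step_maj w w + eta * gauss_norm W s r sJ sI be M Dl w w).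
Proof.
move=> rt Et Er DX; have fM := f_le DX; have [nuC muC etaC] := D_const DX.
have tt : s < t <= t by rewrite st lexx.
have [Vt _] := V_at tt Et DX; have [_ Vr] := V_at rt Er DX.
have rho0C : 0 <= rho <= C by rewrite rho0.
have rt' : s <= r <= t by case/andP: rt => /ltW -> ->.
have := step_pointwise c1 iota1 VC Vbar_lip Vbar_growth Dl0 M0 K1 fM (bM DX) erefl erefl erefl
  C1 tauC nuC muC sqC DlC rho0C erefl s0 rt' (gen_bound DX) Vt Vr.
move=> /= /le_trans; apply; apply: ler_wpM2l; first exact: expR_ge0.
rewrite /step_maj linE quadE !normE -/p.
move: (expR (`|zz t w w| ^+ 2 / _)) (expR (`|zz r w w| ^+ 2 / _)) (expR_ge0 (`|zz t w w| ^+ 2 / (4 * tau ^+ 2)))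
  (expR_ge0 (`|zz r w w| ^+ 2 / (4 * tau ^+ 2))) => e1 e2 e10 e20.
move: (expR (lin_part _ _ _ _ _ _ _)) (p * quad_part _ _ _ _ _ _) (step_eta _ _ _ _ _) etaC => x1 x2 x3 etaC.
apply: (@le_trans _ _ (x1 + x2 + eta * (e1 + e2))).
  by rewrite lerD2l ler_wpM2r // addr_ge0.
have : 0 <= eta * e1 by rewrite mulr_ge0.
by rewrite mulrDr -mulrA; move: (eta * e1) (eta * e2) => *; lra.
Qed.


Let sub_m (g : Om -> R) : measurable_fun [set: T1] (g : T1 -> R) -> measurable_fun [set: Om] g.
Proof. exact: (measurable_filtration filtrFF sT). Qed.

Let inUU j : j \in sJ -> UU j.
Proof. by rewrite (mem_fsets fJ) inE; case: fJ => _; apply. Qed.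

Let mBh h j : j \in sJ -> measurable_fun [set: T1] ((fun w => ipH h (B (Y s w) j)) : T1 -> R).
Proof. by move=> /inUU; exact: (measurable_B_coord sFF hH basisHH fI Ys B_meas h). Qed.

Let mbe h j : h \in sI -> j \in sJ -> measurable_fun [set: T1] (be h j : T1 -> R).
Proof.
move=> hs js; have -> : be h j = fun w => ipH h (B (Y s w) j).
  by apply/funext => w; rewrite /be /b ip_proj.
exact: mBh.
Qed.

Let mal j : j \in sJ -> measurable_fun [set: T1] (al j : T1 -> R).
Proof.
move=> js; have -> : al j = fun w => \sum_(h <- sI) ipH h (B (Y s w) j) * 'D_h V (Y s w).
  by apply/funext => w; rewrite /al /b /proj (dV_sum VC).
apply: measurable_sum => h; apply: measurable_funM; first exact: mBh.
exact: (measurable_dV sFF Ys c1 VC).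
Qed.

Let mm i j : i \in sJ -> j \in sJ -> measurable_fun [set: T1] (m i j : T1 -> R).
Proof.
move=> is_ js; have -> : m i j = fun w => \sum_(h <- sI) ipH h (B (Y s w) i) *
    (\sum_(k <- sI) ipH k (B (Y s w) j) * 'D_h ('D_k V) (Y s w)).
  apply/funext => w; rewrite /m /b {1}/proj (ddV_suml VC).
  by apply: eq_bigr => h _; rewrite /proj (ddV_sumr VC).
apply: measurable_sum => h; apply: measurable_funM; first exact: mBh.
apply: measurable_sum => k; apply: measurable_funM; first exact: mBh.
exact: (measurable_ddV sFF Ys c1 VC).
Qed.

Let mmaj : measurable_fun [set: Om] (fun w => step_maj w w).
Proof. rewrite /step_maj; exact: (measurable_gauss_majorant filtrFF wienerW s0 st tT mal mm mbe M Dl p eta). Qed.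

Variables (Q : Om -> R) (N : nat) (r_ : 'I_N -> R).
Hypotheses (mQ : measurable_fun [set: T1] (Q : T1 -> R)) (Q0 : forall w, 0 <= Q w).
Hypotheses (N0 : (0 < N)%N) (rst : forall i, s < r_ i <= t).

Let G w := Q w * expR (q * V (Y s w)).
(** The weight is split by whether [Y s] lies in D: the one-step estimate acts on [K0], while on
    [Kc] the scheme only applies the semigroup. *)
Let K0 w := G w * \1_D (Y s w).
Let Kc w := G w * (1 - \1_D (Y s w)).
Let gn i w := gauss_norm W s (r_ i) sJ sI be M Dl w w.

Let G0 w : 0 <= G w. Proof. by rewrite mulr_ge0 // expR_ge0. Qed.
Let ind0 w : 0 <= \1_D (Y s w) :> R. Proof. by rewrite indicE. Qed.
Let ind1 w : 0 <= 1 - \1_D (Y s w) :> R. Proof. by rewrite subr_ge0 indicE lern1; case: (_ \in _). Qed.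
Let K00 w : 0 <= K0 w. Proof. by rewrite mulr_ge0. Qed.
Let Kc0 w : 0 <= Kc w. Proof. by rewrite mulr_ge0. Qed.
Let K0D w : K0 w != 0 -> D (Y s w).
Proof. by rewrite /K0 indicE; case: (boolP (_ \in D)); rewrite ?inE // mulr0 eqxx. Qed.

Let mind : measurable_fun [set: T1] ((fun w => \1_D (Y s w)) : T1 -> R).
Proof.
by apply: (random_element_indic sFF (random_element_interp sFF hH basisHH fI Ys)).
Qed.
Let mG : measurable_fun [set: T1] (G : T1 -> R).
Proof.
apply: measurable_funM => //; apply: measurableT_comp => //; apply: measurable_funM => //.
exact: (measurable_V sFF Ys c1 VC).
Qed.
Let mK0 : measurable_fun [set: T1] (K0 : T1 -> R).
Proof. exact: measurable_funM. Qed.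
Let mKc : measurable_fun [set: T1] (Kc : T1 -> R).
Proof. by apply: measurable_funM => //; apply: measurable_funB. Qed.

Let mgn i : measurable_fun [set: Om] (gn i).
Proof.
have /andP[sr rt] := rst i.
rewrite /gn; exact: (measurable_gauss_norm filtrFF wienerW s0 sr (le_trans rt tT) mbe M Dl).
Qed.

(** The time integral over the step enters as a mean over N nodes, and the indicator is already
    frozen at s. *)
Definition step_exponent (w : Om) : R :=
  expR (- (rho * t)) * V (Y t w) + \1_D (Y s w) *
    (Dl / N%:R * \sum_(i < N) expR (- (rho * r_ i)) * Vbar (Y (r_ i) w)).

(** On D the exponent is the mean over the nodes r of [p V(Y_t) + Dl e^(-rho r) Vbar(Y_r)], so
    convexity of the exponential reduces the claim to a single node. *)
Let point w : scheme_eq t w -> (forall i, scheme_eq (r_ i) w) ->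
  Q w * expR (step_exponent w) <=
  K0 w * step_maj w w + \sum_(i < N) eta / N%:R * (K0 w * gn i w) + Kc w.
Proof.
move=> Et Er; have NR : N%:R != 0 :> R by rewrite pnatr_eq0 -lt0n.
rewrite /step_exponent /K0 /Kc /G indicE; case: (boolP (_ \in D)); rewrite ?inE ?notin_setE => DX; last first.
  rewrite /= mul0r addr0 mulr0 mul0r subr0 mulr1 big1 ?add0r; last first.
    by move=> i _; rewrite mul0r mulr0.
  apply: ler_wpM2l => //; rewrite ler_expR -/p.
  apply: (@le_trans _ _ (p * V (Y s w))).
    by apply: ler_wpM2l; [exact: expR_ge0|exact: V_out].
  apply: ler_wpM2r; first exact: (V_ge0 VC).
  by rewrite ler_expR lerN2 ler_wpM2l // ltW.
rewrite /= !mulr1 mul1r subrr mulr0 addr0 -/p.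
have S1 : \sum_(i < N) N%:R^-1 = 1 :> R.
  by rewrite sumr_const card_ord -[LHS]mulr_natr mulVf.
pose e i := p * V (Y t w) + Dl * (expR (- (rho * r_ i)) * Vbar (Y (r_ i) w)).
have -> : p * V (Y t w) + Dl / N%:R * \sum_(i < N) expR (- (rho * r_ i)) * Vbar (Y (r_ i) w) =
    \sum_(i < N) N%:R^-1 * e i.
  under [RHS]eq_bigr do rewrite mulrDr.
  rewrite big_split /= -mulr_suml S1 mul1r; congr (_ + _).
  by rewrite mulr_sumr; apply: eq_bigr => i _; rewrite mulrAC mulrC mulrCA mulrA.
have -> : Q w * expR (q * V (Y s w)) * step_maj w w +
    \sum_(i < N) eta / N%:R * (Q w * expR (q * V (Y s w)) * gn i w) =
  Q w * (\sum_(i < N) N%:R^-1 * (expR (q * V (Y s w)) * (step_maj w w + eta * gn i w))).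
  under [X in _ = Q w * X]eq_bigr do rewrite [expR _ * _]mulrDr mulrDr.
  rewrite big_split /= -mulr_suml S1 mul1r [RHS]mulrDr [in RHS]mulrA; congr (_ + _).
  rewrite mulr_sumr; apply: eq_bigr => i _.
  by move: (N%:R^-1) (gn i w) (expR _) => *; ring.
apply: ler_wpM2l => //.
apply: le_trans (expR_convex _ _ _) _; first by move=> i; rewrite invr_ge0.
  by rewrite S1.
have -> : 1 + \sum_(i < N) N%:R^-1 * (expR (e i) - 1) = \sum_(i < N) N%:R^-1 * expR (e i).
  under eq_bigr do rewrite mulrBr mulr1.
  by rewrite sumrB S1 addrC subrK.
apply: ler_sum => i _; apply: ler_wpM2l; first by rewrite invr_ge0.
exact: point_in.
Qed.

Local Open Scope ereal_scope.

Lemma one_step :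
  \int[P]_w (Q w * expR (step_exponent w))%:E <=
  (1 + 6 * eta)%:E * \int[P]_w (Q w * expR (expR (- (rho * s)) * V (Y s w)))%:E.
Proof.
have en : (0 <= eta / N%:R)%R by rewrite divr_ge0.
have gn0 i w : (0 <= gn i w)%R by rewrite expR_ge0.
have maj0 w : (0 <= K0 w * step_maj w w)%R.
  by have [->|/K0D DX] := eqVneq (K0 w) 0%R; rewrite ?mul0r // mulr_ge0 // step_maj_ge0.
have sum0 w : (0 <= \sum_(i < N) eta / N%:R * (K0 w * gn i w))%R.
  by apply: sumr_ge0 => i _; rewrite !mulr_ge0.
have mE (g : Om -> R) : measurable_fun [set: Om] g -> measurable_fun [set: Om] (fun w => (g w)%:E).
  by move=> ?; exact/measurable_EFinP.
have mK0' := sub_m mK0; have mKc' := sub_m mKc; have mG' := sub_m mG.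
have mM : measurable_fun [set: Om] (fun w => K0 w * step_maj w w)%R by exact: measurable_funM.
have mg i : measurable_fun [set: Om] (fun w => K0 w * gn i w)%R by exact: measurable_funM.
have mS : measurable_fun [set: Om] (fun w => \sum_(i < N) eta / N%:R * (K0 w * gn i w))%R.
  by apply: measurable_sum => i; exact: measurable_funM.
have tt : (s <= t <= t)%R by rewrite lexx andbT ltW.
have ss : (s <= s <= t)%R by rewrite lexx ltW.
apply: (@le_trans _ _ (\int[P]_w ((K0 w * step_maj w w)%:E +
    (\sum_(i < N) eta / N%:R * (K0 w * gn i w))%R%:E + (Kc w)%:E))).
  apply: ae_ge0_le_integral => //.
  - by move=> w _; rewrite lee_fin mulr_ge0 // expR_ge0.
  - apply: mE; apply: measurable_funM; first exact: sub_m.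
    apply: measurableT_comp => //; apply: measurable_funD.
      by apply: measurable_funM => //; exact: mVY.
    apply: measurable_funM; first exact: sub_m mind.
    apply: measurable_funM => //; apply: measurable_sum => i; apply: measurable_funM => //.
    by apply: mVbarY; have /andP[/ltW -> ->] := rst i.
  - by move=> w _; rewrite !adde_ge0 // lee_fin.
  - by apply: emeasurable_funD; [apply: emeasurable_funD|]; exact: mE.
  (* The exceptional null set depends on the node, and there are finitely many nodes. *)
  have Er : {ae P, forall w, forall i : 'I_N, scheme_eq (r_ i) w}.
    apply: (filter_forall (F := almost_everywhere P)) => i; exact: Ystep.
  have Et : {ae P, forall w, scheme_eq t w} by apply: Ystep; rewrite st lexx.
  apply: filterS2 Et Er => w Et Er _; rewrite -!EFinD lee_fin; exact: point.
rewrite ge0_integralD //; last 4 first.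
- by move=> w _; rewrite !adde_ge0 // lee_fin.
- by apply: emeasurable_funD; exact: mE.
- by move=> w _; rewrite lee_fin.
- exact: mE.
rewrite ge0_integralD //; last 4 first.
- by move=> w _; rewrite lee_fin.
- exact: mE.
- by move=> w _; rewrite lee_fin.
- exact: mE.
have KM w : K0 w != 0%R -> (\sum_(h <- sI) \sum_(j <- sJ) be h j w ^+ 2 <= M ^+ 2)%R.
  by move=> /K0D DX; rewrite be_sum; exact: bM.
have I1 := integral_gauss_majorant hU filtrFF wienerW s0 st tT uJ oJ mK0 mal mm mbe K00 M0
  (lexx Dl) KM p01 eta0 (fun w w' Kw => step_maj_ge0 w' (K0D Kw)).
have I2 : \int[P]_w (\sum_(i < N) eta / N%:R * (K0 w * gn i w))%R%:E <= (2 * eta)%:E * \int[P]_w (K0 w)%:E.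
  under eq_integral do rewrite -sumEFin.
  rewrite ge0_integral_sum //; last 2 first.
  - by move=> i; apply: mE; exact: measurable_funM.
  - by move=> i w _; rewrite lee_fin !mulr_ge0.
  apply: (@le_trans _ _ (\sum_(i < N) ((eta / N%:R)%:E * (2%:E * \int[P]_w (K0 w)%:E)))).
    apply: lee_sum => i _; under eq_integral do rewrite EFinM.
    rewrite ge0_integral_scale //; last 2 first.
    - exact: mE.
    - by move=> w; rewrite lee_fin mulr_ge0.
    apply: lee_wpmul2l; first by rewrite lee_fin.
    have /andP[sr rt] := rst i.
    apply: (integral_gauss_norm hU filtrFF wienerW s0 sr (le_trans rt tT) uJ oJ mK0 mbe K00 M0 _ KM).
    by rewrite lerD2r.
  rewrite -ge0_sume_distrl; last by move=> i _; rewrite lee_fin.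
  rewrite muleA sumEFin sumr_const card_ord -EFinM lee_wpmul2r //.
    by apply: integral_ge0 => w _; rewrite lee_fin.
  rewrite lee_fin -[X in (X * 2 <= _)%R]mulr_natr divfK ?pnatr_eq0 -?lt0n // mulrC //.
apply: (@le_trans _ _ ((1 + 6 * eta)%:E * \int[P]_w (K0 w)%:E + \int[P]_w (Kc w)%:E)).
  apply: leeD2r; have -> : (1 + 6 * eta = (1 + 4 * eta) + 2 * eta)%R by ring.
  rewrite EFinD ge0_muleDl ?lee_fin ?addr_ge0 ?mulr_ge0 //.
  by apply: leeD.
have -> : \int[P]_w (Q w * expR (expR (- (rho * s)) * V (Y s w)))%:E =
    \int[P]_w (K0 w)%:E + \int[P]_w (Kc w)%:E.
  rewrite -ge0_integralD //; last 4 first.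
  - by move=> w _; rewrite lee_fin.
  - exact: mE.
  - by move=> w _; rewrite lee_fin.
  - exact: mE.
  by apply: eq_integral => w _; rewrite -EFinD /K0 /Kc -mulrDr addrC subrK mulr1.
have IK : 0 <= \int[P]_w (K0 w)%:E by apply: integral_ge0 => w _; rewrite lee_fin.
have IKc : 0 <= \int[P]_w (Kc w)%:E by apply: integral_ge0 => w _; rewrite lee_fin.
rewrite (ge0_muleDr _ IK IKc); apply: leeD2l.
rewrite -[leLHS]mul1e; apply: lee_wpmul2r => //.
by rewrite lee_fin lerDl mulr_ge0.
Qed.

End one_step.

(** * Induction over the grid points and Fatou's lemma *)

Section induction.
Variables (th : set R) (T0 : 0 < T) (gth : grids T th).
Variables (omh vb : R).
Hypothesis D_V : forall x, D x -> V x <= vb.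
Hypotheses (vb0 : 0 <= vb) (omh0 : 0 <= omh).
Hypothesis const : forall Dl v, 0 < Dl <= mesh th -> 0 <= v <= vb ->
  let tau := M * Num.sqrt Dl in
  let L := c * (Lgrow c K * (1 + v)) in
  let Lbar := c * (1 + 2 * L `^ iota) in
  [/\ 0 < M, Dl * M + 1 <= K, tau <= C, L * tau <= C &
   [/\ Lbar * Dl * tau <= C, Num.sqrt Dl <= C * tau, Dl <= C * tau &
      absorb_const (4 * C ^+ 6) * (L ^+ 2 * tau ^+ 3 + Lbar * Dl * tau) <= Dl * omh]].
Variable Y : R -> Om -> H.
Hypothesis Yad : forall t, 0 <= t <= T -> random_element (FF t) span (@norm_dist R H) (Y t).
Hypothesis Ycont : forall w, {within `[0, T], continuous (fun t => Y t w)}.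
Hypothesis Ystep : forall t, 0 < t <= T ->
  {ae P, forall w, scheme_eq (grid_lfloor th t) Y t w}.

Local Notation mu := (@lebesgue_measure R).
Let E0 := (\int[P]_w (expR (V (Y 0 w)))%:E)%E.
Let g w u := \1_D (Y (grid_floor th u) w) * (Vbar (Y u w) / expR (rho * u)).
Let psi w u := expR (- (rho * u)) * Vbar (Y (Num.max 0 (Num.min T u)) w).

Let psi_cont w : continuous (psi w).
Proof.
move=> u; apply: cvgM.
  by apply: continuous_comp; [apply: cvgN; apply: cvgMr; exact: cvg_id|exact: continuous_expR].
have ccl := continuous_clamp (Z := H) (f := fun t => Y t w) (ltW T0) (@Ycont w).
exact: (continuous_comp (ccl u) (@Vbar_cont _)).
Qed.

Let psiE w u : 0 <= u <= T -> psi w u = Vbar (Y u w) / expR (rho * u).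
Proof.
by move=> /andP[u0 uT]; rewrite /psi (min_idPr uT) (max_idPr u0) expRN mulrC.
Qed.

Let mY t : 0 <= t <= T ->
  measurable_fun [set: g_sigma_algebraType (FF t)] (fun w : g_sigma_algebraType (FF t) => V (Y t w)).
Proof. move=> tT; exact: (measurable_V (filtrFF.1 _ tT).1 (Yad tT) c1 VC). Qed.

Let mYbar t : 0 <= t <= T ->
  measurable_fun [set: g_sigma_algebraType (FF t)] (fun w : g_sigma_algebraType (FF t) => Vbar (Y t w)).
Proof.
move=> tT; exact: (measurable_continuous (filtrFF.1 _ tT).1 (Yad tT) Vbar_cont).
Qed.

(* [Rn] are Riemann sums of the time integral with nodes inside the grid cells;
   the bound holds for each of them, so that Fatou is needed only once. *)
Lemma scheme_claim t : 0 <= t <= T -> exists Rn : nat -> Om -> R,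
  [/\ forall n, measurable_fun [set: g_sigma_algebraType (FF t)] (Rn n : g_sigma_algebraType (FF t) -> R),
      forall w, mu.-integrable `[0, t[ (EFin \o g w),
      forall w, Rn n w @[n --> \oo] --> \int[mu]_(u in `[0, t[) g w u
    & forall n, (\int[P]_w (expR (expR (- (rho * t)) * V (Y t w) + Rn n w))%:E
         <= (expR (6 * (t * omh)))%:E * E0)%E].
Proof.
have [f hf] := grid_rank gth.
(* Induction on a bound k for the number of grid points before t, with t arbitrary in [[0, T]]. *)
move: {2}(f t).+1 (ltnSn (f t)) => k; elim: k t => // k IH t ftk tT.
have /andP[t0 tT'] := tT.
have [t00|tn0] := eqVneq t 0.
  exists (fun _ _ => 0); split.
  - by move=> n; exact: measurable_cst.
  - by move=> w; rewrite t00 set_itvco0; exact: integrable_set0.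
  - by move=> w; rewrite t00 set_itvco0 Rintegral_set0; exact: cvg_cst.
  - move=> n; rewrite t00 mul0r mulr0 expR0 mul1e.
    by under eq_integral do rewrite mulr0 oppr0 expR0 mul1r addr0.
have {}t0 : 0 < t by rewrite lt_neqAle eq_sym tn0.
have /= [ths s0 st hs] := grid_lfloorP gth t0.
set s := grid_lfloor th t in ths s0 st hs.
have sT : 0 <= s <= T by rewrite s0 (le_trans (ltW st)).
have [Rn [mR iR cR bR]] : _ := IH s (leq_trans (hf _ _ ths st) ftk) sT.
pose Dl := t - s; have Dl0 : 0 < Dl by rewrite subr_gt0.
(* Right end points of [n + 1] equal subintervals: they lie in []s, t]], where the step equation is
   available, and avoid s. *)
pose r_ n (i : 'I_n.+1) := s + i.+1%:R * (Dl / n.+1%:R).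
have rst n i : s < r_ n i <= t.
  rewrite /r_ ltrDl mulr_gt0 ?divr_gt0 //= -lerBrDl -/Dl mulrCA ler_piMr ?(ltW Dl0) //.
  by rewrite ler_pdivrMr // mul1r ler_nat.
have rT n i : 0 <= r_ n i <= T.
  by have /andP[h1 h2] := rst n i; rewrite (le_trans s0 (ltW h1)) (le_trans h2).
pose A n w := \1_D (Y s w) * (Dl / n.+1%:R * \sum_(i < n.+1) expR (- (rho * r_ n i)) * Vbar (Y (r_ n i) w)).
exists (fun n w => Rn n w + A n w).
have mA n : measurable_fun [set: g_sigma_algebraType (FF t)] (A n : g_sigma_algebraType (FF t) -> R).
  apply: measurable_funM.
    apply: (measurable_filtrationS filtrFF s0 (ltW st) tT').
    apply: (random_element_indic (filtrFF.1 _ sT).1 _ D_borel).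
    exact: (random_element_interp (filtrFF.1 _ sT).1 hH basisHH fI (Yad sT)).
  apply: measurable_funM => //; apply: measurable_sum => i; apply: measurable_funM => //.
  have /andP[/ltW h1 h2] := rst n i; have /andP[r0 _] := rT n i.
  exact: (measurable_filtrationS filtrFF r0 h2 tT' (mYbar (rT n i))).
(* On this cell the indicator is frozen at s. The right end point is left out because [grid_floor]
   jumps there when t is a grid point. *)
have gE w u : u \in `[s, t[%classic -> g w u = \1_D (Y s w) * psi w u.
  rewrite inE /= in_itv /= => /andP[su ut].
  rewrite /g (grid_floor_eq gth ths hs) ?su // psiE //.
  by rewrite (le_trans s0 su) (le_trans (ltW ut)).
have ipsi w : mu.-integrable `[s, t[ (EFin \o psi w).
  apply: integrableS (continuous_integrable s t (@psi_cont w)) => //.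
  by move=> u /=; rewrite !in_itv /= => /andP[-> /ltW ->].
have igst w : mu.-integrable `[s, t[ (EFin \o g w).
  have mst : measurable (`[s, t[ : set (measurableTypeR R)) by exact: measurable_itv.
  have := integrableZl mst (\1_D (Y s w)) (ipsi w).
  by apply: eq_integrable => // u us; rewrite /= gE // EFinM.
have st0 : `[0, t[%classic = `[0, s[%classic `|` `[s, t[%classic :> set R.
  by apply: itv_bndbnd_setU; rewrite bnd_simp // ltW.
have disj : [disjoint `[0, s[%classic & `[s, t[%classic :> set R].
  apply/disj_setPS => u [/=]; rewrite !in_itv /= => /andP[_ us] /andP[su _].
  by move: us; rewrite ltNge su.
have ig w : mu.-integrable `[0, t[ (EFin \o g w).
  by rewrite st0; apply: integrable_setU_disjoint.
split.
- move=> n; apply: measurable_funD; last exact: mA.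
  exact: (measurable_filtrationS filtrFF s0 (ltW st) tT').
- exact: ig.
- move=> w; rewrite st0 Rintegral_setU //; last by rewrite -st0.
  apply: cvgD; first exact: cR.
  have -> : \int[mu]_(u in `[s, t[) g w u = \1_D (Y s w) * \int[mu]_(u in `[s, t]) psi w u.
    rewrite -(Rintegral_itv_bndo_bndc (ipsi w)) -RintegralZl //.
    by apply: eq_Rintegral => u; exact: gE.
  apply: cvgMr; have := riemann_cvg st (@psi_cont w).
  apply: cvg_trans; apply: near_eq_cvg; apply: nearW => n /=.
  congr (_ * _); apply: eq_bigr => i _; rewrite /psi -/Dl -/(r_ n i).
  by have /andP[h1 h2] := rT n i; rewrite (min_idPr h2) (max_idPr h1).
move=> n.
have DlI : 0 < Dl <= mesh th by rewrite Dl0 (mesh_ge gth ths) // st.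
(* These bounds do not involve v and are read off at [v = 0]. *)
have [M0 K1 tauC _ [_ sqC DlC _]] := const DlI (introT andP (conj (lexx 0) vb0)).
have Dc x : D x -> [/\ Llip c V K x * (M * Num.sqrt Dl) <= C,
    c * (1 + 2 * (Llip c V K x) `^ iota) * Dl * (M * Num.sqrt Dl) <= C
  & step_eta Dl C (M * Num.sqrt Dl) (Llip c V K x) (c * (1 + 2 * (Llip c V K x) `^ iota)) <= Dl * omh].
  move=> Dx; have v01 : 0 <= V x <= vb by rewrite (V_ge0 VC) D_V.
  by have [_ _ _ ? [? _ _ ?]] := const DlI v01.
have stepE r : s < r <= t -> {ae P, forall w, scheme_eq s Y r w}.
  move=> srt; rewrite -(grid_lfloor_eq gth ths hs srt); apply: Ystep.
  by have /andP[h1 h2] := srt; rewrite (le_lt_trans s0 h1) (le_trans h2).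
have eta0 : 0 <= Dl * omh by rewrite mulr_ge0 // ltW.
have rI r : s <= r <= t -> 0 <= r <= T.
  by move=> /andP[h1 h2]; rewrite (le_trans s0 h1) (le_trans h2).
have mQ : measurable_fun [set: g_sigma_algebraType (FF s)] (fun w : g_sigma_algebraType (FF s) => expR (Rn n w)).
  by apply: measurableT_comp => //; exact: mR.
have step := one_step s0 st tT' M0 K1
  tauC sqC DlC Dc eta0 (Yad sT)
  (fun r sr => measurable_filtration filtrFF (rI r sr) (mY (rI r sr)))
  (fun r sr => measurable_filtration filtrFF (rI r sr) (mYbar (rI r sr)))
  stepE mQ (fun w => expR_ge0 _) (ltn0Sn n) (rst n).
apply: (@le_trans _ _ ((1 + 6 * (Dl * omh))%:E * ((expR (6 * (s * omh)))%:E * E0))%E); last first.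
  rewrite muleA -EFinM; apply: lee_wpmul2r.
    by apply: integral_ge0 => w _; rewrite lee_fin expR_ge0.
  rewrite lee_fin; have -> : 6 * (t * omh) = 6 * (Dl * omh) + 6 * (s * omh) by rewrite /Dl; ring.
  by rewrite expRD ler_wpM2r ?expR_ge0 // expR_ge1Dx.
apply: le_trans (_ : _ <= (1 + 6 * (Dl * omh))%:E * \int[P]_w
  (expR (Rn n w) * expR (expR (- (rho * s)) * V (Y s w)))%:E)%E _; last first.
  apply: lee_wpmul2l; first by rewrite lee_fin addr_ge0 // mulr_ge0.
  by under eq_integral do rewrite -expRD addrC; exact: bR.
under eq_integral do rewrite [Rn n _ + _]addrC addrA addrC expRD.
exact: step.
Qed.

Lemma exp_moment_le t : 0 <= t <= T ->
  (exp_moment P rho V Vbar D th Y t <= (expR (6 * (T * omh)))%:E * E0)%E.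
Proof.
move=> tT; have [Rn [mR ig cR bR]] := scheme_claim tT.
have /andP[t0 tT'] := tT.
rewrite /exp_moment unlock.
pose u n w := (expR (expR (- (rho * t)) * V (Y t w) + Rn n w))%:E : \bar R.
have E00 : (0 <= E0)%E by apply: integral_ge0 => w _; rewrite lee_fin expR_ge0.
(* The end point t is a null set, and the integrand, a limit of the [u n], is written as their lower
   limit to meet Fatou. *)
have uE w : (expR (V (Y t w) / expR (rho * t) + \int[mu]_(r in `[0, t]) g w r))%:E = limn_einf (u ^~ w).
  rewrite -(Rintegral_itv_bndo_bndc (ig w)) mulrC -expRN.
  have cu : u n w @[n --> \oo] -->
      (expR (expR (- (rho * t)) * V (Y t w) + \int[mu]_(r in `[0, t[) g w r))%:E.
    apply: cvg_EFin; first by apply: nearW.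
    have h : expR (- (rho * t)) * V (Y t w) + Rn n w @[n --> \oo] -->
        expR (- (rho * t)) * V (Y t w) + \int[mu]_(r in `[0, t[) g w r.
      by apply: cvgD; [exact: cvg_cst|exact: cR].
    exact: (cvg_comp _ _ h (@continuous_expR R _)).
  rewrite is_cvg_limn_einfE; last by apply/cvg_ex; eexists; exact: cu.
  by apply/esym/cvg_lim.
under eq_integral do rewrite -/(g _) uE.
apply: le_trans (fatou P measurableT (f := u) _ _) _.
- move=> n; apply/measurable_EFinP; apply: measurableT_comp => //; apply: measurable_funD.
    by apply: measurable_funM => //; exact: (measurable_filtration filtrFF tT (mY tT)).
  exact: (measurable_filtration filtrFF tT (mR n)).
- by move=> n w _; rewrite lee_fin expR_ge0.
rewrite limn_einf_lim; apply: lime_le; first exact: is_cvg_einfs.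
apply: nearW => n; apply: (@le_trans _ _ (\int[P]_w u n w)%E).
  by apply: ereal_inf_lbound; exists n => //=.
apply: le_trans (bR n) _; apply: lee_wpmul2r => //.
by rewrite lee_fin ler_expR ler_pM2l // ler_wpM2r.
Qed.

End induction.

End exponential_moments.

Theorem theorem3p3 (R : realType)
  (* the Hilbert spaces H and U with orthonormal bases HH and UU *)
  (H U : completeNormedModType R)
  (ipH : {dot H for idfun}) (ipU : {dot U for idfun})
  (hH : hilbert_norm ipH) (hU : hilbert_norm ipU)
  (sepH : separable_space H) (sepU : separable_space U)
  (HH : set H) (UU : set U)
  (HH0 : HH !=set0) (UU0 : UU !=set0)
  (basisHH : orthonormal_basis ipH HH) (basisUU : orthonormal_basis ipU UU)
  (T gamma delta : R)
  (T_gt0 : 0 < T) (gamma_ge0 : 0 <= gamma) (delta_bnd : 0 <= delta < 14^-1)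
  (lam : H -> R)
  (lam_lt0 : (ereal_sup [set (lam h)%:E | h in HH] < 0)%E)
  (* the filtered probability space and the cylindrical Wiener process *)
  (d : measure_display) (Omega : measurableType d) (P : probability Omega R)
  (FF : R -> set (set Omega)) (filtrFF : filtration T FF)
  (W : R -> U -> Omega -> R) (wienerW : cylindrical_wiener P T FF ipU W)
  (* the initial value and the coefficients *)
  (xi : Omega -> H)
  (xi_meas : random_element (FF 0)
     (interp ipH HH lam gamma) (interp_dist ipH HH lam gamma) xi)
  (F : H -> H)
  (F_meas : borel_measurable_on
     (interp ipH HH lam gamma) (interp_dist ipH HH lam gamma)
     setT (@norm_dist R H) F)
  (B : H -> U -> H)
  (B_meas : borel_measurable_on
     (interp ipH HH lam gamma) (interp_dist ipH HH lam gamma)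
     (hilbert_schmidt UU) (hs_dist UU) B)
  (D : set H -> R -> set H)
  (D_borel : forall I (h : R), I `<=` HH -> 0 < h <= T ->
     borel_on (interp ipH HH lam gamma) (interp_dist ipH HH lam gamma) (D I h))
  (* the Lyapunov-type functions *)
  (rho c iota varsigma : R)
  (rho_ge0 : 0 <= rho) (c_ge1 : 1 <= c) (iota_ge1 : 1 <= iota)
  (varsigma_bnd : 0 < varsigma < (1 - 14 * delta) / (2 + 2 * iota))
  (V Vbar : H -> R)
  (V_C3c : Cnc 3 c [set r | 0 <= r] V) (Vbar_cont : continuous Vbar)
  (V_semigroup : forall (h : R) x, 0 < h <= T ->
     V (semigroup ipH HH lam h x) <= V x)
  (Vbar_semigroup : forall (h : R) x, 0 < h <= T ->
     Vbar (semigroup ipH HH lam h x) <= Vbar x)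
  (Vbar_lip : forall x y,
     `|Vbar x - Vbar y| <=
       c * (1 + `|V x| `^ iota + `|V y| `^ iota) * `|x - y|)
  (Vbar_growth : forall x, `|Vbar x| <= c * (1 + `|V x| `^ iota))
  (xi_exp : (ereal_sup
     [set 'E_P[fun w => expR (V (orthoproj ipH I (xi w)))] | I in fsets HH]
       < +oo)%E)
  (DFB : forall I J (h : R) x, fsets HH I -> fsets UU J -> 0 < h <= T -> D I h x ->
     [/\ D I h `<=` [set v | V v <= c * h `^ (- varsigma)],
         Num.max `|orthoproj ipH I (F x)|
                 (hs_norm UU (fun u => orthoproj ipH I (B x (orthoproj ipU J u))))
           <= c * h `^ (- delta)
       & generator ipU ipH HH (fun y => orthoproj ipH I (F y))
           (fun y u => orthoproj ipH I (B y (orthoproj ipU J u))) V x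
         + 2^-1 * `|adjoint ipU ipH (fun u => orthoproj ipH I (B x (orthoproj ipU J u)))
                      (grad ipH V x)| ^+ 2
         + Vbar x <= rho * V x])
  (* the approximation processes *)
  (Y : set R -> set H -> set U -> R -> Omega -> H)
  (Y_adapted : forall th I J (t : R), grids T th -> fsets HH I -> fsets UU J ->
     0 <= t <= T ->
     random_element (FF t) (orthoproj ipH I @` interp ipH HH lam gamma)
       (@norm_dist R H) (Y th I J t))
  (Y_cont : forall th I J w, grids T th -> fsets HH I -> fsets UU J ->
     {within `[0, T], continuous (fun t => Y th I J t w)})
  (Y_init : forall th I J w, grids T th -> fsets HH I -> fsets UU J ->
     Y th I J 0 w = orthoproj ipH I (xi w))
  (Y_step : forall th I J (t : R), grids T th -> fsets HH I -> fsets UU J ->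
     0 < t <= T ->
     let s := grid_lfloor th t in
     let X := Y th I J s in
     let S := semigroup ipH HH lam (t - s) in
     let ind w : R := \1_(D I (mesh th)) (X w) in
     let PBP w u := orthoproj ipH I (B (X w) (orthoproj ipU J u)) in
     {ae P, forall w,
       Y th I J t w =
         S (X w + (ind w * (t - s)) *: orthoproj ipH I (F (X w))) +
         (1 + `|elementary_ito UU W PBP s t w| ^+ 2)^-1 *:
           elementary_ito UU W (fun w u => S (ind w *: PBP w u)) s t w}) :
  [/\ (mesh_limsup T (fun th =>
         ereal_sup [set ereal_sup [set ereal_sup [set
           exp_moment P rho V Vbar (D I (mesh th)) th (Y th I J) t
           | t in `[0%R, T]] | J in fsets UU] | I in fsets HH])
       <= ereal_sup
            [set 'E_P[fun w => expR (V (orthoproj ipH I (xi w)))] | I in fsets HH])%E,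
      (ereal_sup
         [set 'E_P[fun w => expR (V (orthoproj ipH I (xi w)))] | I in fsets HH]
       <= ereal_sup [set ereal_sup [set ereal_sup [set ereal_sup [set
            exp_moment P rho V Vbar (D I (mesh th)) th (Y th I J) t
            | t in `[0%R, T]] | J in fsets UU] | I in fsets HH]
            | th in grids T])%E
    & (ereal_sup [set ereal_sup [set ereal_sup [set ereal_sup [set
         exp_moment P rho V Vbar (D I (mesh th)) th (Y th I J) t
         | t in `[0%R, T]] | J in fsets UU] | I in fsets HH]
         | th in grids T] < +oo)%E].
Proof.
have Lg1 K : 1 <= K -> 1 <= Lgrow c K.
  by move=> K1; apply: (Lgrow_ge1 c_ge1); exact: le_trans K1.
have [C [K [om [C1 rhoC om_small [OB omB] const]]]] :=
  step_constants T_gt0 c_ge1 iota_ge1 rho_ge0 delta_bnd varsigma_bnd Lg1.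
set SE := ereal_sup _ in xi_exp *.
have mesh_T th : grids T th -> 0 < mesh th <= T by exact: mesh_itv.
(* Uniform in I, J and t: the bound depends on the grid only through its mesh. *)
have main th I J t : grids T th -> fsets HH I -> fsets UU J -> 0 <= t <= T ->
    (exp_moment P rho V Vbar (D I (mesh th)) th (Y th I J) t <=
     (expR (6 * (T * om (mesh th))))%:E * SE)%E.
  move=> gth fI fJ tT; have hT := mesh_T _ gth; have /andP[h0 hT'] := hT.
  have vb0 : 0 <= c * mesh th `^ (- varsigma).
    by rewrite mulr_ge0 ?powR_ge0 // (le_trans ler01).
  have DV x : D I (mesh th) x -> V x <= c * mesh th `^ (- varsigma).
    by move=> Dx; have [sub _ _] := DFB I J _ x fI fJ hT Dx; exact: sub.
  have Db x (Dx : D I (mesh th) x) := let: And3 _ FB_le gen_le := DFB I J _ x fI fJ hT Dx in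
    conj FB_le gen_le.
  have om0 : 0 <= om (mesh th) by have /andP[] := omB _ hT.
  have := exp_moment_le hH hU basisHH basisUU filtrFF wienerW B_meas fI fJ rho_ge0 c_ge1
    iota_ge1 V_C3c Vbar_cont V_semigroup Vbar_semigroup Vbar_lip Vbar_growth
    (D_borel I _ fI.2 hT) Db C1 rhoC T_gt0 gth DV vb0 om0 (fun Dl v => const _ Dl v hT)
    (fun t tT => Y_adapted th I J t gth fI fJ tT) (fun w => Y_cont th I J w gth fI fJ)
    (fun t tT => Y_step th I J t gth fI fJ tT) tT.
  move/le_trans; apply; apply: lee_wpmul2l; first by rewrite lee_fin expR_ge0.
  apply: ereal_sup_ubound; exists I => //; rewrite unlock.
  by apply: eq_integral => w _; rewrite Y_init.
have SE0 : (0 <= SE)%E.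
  apply: (@le_trans _ _ ('E_P[fun w => expR (V (orthoproj ipH set0 (xi w)))])%E).
    by apply: expectation_ge0 => w; exact: expR_ge0.
  by apply: ereal_sup_ubound; exists set0 => //; exact: fsets_set0.
have SEfin : SE = (fine SE)%:E by rewrite fineK // ge0_fin_numE.
split.
- apply/lee_addgt0Pr => e e0.
  (* Then [e^x] exceeds 1 by [e / (SE + 1)], so that [e^x SE <= SE + e]. *)
  pose x := ln (1 + e / (fine SE + 1)).
  have S1 : 0 < fine SE + 1 by rewrite ltr_wpDl // fine_ge0.
  have eS0 : 0 < e / (fine SE + 1) by rewrite divr_gt0.
  have x0 : 0 < x by rewrite ln_gt0 // ltrDl.
  have T6 : 0 < 6 * T by rewrite mulr_gt0.
  have [q q0 hq] := om_small _ (divr_gt0 x0 T6).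
  apply: (@le_trans _ _ (expR x * fine SE)%:E); last first.
    rewrite SEfin -EFinD lee_fin /x lnK ?posrE ?addr_gt0 // mulrDl mul1r lerD2l.
    rewrite mulrAC ler_pdivrMr // ler_wpM2l ?ltW //.
    by rewrite ltrDl.
  apply: le_trans (ereal_inf_lbound _) _; first by exists q.
  apply: ge_ereal_sup => _ [th [gth hth] <-].
  apply: ge_ereal_sup => _ [I fI <-]; apply: ge_ereal_sup => _ [J fJ <-].
  apply: ge_ereal_sup => _ [t tI <-]; have tT : 0 <= t <= T by move: tI; rewrite /= in_itv.
  apply: le_trans (main th I J t gth fI fJ tT) _.
  rewrite [in leLHS]SEfin -EFinM lee_fin ler_wpM2r ?fine_ge0 // ler_expR.
  have /andP[h0 _] := mesh_T _ gth.
  have /andP[_ omq] := hq (mesh th) (introT andP (conj h0 hth)).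
  by move: omq; rewrite ler_pdivlMr // mulrC mulrA.
- apply: ge_ereal_sup => _ [I fI <-].
  (* The coarsest grid, read at [t = 0], where the exponent is V at the projected initial value and
     the time integral vanishes. *)
  pose th0 : set R := [set 0; T].
  have gth0 : grids T th0.
    split; [exact: finite_set2| |by left|by right].
    by move=> x [->|->]; rewrite /= in_itv /= lexx ltW.
  apply: le_trans (ereal_sup_ubound _); last by exists th0.
  apply: le_trans (ereal_sup_ubound _); last by exists I.
  apply: le_trans (ereal_sup_ubound _); last by exists set0 => //; exact: fsets_set0.
  apply: le_trans (ereal_sup_ubound _); last by exists 0 => //=; rewrite in_itv /= lexx ltW.
  rewrite /exp_moment unlock le_eqVlt; apply/orP; left; apply/eqP.
  apply: eq_integral => w _; rewrite Y_init //; last exact: fsets_set0.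
  by rewrite mulr0 expR0 divr1 set_itv1 Rintegral_set1 addr0.
- apply: (@le_lt_trans _ _ ((expR (6 * (T * OB)))%:E * SE)%E); last first.
    by rewrite SEfin -EFinM ltry.
  apply: ge_ereal_sup => _ [th gth <-].
  apply: ge_ereal_sup => _ [I fI <-]; apply: ge_ereal_sup => _ [J fJ <-].
  apply: ge_ereal_sup => _ [t tI <-]; have tT : 0 <= t <= T by move: tI; rewrite /= in_itv.
  apply: le_trans (main th I J t gth fI fJ tT) _; apply: lee_wpmul2r => //.
  rewrite lee_fin ler_expR ler_pM2l // ler_wpM2l ?(ltW T_gt0) //.
  by have /andP[] := omB _ (mesh_T _ gth).
Qed.
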